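(* Let $C\subset\mathbb{P}^3$ be the curve over $\mathbb{Q}$ defined by $x^2+y^2+z^2+w^2=0$ and $x^3+y^3+z^3+w^3=0$. Then for every prime $p\ge 5$, over $\mathbb{F}_p$, $$L(J_C)=L(J_{C/(1,2)})\times L(J_{C/(1,2,3)})\times L(J_{C/(1,2,3,4)}).$$
   Context: The symmetric group $S_4$ acts on $C$ by permuting the coordinates, with $1,2,3,4$ identified with $x,y,z,w$ respectively; e.g. $(1,2,3)$ sends $x\mapsto y\mapsto z\mapsto x$ and fixes $w$. For $\sigma\in S_4$, $C/\sigma$ denotes the quotient curve $C/\langle\sigma\rangle$, i.e. the smooth projective curve whose function field is the subfield of the function field of $C$ fixed by $\sigma$. $J_X$ denotes the Jacobian of a curve $X$. For $p\ge5$ the curve $C$ has good reduction modulo $p$, and so do $J_C$ and the Jacobians of the quotient curves. $L(J_X)$ denotes the $L$-polynomial of the reduction modulo $p$ of $J_X$, i.e. the reciprocal polynomial $t^{2g}f(1/t)$ of the characteristic polynomial $f(t)$ of the Frobenius endomorphism of the reduction over $\mathbb{F}_p$ acting on the $\ell$-adic Tate module ($\ell\ne p$), where $g=\dim J_X$; for a curve over $\mathbb{F}_p$ this is the numerator of its zeta function. *)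

(* Defs.v *)
From HB Require Import structures.
From mathcomp Require Import all_boot all_order all_algebra all_fingroup.
From mathcomp Require Import mpoly.
From mathcomp Require Import boolp classical_sets functions cardinality fsbigop.

Set Implicit Arguments.
Unset Strict Implicit.
Unset Printing Implicit Defensive.

Import GRing.Theory.
Local Open Scope ring_scope.
Local Open Scope classical_set_scope.

(* Smooth projective curves are handled through their function fields, which
   are subfields of an ambient field, given as sets; the points of such a curve
   over an algebraically closed field of constants are the places of its
   function field.  The coordinates x, y, z, w have indices 0, 1, 2, 3. *)

Definition quadric (R : nzRingType) : {mpoly R[4]} := \sum_(i < 4) 'X_i ^+ 2.
Definition cubic (R : nzRingType) : {mpoly R[4]} := \sum_(i < 4) 'X_i ^+ 3.

(* K is the function field over k of the curve C in P^3 with homogeneous ideal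
   (quadric, cubic), and X are the homogeneous coordinates of its generic
   point.  Rational functions on C are quotients of forms of equal degree. *)
Definition function_field_of_C (k : fieldType) (K : fieldType)
    (iota : {rmorphism k -> K}) (X : 'I_4 -> K) : Prop :=
  (forall (d : nat) (P : {mpoly k[4]}), P \is d.-homog ->
     (mmap iota X P = 0 <->
      exists A B : {mpoly k[4]}, P = A * quadric k + B * cubic k)) /\
  (forall f : K, exists (d : nat) (P Q : {mpoly k[4]}),
     [/\ P \is d.-homog, Q \is d.-homog, mmap iota X Q != 0 &
         f = mmap iota X P / mmap iota X Q]).

(* On K only the quotients X i / X j are intrinsic, so that tau is determined
   by s (on a field K as above, if tau is moreover k-linear). *)
Definition permutes_coordinates (K : fieldType) (X : 'I_4 -> K)
    (s : 'S_4) (tau : K -> K) : Prop :=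
  forall i j : 'I_4, tau (X i / X j) = X (s i) / X (s j).

Definition cycle12 : 'S_4 := tperm (inord 0) (inord 1).
(* The product of permutations is read from left to right: 0 -> 1 -> 2 -> 0. *)
Definition cycle123 : 'S_4 :=
  (tperm (inord 0) (inord 1) * tperm (inord 0) (inord 2))%g.
(* 0 -> 1 -> 2 -> 3 -> 0 *)
Definition cycle1234 : 'S_4 :=
  (tperm (inord 0) (inord 1) * tperm (inord 0) (inord 2)
     * tperm (inord 0) (inord 3))%g.

(* Function field of C / <tau>. *)
Definition fixed_subfield (K : fieldType) (tau : K -> K) : set K :=
  [set f | tau f = f].

(* [specializes X x f a]: f lies in the local ring of the projective Z-scheme
   quadric = cubic = 0 at the generic point of its fibre at p, and a is its
   residue, a rational function on that fibre.  Here X is the generic point of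
   the curve in characteristic 0, and x the one of the fibre. *)
Definition specializes (K E : fieldType) (X : 'I_4 -> K) (x : 'I_4 -> E)
    (f : K) (a : E) : Prop :=
  exists (d : nat) (A B : {mpoly int[4]}),
    [/\ A \is d.-homog, B \is d.-homog,
        mmap intr X B != 0 /\ mmap intr x B != 0,
        f = mmap intr X A / mmap intr X B &
        a = mmap intr x A / mmap intr x B].

(* For F the function field of a quotient curve of C, this is the residue field
   of the valuation ring of F cut out by the local ring above, that is, the
   function field over F_p of the reduction of that quotient curve. *)
Definition reduction (K E : fieldType) (X : 'I_4 -> K) (x : 'I_4 -> E)
    (F : set K) : set E :=
  [set a | exists2 f, F f & specializes X x f a].

Definition is_subfield (E : fieldType) (S : set E) : Prop :=
  [/\ S 1, (forall a b, S a -> S b -> S (a - b)) &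
      (forall a b, S a -> S b -> S (a / b))].

(* Extension of the field of constants to k. *)
Definition extend_constants (k E : fieldType) (iota : {rmorphism k -> E})
    (F : set E) : set E :=
  smallest (@is_subfield E) (range iota `|` F).

Definition algebraic_closure_of_Fp (p : nat) (k : closedFieldType) : Prop :=
  p \in [pchar k] /\ (forall c : k, exists2 n, (0 < n)%N & c ^+ (p ^ n) = c).

(* The automorphism of E = k (x) F_p(C) that is the p-th power map on the
   constants k and the identity on F_p(C). *)
Definition is_frobenius (p : nat) (k E : fieldType) (iota : {rmorphism k -> E})
    (x : 'I_4 -> E) (phi : E -> E) : Prop :=
  (forall c : k, phi (iota c) = iota c ^+ p) /\
  (forall i j : 'I_4, phi (x i / x j) = x i / x j).

(* The places of the function field M over k, as valuation rings. *)
Definition is_place (k E : fieldType) (iota : {rmorphism k -> E})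
    (M V : set E) : Prop :=
  [/\ range iota `<=` V, V `<=` M, V <> M,
      (forall a b, V a -> V b -> V (a - b) /\ V (a * b)) &
      (forall a, M a -> V a \/ V a^-1)].

Definition is_unit (E : fieldType) (V : set E) (u : E) : Prop :=
  [/\ u != 0, V u & V u^-1].

Definition is_uniformizer (E : fieldType) (V : set E) (t : E) : Prop :=
  [/\ t != 0, V t, ~ is_unit V t & (forall a, V a -> ~ is_unit V a -> V (a / t))].

Definition has_order (E : fieldType) (V : set E) (f : E) (n : int) : Prop :=
  exists t u : E, [/\ is_uniformizer V t, is_unit V u & f = u * t ^ n].

(* A divisor is a function on all subsets of E, with finite support consisting
   of places of M. Places have degree 1, as k is algebraically closed. *)
Definition is_divisor (k E : fieldType) (iota : {rmorphism k -> E})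
    (M : set E) (D : set E -> int) : Prop :=
  finite_set [set V | D V != 0] /\ (forall V, D V != 0 -> is_place iota M V).

Definition degree (E : fieldType) (D : set E -> int) : int :=
  \sum_(V \in [set: set E]) D V.

Definition is_principal (k E : fieldType) (iota : {rmorphism k -> E})
    (M : set E) (D : set E -> int) : Prop :=
  exists f : E, [/\ M f, f != 0 &
    forall V, is_place iota M V -> has_order V f (D V)].

Definition lin_equiv (k E : fieldType) (iota : {rmorphism k -> E})
    (M : set E) (D D' : set E -> int) : Prop :=
  is_principal iota M (D - D').

(* The image of D under the Frobenius endomorphism V |-> phi(V) of the curve;
   the set phi @^-1` V is the place mapped to V. *)
Definition frob_divisor (E : fieldType) (phi : E -> E) (D : set E -> int) :
  set E -> int := fun V => D (phi @^-1` V).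

(* The l-adic Tate module of the Jacobian J.  J(k) is the group Pic^0 of
   divisors of degree 0 modulo linear equivalence, and an element of T_l J is a
   sequence (D n) of classes with l D(n+1) ~ D(n) and D(0) ~ 0 (so that D(n) is
   in the l^n-torsion).  Sequences with D(n) ~ D'(n) for all n are equal in
   T_l J. *)
Definition in_tate_module (k E : fieldType) (iota : {rmorphism k -> E})
    (M : set E) (l : nat) (D : nat -> set E -> int) : Prop :=
  [/\ (forall n, is_divisor iota M (D n) /\ degree (D n) = 0),
      lin_equiv iota M (D 0%N) 0 &
      (forall n, lin_equiv iota M (D n.+1 *+ l) (D n))].

(* The l-adic integers, as compatible sequences of representatives of elements
   of Z/l^n; such sequences are equal if congruent modulo l^n for all n. *)
Definition is_ladic (l : nat) (a : nat -> int) : Prop :=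
  forall n, (a n.+1 = a n %[mod (l ^ n)%N%:Z])%Z.

Definition is_tate_basis (k E : fieldType) (iota : {rmorphism k -> E})
    (M : set E) (l r : nat) (e : 'I_r -> nat -> set E -> int) : Prop :=
  [/\ (forall i, in_tate_module iota M l (e i)),
      (forall D, in_tate_module iota M l D ->
         exists2 a : 'I_r -> nat -> int, (forall i, is_ladic l (a i)) &
           forall n, lin_equiv iota M (D n) (\sum_i e i n *~ a i n)) &
      (forall a : 'I_r -> nat -> int, (forall i, is_ladic l (a i)) ->
         (forall n, lin_equiv iota M (\sum_i e i n *~ a i n) 0) ->
         forall i n, (a i n = 0 %[mod (l ^ n)%N%:Z])%Z)].

(* f is the characteristic polynomial of the Frobenius endomorphism on T_l J:
   A is its matrix over the l-adic integers in the basis e (with the image of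
   e i in row i). *)
Definition is_frob_char_poly (k E : fieldType) (iota : {rmorphism k -> E})
    (phi : E -> E) (M : set E) (l : nat) (f : {poly int}) : Prop :=
  exists (r : nat) (e : 'I_r -> nat -> set E -> int) (A : nat -> 'M[int]_r),
    [/\ is_tate_basis iota M l e,
        (forall i j, is_ladic l (fun n => A n i j)),
        (forall i n, lin_equiv iota M (frob_divisor phi (e i n))
                                      (\sum_j e j n *~ A n i j)),
        f \is monic /\ size f = r.+1 &
        (forall n m, ((char_poly (A n))`_m = f`_m %[mod (l ^ n)%N%:Z])%Z)].

(* t^d f(1/t), where d is the degree of f (d = 2 dim J below). *)
Definition reciprocal_poly (f : {poly int}) : {poly int} :=
  \poly_(i < size f) f`_((size f).-1 - i).

(* L is the L-polynomial of the Jacobian of the curve over F_p with function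
   field F, a set of elements of E. *)
Definition is_L_poly (k E : fieldType) (iota : {rmorphism k -> E})
    (phi : E -> E) (F : set E) (l : nat) (L : {poly int}) : Prop :=
  exists2 f : {poly int},
    is_frob_char_poly iota phi (extend_constants iota F) l f &
    L = reciprocal_poly f.

Lemma cycle123E : [/\ cycle123 (inord 0) = inord 1,
  cycle123 (inord 1) = inord 2, cycle123 (inord 2) = inord 0 &
  cycle123 (inord 3) = inord 3].
Proof.
by split; apply/val_inj; rewrite !permM !permE /= -!val_eqE /= !inordK //= ?inordK.
Qed.

Lemma cycle1234E : [/\ cycle1234 (inord 0) = inord 1,
  cycle1234 (inord 1) = inord 2, cycle1234 (inord 2) = inord 3 &
  cycle1234 (inord 3) = inord 0].
Proof.
by split; apply/val_inj; rewrite !permM !permE /= -!val_eqE /= !inordK //= ?inordK.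
Qed.

(* Main.v *)
(** Write [E] for the function field of C over k and [T] for its Tate module. As
  |s| is prime to p, the fixed field of s reduces to the fixed field of s acting
  on E. For a cyclic group H of automorphisms, pullback and pushforward of
  divisors between C and C/H are represented by matrices P and Q with
  P Q = |H| and Q P = sum_(h in H) h, and they commute with Frobenius F. So
  |H| tr(F^m | T(C/H)) = sum_(h in H) tr(F^m h | T).
  The quotient of C by V = <(1,2), (3,4)> is rational, with coordinate
  (x + y) / (z + w), so that sum_(h in V) h kills T up to torsion. Now
  h |-> tr(F^m h | T) is a class function, and this relation and its translates
  imply, for every m, that the trace of F^m on T is the sum of those on the Tate
  modules of the quotients by (1,2), (1,2,3) and (1,2,3,4). Newton's identities
  then give the equality of characteristic polynomials. The matrices are only
  used modulo l^n, where the identities hold up to a factor independent of n. *)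

Require Import Defs.
From HB Require Import structures.
From mathcomp Require Import all_boot all_order all_algebra all_fingroup.
From mathcomp Require Import cyclic mpoly finmap ring zify.
From mathcomp Require Import boolp classical_sets functions cardinality fsbigop.

Set Implicit Arguments.
Unset Strict Implicit.
Unset Printing Implicit Defensive.
Import Order.TTheory GRing.Theory Num.Theory.
Local Open Scope ring_scope.
Local Open Scope classical_set_scope.

(** * Newton's identities modulo prime powers *)

(** The rational quotient C/V serves twice. Every element of E is a root of a monic polynomial of
    degree |V| over its function field k(tau); this is how the places of E are shown to be discrete
    with residue field k. It also makes the sum over V vanish up to torsion.

    Divisors on a quotient C/H are handled through tame ramification, where a generator of each
    stabilizer is needed, so H is cyclic there. V is not cyclic; its relation is therefore proved on
    C itself. If N D = div f, the norm of f to k(tau) is a quotient of products of factors tau - c,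
    and their exponents are multiples of N up to ramification. The indices are at most |V|, hence
    divide |V|!, which is the factor independent of n.

    Bases of the Tate modules come with the given L-polynomials, and the equality of the ranks is
    the case m = 0 of the trace identity. In the relation between characters the quotients by (1,2),
    (1,2,3), (1,2,3,4) have weights 24/2, 24/3, 24/4, so that the factors |H| all turn into 24. *)

Lemma deriv_prod_seq (R : comNzRingType) (I : eqType) (s : seq I) (F : I -> {poly R}) :
  uniq s ->
  (\prod_(i <- s) F i)^`() = \sum_(i <- s) (F i)^`() * \prod_(j <- s | j != i) F j.
Proof.
elim: s => [|a s IHs] /=; first by rewrite !big_nil derivC.
case/andP=> a_s us; rewrite !big_cons derivM IHs //= eqxx /=; congr (_ * _ + _).
  rewrite [LHS]big_seq [RHS]big_seq_cond; apply: eq_bigl => i.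
  by case: eqP => [->|]; rewrite ?andbT // (negbTE a_s).
rewrite mulr_sumr; apply: eq_big_seq => i i_s.
rewrite big_cons; case: eqP i_s a_s => [->->//|_ _ _].
by rewrite mulrCA.
Qed.

(** Jacobi's formula: each row of X - A has a unit vector as derivative, so differentiating the
    determinant row by row leaves the diagonal cofactors. *)
Lemma deriv_char_poly (R : comNzRingType) n (A : 'M[R]_n) :
  (char_poly A)^`() = \tr (\adj (char_poly_mx A)).
Proof.
set M := char_poly_mx A.
have dM i j : (M i j)^`() = (i == j)%:R.
  by rewrite !mxE derivB derivC subr0 derivMn derivX; case: eqP.
rewrite /char_poly -/M /determinant raddf_sum /=.
have sgE (s : 'S_n) (q : {poly R}) : (-1) ^+ s * q = (-1) ^+ s *: q.
  by case: (s : bool); rewrite ?expr0 ?expr1 ?mul1r ?scale1r ?mulN1r ?scaleN1r.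
under eq_bigr => s _ do rewrite sgE derivZ deriv_prod_seq ?index_enum_uniq // scaler_sumr.
rewrite exchange_big /=; apply: eq_bigr => i _.
have -> : (\adj M) i i = cofactor M i i by rewrite mxE.
(* [M] with row i replaced by its derivative, the i-th unit row. *)
pose N := \matrix_(a, b) if a == i then (b == i)%:R else M a b.
have -> : cofactor M i i = \det N.
  rewrite (expand_det_row _ i) (bigD1 i) //= big1 ?addr0.
    rewrite !mxE !eqxx mul1r /cofactor; congr (_ * \det _).
    by apply/matrixP=> a b; rewrite !mxE [lift i a == i]eq_sym (negbTE (neq_lift _ _)).
  by move=> j /negbTE ji; rewrite mxE eqxx ji mul0r.
rewrite /determinant; apply: eq_bigr => s _.
rewrite sgE; congr (_ *: _).
rewrite [RHS](bigD1 i) //= [N i _]mxE eqxx dM eq_sym; congr (_ * _).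
by apply: eq_bigr => j /negbTE ji; rewrite [N j _]mxE ji.
Qed.

(** Let B_j be the matrix coefficients of adj(X - A) and p the characteristic polynomial. Then (X -
    A) adj(X - A) = p gives B_(j-1) - A B_j = p_j, and the trace of B_(j-1) is j p_j by the
    derivative formula. Multiplying by powers of A and taking traces telescopes, without any
    division. *)
Lemma char_poly_newton (R : comNzRingType) n (A : 'M[R]_n) i :
  (char_poly A)`_i *+ i =
  \sum_(m < n.+1) (char_poly A)`_(i + m) * \tr (A ^+ m).
Proof.
set p := char_poly A; set B := \adj (char_poly_mx A).
pose Bc j : 'M[R]_n := \matrix_(a, b) (B a b)`_j.
have [N BN] : exists N, Bc (i + (n + N))%N = 0.
  pose N := \max_a \max_b size (B a b); exists N.
  apply/matrixP=> a b; rewrite [LHS]mxE [RHS]mxE nth_default // addnA.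
  apply: leq_trans (leq_addl _ _).
  apply: leq_trans (@leq_bigmax_cond _ xpredT (fun a => \max_b size (B a b)) a isT).
  exact: (@leq_bigmax_cond _ xpredT (fun b => size (B a b)) b isT).
have eqB : char_poly_mx A *m B = p%:M by rewrite mul_mx_adj.
have eqB' j : (if j is j'.+1 then Bc j' else 0) - A *m Bc j = (p`_j)%:M.
  apply/matrixP=> a b; move/matrixP: eqB => /(_ a b) /(congr1 (fun q : {poly R} => q`_j)).
  rewrite /char_poly_mx mulmxBl mul_scalar_mx !mxE coefB coefXM.
  rewrite coef_sum coefMn; under eq_bigr => c _ do rewrite mxE coefCM.
  move=> <-. rewrite -if_neg; case: j => [|j] /=; rewrite !mxE; do ?congr (_ - _);
    by apply: eq_bigr => c _; rewrite mxE.
have trS m j : \tr (A ^+ m *m Bc j) = p`_j.+1 * \tr (A ^+ m) + \tr (A ^+ m.+1 *m Bc j.+1).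
  have/eqP := eqB' j.+1; rewrite subr_eq => /eqP ->.
  by rewrite mulmxDr mul_mx_scalar mxtraceD mxtraceZ mulmxA exprSr.
have trBc j : p`_j *+ j = p`_j * \tr (A ^+ 0) + \tr (A ^+ 1 *m Bc j).
  case: j => [|j].
    have/eqP := eqB' 0%N; rewrite sub0r eqr_oppLR expr1 => /eqP ->.
    have -> : \tr (A ^+ 0) = n%:R by exact: mxtrace1.
    by rewrite mulr0n linearN /= mxtrace_scalar mulr_natr subrr.
  rewrite -(coef_deriv p) deriv_char_poly -/B.
  have -> : (\tr B)`_j = \tr (A ^+ 0 *m Bc j).
    by rewrite expr0 mul1mx coef_sum; apply: eq_bigr => a _; rewrite [RHS]mxE.
  by rewrite trS expr0 expr1.
(* For K = n + N the remainder vanishes, as its index exceeds the degree of the adjugate. *)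
have sumN K :
  p`_i *+ i = \sum_(m < K.+1) p`_(i + m) * \tr (A ^+ m) + \tr (A ^+ K.+1 *m Bc (i + K)%N).
  elim: K => [|K IHK]; first by rewrite big_ord1 addn0.
  by rewrite IHK trS [in RHS]big_ord_recr /= addnS addrA.
rewrite (sumN (n + N)%N) BN mulmx0 mxtrace0 addr0.
rewrite [RHS](big_ord_widen (n + N).+1 (fun m => p`_(i + m) * \tr (A ^+ m))) ?ltnS ?leq_addr //.
rewrite [RHS]big_mkcond; apply: eq_bigr => m _; case: ltnP => // nm.
by rewrite nth_default ?mul0r // size_char_poly (leq_trans nm) ?leq_addl.
Qed.

Lemma char_poly_block_diag (R : comNzRingType) m n (A : 'M[R]_m) (B : 'M[R]_n) :
  char_poly (block_mx A 0 0 B) = char_poly A * char_poly B.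
Proof.
rewrite /char_poly /char_poly_mx (scalar_mx_block _ _ 'X) map_block_mx !map_mx0.
by rewrite opp_block_mx add_block_mx !oppr0 !addr0 det_ublock.
Qed.

Lemma exp_block_diag (R : comNzRingType) m n (A : 'M[R]_m) (B : 'M[R]_n) i :
  (block_mx A 0 0 B) ^+ i = block_mx (A ^+ i) 0 0 (B ^+ i).
Proof.
elim: i => [|i IHi]; first by rewrite !expr0 -scalar_mx_block.
rewrite exprS IHi -[LHS]/(_ *m _) mulmx_block !mul0mx !mulmx0 !addr0 !add0r.
by rewrite !exprS.
Qed.

Lemma dvdz_exp_eq0 (l : nat) (a : int) :
  (1 < l)%N -> (forall n, ((l ^ n)%N%:Z %| a)%Z) -> a = 0.
Proof.
move=> l_gt1 dv; apply/eqP; rewrite -absz_eq0; apply: contraTT (dv `|a|%N) => a0.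
rewrite /dvdz /=; apply: contraL (ltn_expl `|a| l_gt1) => /dvdn_leq.
by rewrite lt0n -leqNgt; apply.
Qed.

(** Newton's identity determines (i - r) f_i from the higher coefficients and the traces. Neither c
    nor i - r has to be invertible modulo l: the congruences for all n are first turned into an
    equality of integers, where both factors cancel. The traces with m = 0 give r = s. *)
Lemma eq_poly_of_traces (l c r s : nat) (f g : {poly int})
    (A : nat -> 'M[int]_r) (B : nat -> 'M[int]_s) :
  (1 < l)%N -> (0 < c)%N ->
  f \is monic -> size f = r.+1 -> g \is monic -> size g = s.+1 ->
  (forall n m, ((char_poly (A n))`_m = f`_m %[mod (l ^ n)%N%:Z])%Z) ->
  (forall n m, ((char_poly (B n))`_m = g`_m %[mod (l ^ n)%N%:Z])%Z) ->
  (forall n m, ((l ^ n)%N%:Z %| c%:Z * (\tr (A n ^+ m) - \tr (B n ^+ m)))%Z) ->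
  f = g.
Proof.
move=> l_gt1 c_gt0 f_mon sf g_mon sg fA gB AB.
have c_neq0 : c%:Z != 0 by rewrite -lt0n.
have tr0 d (M : 'M[int]_d) : \tr (M ^+ 0) = d%:R by exact: mxtrace1.
have eqrs : r = s.
  suff /eqP : c%:Z * (r%:R - s%:R) = 0.
    by rewrite mulf_eq0 (negbTE c_neq0) subr_eq0 eqr_nat => /eqP.
  by apply: dvdz_exp_eq0 l_gt1 _ => n; have := AB n 0%N; rewrite !tr0.
subst s.
have newton q (M : nat -> 'M[int]_r) n i :
    (forall n m, ((char_poly (M n))`_m = q`_m %[mod (l ^ n)%N%:Z])%Z) ->
    ((l ^ n)%N%:Z %| q`_i * (i%:R - r%:R) -
       \sum_(m < r) q`_(i + m.+1) * \tr (M n ^+ m.+1))%Z.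
  move=> qM; have := char_poly_newton (M n) i.
  rewrite big_ord_recl tr0 addn0 -[_ *+ i]mulr_natr => /eqP.
  rewrite addrC -subr_eq -mulrBr => /eqP nw.
  set z := (z in (_ %| z)%Z).
  have -> : z = (q`_i - (char_poly (M n))`_i) * (i%:R - r%:R) -
      \sum_(m < r) (q`_(i + m.+1) - (char_poly (M n))`_(i + m.+1)) * \tr (M n ^+ m.+1).
    under [X in _ - X]eq_bigr do rewrite mulrBl.
    rewrite sumrB mulrBl /z.
    have -> : \sum_(m < r) (char_poly (M n))`_(i + m.+1) * \tr (M n ^+ m.+1) =
        (char_poly (M n))`_i * (i%:R - r%:R) by rewrite nw.
    ring.
  have dv j : ((l ^ n)%N%:Z %| q`_j - (char_poly (M n))`_j)%Z.
    by rewrite -eqz_mod_dvd; apply/eqP/esym/qM.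
  rewrite rpredB ?dvdz_mulr // rpred_sum // => m _; exact: dvdz_mulr.
(* Descending induction from the leading coefficient, with [d] bounding the distance from i to r. *)
suff eqfg d i : (r <= i + d)%N -> f`_i = g`_i.
  by apply/polyP=> i; apply: (eqfg r); apply: leq_addl.
elim: d i => [|d IHd] i.
  rewrite addn0 leq_eqVlt => /predU1P[<-|lt_ri].
    by move/monicP: f_mon; move/monicP: g_mon; rewrite !lead_coefE sf sg => -> ->.
  by rewrite !nth_default ?sf ?sg.
case: (ltngtP r i) => [|lt_ir|<- _]; last 2 first.
- rewrite addnS -addSn => le_r.
  have IH m : f`_(i + m.+1) = g`_(i + m.+1).
    by apply: IHd; rewrite (leq_trans le_r) // leq_add2r -addSnnS leq_addr.
  suff /eqP : c%:Z * (f`_i - g`_i) * (i%:R - r%:R) = 0.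
    rewrite !mulf_eq0 (negbTE c_neq0) /= !subr_eq0 eqr_nat (ltn_eqF lt_ir) orbF.
    by move/eqP.
  apply: dvdz_exp_eq0 l_gt1 _ => n.
  have := newton f A n i fA; have := newton g B n i gB.
  set a := \sum_(_ < _) _; set b := \sum_(_ < _) _ => dg df.
  have dab : ((l ^ n)%N%:Z %| c%:Z * (b - a))%Z.
    rewrite -sumrB mulr_sumr rpred_sum // => m _.
    by rewrite IH -mulrBr mulrCA dvdz_mull.
  have -> : c%:Z * (f`_i - g`_i) * (i%:R - r%:R) =
    c%:Z * (f`_i * (i%:R - r%:R) - b) - c%:Z * (g`_i * (i%:R - r%:R) - a) + c%:Z * (b - a) by ring.
  by rewrite rpredD // rpredB // dvdz_mull.
- by move/monicP: f_mon; move/monicP: g_mon; rewrite !lead_coefE sf sg => -> ->.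
by move=> lt_ri _; rewrite !nth_default ?sf ?sg.
Qed.

(** * Class functions on S_4 *)

Local Notation o0 := (@Ordinal 4 0 isT).
Local Notation o1 := (@Ordinal 4 1 isT).
Local Notation o2 := (@Ordinal 4 2 isT).
Local Notation o3 := (@Ordinal 4 3 isT).

Lemma inord4E : [/\ inord 0 = o0, inord 1 = o1, inord 2 = o2 & inord 3 = o3].
Proof. by split; apply: val_inj; rewrite /= inordK. Qed.

Local Definition swapn (a b c : nat) := if c == a then b else if c == b then a else c.

Lemma val_tperm n (x y z : 'I_n) : tperm x y z = swapn x y z :> nat.
Proof. by rewrite permE /= -!val_eqE /swapn; case: (val z == val x); case: (val z == val y). Qed.

Local Ltac perm4 :=
  apply/permP=> -[[|[|[|[|//]]]] ?]; apply: val_inj;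
  rewrite [LHS]/= [RHS]/= ?expgS ?expg0; do ?rewrite !(permM, perm1, val_tperm);
  vm_compute; reflexivity.

Lemma perm_neq_at n (i : 'I_n) (s t : 'S_n) : s i != t i :> nat -> s != t.
Proof. by apply: contraNneq => ->. Qed.

Local Ltac perm4_neq :=
  solve [apply: (perm_neq_at (i := o0)); rewrite ?expgS ?expg0 /=;
         do ?rewrite !(permM, perm1, val_tperm); vm_compute; reflexivity
        |apply: (perm_neq_at (i := o2)); rewrite /=;
         do ?rewrite !(permM, perm1, val_tperm); vm_compute; reflexivity].

Lemma big_cycle (R : nmodType) (gT : finGroupType) (s : gT) (F : gT -> R) :
  \sum_(h in <[s]>%g) F h = \sum_(h <- traject (mulg s) 1%g #[s]%g) F h.
Proof.
rewrite big_uniq /=; first by apply: eq_bigl => h; rewrite cycle_traject.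
by apply/card_uniqP; rewrite size_traject -(eq_card (cycle_traject s)).
Qed.

Definition cycle34 : 'S_4 := tperm (inord 2) (inord 3).

Lemma cyclesE :
  [/\ cycle12 = tperm o0 o1, cycle34 = tperm o2 o3,
      cycle123 = (tperm o0 o1 * tperm o0 o2)%g &
      cycle1234 = (tperm o0 o1 * tperm o0 o2 * tperm o0 o3)%g].
Proof.
have [e0 e1 e2 e3] := inord4E.
by rewrite /cycle12 /cycle34 /cycle123 /cycle1234 e0 e1 e2 e3.
Qed.

Lemma order_cycles : [/\ #[cycle12]%g = 2%N, #[cycle123]%g = 3%N & #[cycle1234]%g = 4%N].
Proof.
have [-> _ -> ->] := cyclesE.
split; last first.
- set s := (_ * _)%g.
  have s4 : #[s]%g \in divisors 4 by rewrite -dvdn_divisors // order_dvdn; apply/eqP; perm4.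
  have s2 : ~~ (#[s]%g %| 2)%N by rewrite order_dvdn; perm4_neq.
  by move: s4 s2; rewrite !inE => /or3P[/eqP->|/eqP->|/eqP->].
- apply: nt_prime_order => //; first perm4.
  by perm4_neq.
- apply: nt_prime_order => //; first perm4.
  by perm4_neq.
Qed.

(* (1 + (1,2)) (1 + (3,4)) acts as 0 exactly on the irreducible representations
   sgn and std (x) sgn, and the identity holds for their characters. *)
Lemma class_fun_relation (R : comNzRingType) (chi : 'S_4 -> R) (c : R) :
  (forall g h, chi (g * h)%g = chi (h * g)%g) ->
  (forall h, c * (chi h + chi (cycle12 * h)%g + chi (cycle34 * h)%g
                  + chi (cycle12 * cycle34 * h)%g) = 0) ->
  c * (24%:R * chi 1%g) =
  c * (12%:R * \sum_(h in <[cycle12]>%g) chi h + 8%:R * \sum_(h in <[cycle123]>%g) chi h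
       + 6%:R * \sum_(h in <[cycle1234]>%g) chi h).
Proof.
move=> chiC; rewrite !big_cycle; have [-> -> ->] := order_cycles.
have [-> -> -> ->] := cyclesE => rel.
have conj x g g' : (g' * x = x * g)%g -> chi g' = chi g.
  by move=> e; rewrite -[g'](mulgK x) e -mulgA chiC mulgKV.
rewrite !big_cons !big_nil /= !mulg1 !addr0.
set t01 := tperm o0 o1; set t02 := tperm o0 o2; set t03 := tperm o0 o3.
set t23 := tperm o2 o3; set t12 := tperm o1 o2; set t13 := tperm o1 o3.
(* The relation at 1, at a transposition and at a double transposition outside V. With a, b, d, e
   the values on transpositions, 3-cycles, 4-cycles and double transpositions, c kills chi(1) + 2a +
   e, a + 2b + d and 2d + 2e. *)
have E1 := rel 1%g; have E2 := rel t02; have E3 := rel (t02 * t13)%g.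
rewrite !mulg1 (conj (t02 * t13)%g t01 t23) in E1; last by perm4.
rewrite (conj t12 t01 t02) in E2; last by perm4.
rewrite (conj (t13 * t12)%g (t01 * t02)%g (t23 * t02)%g) in E2; last by perm4.
rewrite (conj 1%g (t01 * t02 * t03)%g (t01 * t23 * t02)%g) in E2; last by perm4.
rewrite (conj t12 (t01 * t23)%g (t02 * t13)%g) in E3; last by perm4.
rewrite (conj (t12 * t13)%g (t01 * t02 * t03)%g (t01 * (t02 * t13))%g) in E3; last by perm4.
rewrite (conj t12 (t01 * t02 * t03)%g (t23 * (t02 * t13))%g) in E3; last by perm4.
rewrite (conj (t12 * t13)%g (t01 * t23)%g (t01 * t23 * (t02 * t13))%g) in E3; last by perm4.
set c3 := (t01 * t02)%g; set c4 := (c3 * t03)%g.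
rewrite (conj t12 c3 (c3 * c3)%g); last by perm4.
rewrite (conj t12 (t01 * t23)%g (c4 * c4)%g); last by perm4.
rewrite (conj t13 c4 (c4 * (c4 * c4))%g); last by perm4.
move: E1 E2 E3; rewrite -/c3 -/c4.
set a := chi t01; set b := chi c3; set d := chi c4; set e := chi (t01 * t23)%g.
move=> E1 E2 E3; apply/eqP; rewrite -subr_eq0; apply/eqP.
(* The right side minus the left side is c times 2 chi(1) + 12a + 16b + 12d + 6e. The coefficients
   of chi(1), b and d force the weights 2, 8 and 2; those of a and e then agree. *)
transitivity (- (2%:R * (c * (chi 1%g + a + a + e)) + 8%:R * (c * (a + b + b + d))
  + 2%:R * (c * (e + d + d + e)))); last by rewrite E1 E2 E3 !mulr0 !addr0 oppr0.
ring.
Qed.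

(** * Integral forms vanishing on the curve *)

Lemma mpoly_rmorph_ext n (R S : comNzRingType) (f g : {rmorphism {mpoly R[n]} -> S}) :
  (forall c, f c%:MP = g c%:MP) -> (forall i, f 'X_i = g 'X_i) -> f =1 g.
Proof.
move=> fgC fgX p; rewrite [p]mpolyE !rmorph_sum; apply: eq_bigr => m _.
rewrite -mul_mpolyC !rmorphM fgC mpolyXE_id !rmorph_prod; congr (_ * _).
by apply: eq_bigr => i _; rewrite !rmorphXn /= fgX.
Qed.

Lemma mmap_quadric (R S : comNzRingType) (f : {rmorphism R -> S}) (v : 'I_4 -> S) :
  mmap f v (quadric R) = \sum_i v i ^+ 2.
Proof. by rewrite /quadric rmorph_sum; apply: eq_bigr => i _; rewrite rmorphXn /= mmapX mmap1U. Qed.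

Lemma mmap_cubic (R S : comNzRingType) (f : {rmorphism R -> S}) (v : 'I_4 -> S) :
  mmap f v (cubic R) = \sum_i v i ^+ 3.
Proof. by rewrite /cubic rmorph_sum; apply: eq_bigr => i _; rewrite rmorphXn /= mmapX mmap1U. Qed.

(** * The quadric and the cubic form a regular sequence *)

Section RegularSequence.
Variable (F : fieldType).

(* F[x,y,z,w] as F[y,z,w][x], where the quadric is monic. *)
Let coord (i : 'I_4) : {poly {mpoly F[3]}} := oapp (fun j => ('X_j)%:P) 'X (unlift ord0 i).
Let unfold : {rmorphism {mpoly F[4]} -> {poly {mpoly F[3]}}} :=
  mmap (polyC \o @mpolyC 3 F) coord.
Let widen : {rmorphism {mpoly F[3]} -> {mpoly F[4]}} :=
  mmap (@mpolyC 4 F) (fun j => 'X_(lift ord0 j)).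
Let fold : {rmorphism {poly {mpoly F[3]}} -> {mpoly F[4]}} :=
  horner_eval ('X_ord0) \o map_poly widen.

Lemma unfoldK : cancel unfold fold.
Proof.
apply: (@mpoly_rmorph_ext _ _ _ (fold \o unfold) idfun) => [c|i] /=.
  by rewrite /= mmapC /= map_polyC /= /horner_eval hornerC mmapC.
rewrite mmapX mmap1U /coord; case: unliftP => [j ->|->] /=.
  by rewrite map_polyC /= /horner_eval hornerC mmapX mmap1U.
by rewrite map_polyX /horner_eval hornerX.
Qed.

Let r : {mpoly F[3]} := \sum_i 'X_i ^+ 2.
Let s : {mpoly F[3]} := \sum_i 'X_i ^+ 3.

Lemma coord_sum n : \sum_i coord i ^+ n = 'X ^+ n + (\sum_i 'X_i ^+ n)%:P.
Proof.
rewrite big_ord_recl /coord unlift_none /=; congr (_ + _).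
rewrite raddf_sum; apply: eq_bigr => i _ /=.
by rewrite liftK /= rmorphXn.
Qed.

Lemma exists_unfolding : exists (U : {rmorphism {mpoly F[4]} -> {poly {mpoly F[3]}}})
    (W : {rmorphism {poly {mpoly F[3]}} -> {mpoly F[4]}}),
  [/\ cancel U W, U (quadric F) = 'X ^+ 2 + r%:P & U (cubic F) = 'X ^+ 3 + s%:P].
Proof.
exists unfold, fold; split; first exact: unfoldK.
  by rewrite /unfold /= mmap_quadric coord_sum.
by rewrite /unfold /= mmap_cubic coord_sum.
Qed.

(** The quadric q = x^2 + r is monic in x. Modulo q the cubic c = x^3 + s becomes s - r x, whose
    norm s^2 + r^3 is nonzero, so c is not a zero divisor modulo q. Hence q divides B, and A is
    determined. *)
Lemma quadric_cubic_regular (A B : {mpoly F[4]}) :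
  2%:R != 0 :> F -> A * quadric F + B * cubic F = 0 ->
  exists H, A = - (H * cubic F) /\ B = H * quadric F.
Proof.
move=> F2 AB0; have [U [W [UK unfq unfc]]] := exists_unfolding.
(* Its value at (1,0,0) is 2. *)
have k0 : s ^+ 2 + r ^+ 3 != 0.
  pose e : {rmorphism {mpoly F[3]} -> F} := meval (fun i : 'I_3 => (i == ord0)%:R : F).
  have ev n : e (\sum_i 'X_i ^+ n.+1) = 1.
    rewrite rmorph_sum big_ord_recl rmorphXn /= mevalXU eqxx expr1n.
    by rewrite big1 ?addr0 // => i _; rewrite rmorphXn /= mevalXU expr0n.
  apply: contraNneq F2 => /(congr1 e); rewrite rmorphD !rmorphXn /= !ev !expr1n.
  by rewrite rmorph0 => /eqP.
move: k0 unfq unfc; move: (s) (r) => s' r'.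
move: (quadric F) (cubic F) AB0 => Q C AB0 k0.
set q := _ + r'%:P => unfq; set c := _ + s'%:P => unfc.
have q_mon : q \is monic by exact: monicXnaddC.
have q0 : q != 0 by exact: monic_neq0.
have := congr1 U AB0; rewrite rmorphD (rmorphM U A) (rmorphM U B) rmorph0 unfq unfc.
have [a eqa] : exists a, a = U A by exists (U A).
have [b eqb] : exists b, b = U B by exists (U B).
rewrite -eqa -eqb => eqab; pose k : {poly {mpoly F[3]}} := (s' ^+ 2 + r' ^+ 3)%:P.
(* From s^2 + r^3 = c (s - X^3) + q (X^4 - r X^2 + r^2), multiplied by b, with b c replaced by - a
   q. *)
pose z := - a * (s'%:P - 'X ^+ 3) + b * ('X ^+ 4 - 'X ^+ 2 * r'%:P + r'%:P ^+ 2).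
have bk : b * k = z * q.
  have -> : b * k = z * q + (a * q + b * c) * (s'%:P - 'X ^+ 3).
    by rewrite /z /k /q /c polyCD !polyC_exp; ring.
  by rewrite eqab mul0r addr0.
(* A nonzero remainder times the nonzero constant k would be a multiple of q of degree smaller than
   that of q. *)
have rho0 : Pdiv.Ring.rmodp b q = 0.
  have eqb' := Pdiv.RingMonic.rdivp_eq q_mon b.
  set h := Pdiv.Ring.rdivp b q in eqb'; set rho := Pdiv.Ring.rmodp b q in eqb' *.
  have rhok : rho * k = (z - h * k) * q.
    by rewrite mulrBl -bk [in RHS]eqb'; ring.
  have srho : (size rho < size q)%N by rewrite Pdiv.Ring.ltn_rmodp monic_neq0.
  apply/eqP; apply: contraLR srho => rho0; rewrite -leqNgt.
  have k0' : k != 0 by rewrite polyC_eq0.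
  have zk0 : z - h * k != 0.
    by apply: contraNneq (mulf_neq0 rho0 k0') => zk; rewrite rhok zk mul0r.
  have := congr1 (fun p : {poly _} => size p) rhok.
  rewrite size_mul // size_polyC k0 addn1 /= => ->.
  by rewrite size_mul // -ltnS prednK ?addn_gt0 ?lt0n ?size_poly_eq0 ?zk0 // -add1n leq_add2r
    lt0n size_poly_eq0.
have bE : b = Pdiv.Ring.rdivp b q * q by rewrite {1}(Pdiv.RingMonic.rdivp_eq q_mon b) rho0 addr0.
set h := Pdiv.Ring.rdivp b q in bE.
have aE : a = - (h * c).
  by apply: (mulIf q0); apply/eqP; rewrite -subr_eq0 mulNr opprK -mulrA [c * q]mulrC mulrA -bE eqab.
exists (W h); split; rewrite -[LHS]UK.
  by rewrite -eqa aE rmorphN rmorphM -unfc UK.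
by rewrite -eqb bE rmorphM -unfq UK.
Qed.
End RegularSequence.

Lemma mpoly_clear_denominators n (A : {mpoly rat[n]}) :
  exists N (A' : {mpoly int[n]}), N != 0 :> int /\ N%:~R *: A = map_mpoly intr A'.
Proof.
elim/mpolyind: A => [|c m A _ _ [N [A' [N0 eqA]]]].
  by exists 1, 0; split; rewrite ?scaler0 ?rmorph0.
exists (denq c * N), ((numq c * N) *: 'X_[m] + denq c *: A').
split; first by rewrite mulf_neq0 ?denq_neq0.
rewrite rmorphD /= !map_mpolyZ map_mpolyX -eqA scalerDr !scalerA -!intrM; congr (_ *: _ + _).
by rewrite /= !intrM numqE mulrAC [_ * c]mulrC.
Qed.

Lemma map_mpoly_quadric (R S : comNzRingType) (f : {rmorphism R -> S}) :
  map_mpoly f (quadric R) = quadric S.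
Proof. by rewrite /quadric rmorph_sum; apply: eq_bigr => i _; rewrite rmorphXn /= map_mpolyX. Qed.

Lemma map_mpoly_cubic (R S : comNzRingType) (f : {rmorphism R -> S}) :
  map_mpoly f (cubic R) = cubic S.
Proof. by rewrite /cubic rmorph_sum; apply: eq_bigr => i _; rewrite rmorphXn /= map_mpolyX. Qed.

Lemma intr_pchar_eq0 (R : nzRingType) (p : nat) (a : int) :
  p \in [pchar R] -> (a%:~R == 0 :> R) = (p %| a)%Z.
Proof.
move=> pc; case: a => n; first by rewrite -pmulrn -(dvdn_pcharf pc).
by rewrite NegzE mulrNz oppr_eq0 -pmulrn -(dvdn_pcharf pc) dvdzE abszN.
Qed.

Lemma map_mpoly_Fp_eq0 n (p : nat) (P : {mpoly int[n]}) :
  prime p -> map_mpoly (intr : int -> 'F_p) P = 0 -> exists P', P = p%:Z *: P'.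
Proof.
move=> p_prime P0; exists (\sum_(m <- msupp P) (P@_m %/ p)%Z *: 'X_[m]).
rewrite {1}[P]mpolyE scaler_sumr; apply: eq_bigr => m _; rewrite scalerA; congr (_ *: _).
have : (p %| P@_m)%Z by rewrite -(intr_pchar_eq0 _ (pchar_Fp p_prime)) -mcoeff_map_mpoly P0 mcoeff0.
by move/divzK => {1}<-; rewrite mulrC.
Qed.

Lemma map_mpoly_Fp_surj n (p : nat) (Q : {mpoly 'F_p[n]}) :
  exists P : {mpoly int[n]}, map_mpoly intr P = Q.
Proof.
elim/mpolyind: Q => [|c m Q _ _ [P <-]]; first by exists 0; rewrite rmorph0.
exists ((c : nat)%:Z *: 'X_[m] + P); rewrite rmorphD /= map_mpolyZ map_mpolyX.
by congr (_ *: _ + _); rewrite /= -pmulrn natr_Zp.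
Qed.

(** If p divides N, the relation A Q + B C = 0 holds modulo p, so by regularity (A, B) is congruent
    to a multiple H (-C, Q). Subtracting an integral lift of this trivial relation leaves
    coefficients divisible by p, and one factor p cancels from N. *)
Lemma ideal_saturated (p : nat) (P A B : {mpoly int[4]}) (N : int) :
  prime p -> (2 < p)%N -> N != 0 -> N *: P = A * quadric int + B * cubic int ->
  exists N' A' B', ~~ (p %| N')%Z /\ N' *: P = A' * quadric int + B' * cubic int.
Proof.
move=> p_prime p_gt2; have [n] := ubnP `|N|%N.
elim: n N A B => // n IHn N A B ltNn N0 eqNP.
have [pN|pN] := boolP (p %| N)%Z; last by exists N, A, B.
have F2 : 2%:R != 0 :> 'F_p.
  by rewrite -[2%:R]/(2%:~R) (intr_pchar_eq0 _ (pchar_Fp p_prime)) dvdzE /= gtnNdvd.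
pose red : {rmorphism {mpoly int[4]} -> {mpoly 'F_p[4]}} := map_mpoly intr.
have redp Q : red (p%:Z *: Q) = 0.
  rewrite /= map_mpolyZ /=; have /eqP -> : p%:~R == 0 :> 'F_p.
    by rewrite (intr_pchar_eq0 _ (pchar_Fp p_prime)) dvdzz.
  by rewrite scale0r.
have redAB : red A * quadric _ + red B * cubic _ = 0.
  have <- : red (quadric int) = quadric _ by apply: map_mpoly_quadric.
  have <- : red (cubic int) = cubic _ by apply: map_mpoly_cubic.
  have -> : red A * red (quadric int) + red B * red (cubic int) = red (N *: P).
    by rewrite eqNP rmorphD !rmorphM.
  by have /divzK := pN => <-; rewrite mulrC -scalerA; apply: redp.
have [H [eqA eqB]] := quadric_cubic_regular F2 redAB.
have [H' eqH] := map_mpoly_Fp_surj H.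
have [A' eqA'] : exists A', A + H' * cubic int = p%:Z *: A'.
  apply: map_mpoly_Fp_eq0 => //; rewrite -/(red _) rmorphD rmorphM /= eqH map_mpoly_cubic.
  by rewrite -/(red A) eqA addNr.
have [B' eqB'] : exists B', B - H' * quadric int = p%:Z *: B'.
  apply: map_mpoly_Fp_eq0 => //; rewrite -/(red _) rmorphB rmorphM /= eqH map_mpoly_quadric.
  by rewrite -/(red B) eqB subrr.
have p0 : p%:Z != 0 by rewrite -lt0n prime_gt0.
have [M NM] : exists M : int, N = M * p%:Z by exists (N %/ p)%Z; rewrite divzK.
apply: (IHn M A' B').
- rewrite ltnS NM abszM /= in ltNn; apply: leq_trans ltNn; rewrite ltn_Pmulr ?prime_gt1 //.
  by rewrite absz_gt0; apply: contraNneq N0 => M0; rewrite NM M0 mul0r.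
- by apply: contraNneq N0 => M0; rewrite NM M0 mul0r.
have pM0 : p%:Z%:MP_[4] != 0 by rewrite mpolyC_eq0.
apply: (mulfI pM0); rewrite !mul_mpolyC scalerA mulrC -NM eqNP scalerDr !scalerAl -eqA' -eqB'.
ring.
Qed.

Lemma mmap_map_mpoly n (R S T : comNzRingType) (f : {rmorphism R -> S})
    (g : {rmorphism S -> T}) (h : {rmorphism R -> T}) (v : 'I_n -> T) :
  (forall c, g (f c) = h c) ->
  forall P, mmap g v (map_mpoly f P) = mmap h v P.
Proof.
move=> gf; apply: (@mpoly_rmorph_ext _ _ _ (mmap g v \o map_mpoly f) (mmap h v)) => [c|i] /=.
  by rewrite map_mpolyC !mmapC /= gf.
by rewrite map_mpolyX !mmapX.
Qed.

(** Flatness of the integral model at p, which makes residues independent of the chosen forms.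
    Clearing denominators puts a multiple of P into the integral ideal; by saturation the multiplier
    can be taken prime to p, hence invertible in E. *)
Lemma vanishing_specializes (p : nat) (K E : fieldType) (iotaQ : {rmorphism rat -> K})
    (X : 'I_4 -> K) (x : 'I_4 -> E) (d : nat) (P : {mpoly int[4]}) :
  prime p -> (2 < p)%N -> p \in [pchar E] -> function_field_of_C iotaQ X ->
  \sum_i x i ^+ 2 = 0 -> \sum_i x i ^+ 3 = 0 ->
  P \is d.-homog -> mmap intr X P = 0 -> mmap intr x P = 0.
Proof.
move=> p_prime p_gt2 charE [KI _] x2 x3 homP PX0.
pose emb : {rmorphism {mpoly int[4]} -> {mpoly rat[4]}} := map_mpoly intr.
have intE c : iotaQ (intr c) = c%:~R by rewrite rmorph_int.
have homP' : emb P \is d.-homog.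
  move/dhomogP: homP => homP; apply/dhomogP=> m.
  by rewrite mcoeff_msupp mcoeff_map_mpoly intr_eq0 -mcoeff_msupp => /homP.
have /(KI d _ homP') [A [B eqAB]] : mmap iotaQ X (emb P) = 0.
  by rewrite (mmap_map_mpoly _ intE).
have [N1 [A' [N10 eqA]]] := mpoly_clear_denominators A.
have [N2 [B' [N20 eqB]]] := mpoly_clear_denominators B.
have eqNP : (N1 * N2) *: P = (N2 *: A') * quadric int + (N1 *: B') * cubic int.
  have emb_inj : injective emb.
    move=> Q1 Q2 /mpolyP eqQ; apply/mpolyP=> m; have := eqQ m.
    by rewrite !mcoeff_map_mpoly => /intr_inj.
  apply: emb_inj; rewrite rmorphD !rmorphM /= !map_mpolyZ map_mpoly_quadric map_mpoly_cubic.
  rewrite -/(emb P) eqAB -eqA -eqB !scalerA -!scalerAl scalerDr -!intrM.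
  by congr (_ *: _ + _); rewrite mulrC.
have [|N [A1 [B1 [pN eqN]]]] := ideal_saturated p_prime p_gt2 _ eqNP; first by rewrite mulf_neq0.
have := congr1 (mmap intr x) eqN; rewrite mmapZ rmorphD !rmorphM /= mmap_quadric mmap_cubic.
rewrite x2 x3 !mulr0 addr0 => /eqP; rewrite mulf_eq0 => /orP[|/eqP //].
by rewrite (intr_pchar_eq0 _ charE) (negbTE pN).
Qed.

(** * The function field of the curve *)

Section Subfield.
Variables (E : fieldType) (S : set E).
Hypothesis S_sub : is_subfield S.

Lemma subfield1 : S 1. Proof. by case: S_sub. Qed.
Lemma subfieldB a b : S a -> S b -> S (a - b). Proof. by case: S_sub => _ + _; apply. Qed.
Lemma subfield_div a b : S a -> S b -> S (a / b). Proof. by case: S_sub => _ _; apply. Qed.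
Lemma subfield0 : S 0. Proof. by rewrite -(subrr 1); apply: subfieldB; apply: subfield1. Qed.
Lemma subfieldN a : S a -> S (- a).
Proof. by move=> Sa; rewrite -sub0r; apply: subfieldB => //; exact: subfield0. Qed.
Lemma subfieldD a b : S a -> S b -> S (a + b).
Proof. by move=> Sa Sb; rewrite -[b]opprK; apply: subfieldB => //; apply: subfieldN. Qed.
Lemma subfieldV a : S a -> S a^-1.
Proof. by move=> Sa; rewrite -div1r; apply: subfield_div => //; exact: subfield1. Qed.
Lemma subfieldM a b : S a -> S b -> S (a * b).
Proof. by move=> Sa Sb; rewrite -[b]invrK; apply: subfield_div => //; apply: subfieldV. Qed.
Lemma subfield_exp a n : S a -> S (a ^+ n).
Proof. by move=> Sa; elim: n => [|n IHn]; [exact: subfield1|rewrite exprS; apply: subfieldM]. Qed.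
Lemma subfield_sum I (r : seq I) (P : pred I) F :
  (forall i, P i -> S (F i)) -> S (\sum_(i <- r | P i) F i).
Proof. by move=> SF; apply: big_ind => //; [exact: subfield0|exact: subfieldD]. Qed.
Lemma subfield_prod I (r : seq I) (P : pred I) F :
  (forall i, P i -> S (F i)) -> S (\prod_(i <- r | P i) F i).
Proof. by move=> SF; apply: big_ind => //; [exact: subfield1|exact: subfieldM]. Qed.
Lemma subfield_nat n : S n%:R.
Proof. by elim: n => [|n IHn]; [exact: subfield0|rewrite mulrS; apply: subfieldD => //;
  exact: subfield1]. Qed.
End Subfield.

Lemma mmap1_scale n (R : comNzRingType) (a : R) (y : 'I_n -> R) (m : 'X_{1..n}) :
  mmap1 (fun i => a * y i) m = a ^+ mdeg m * mmap1 y m.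
Proof.
rewrite /mmap1 mdegE -prodrXr -big_split /=; apply: eq_bigr => i _; exact: exprMn.
Qed.

Lemma mmap_scale n (R S : comNzRingType) (f : {rmorphism R -> S}) (a : S) (y : 'I_n -> S)
    d (P : {mpoly R[n]}) :
  P \is d.-homog -> mmap f (fun i => a * y i) P = a ^+ d * mmap f y P.
Proof.
move=> /dhomogP homP; rewrite /mmap mulr_sumr; apply: eq_big_seq => m /homP /= <-.
by rewrite mmap1_scale mulrCA.
Qed.

Lemma mmap_msym n (R S : comNzRingType) (f : {rmorphism R -> S}) (y : 'I_n -> S) (s : 'S_n) P :
  mmap f y (msym s P) = mmap f (y \o s) P.
Proof.
apply: (@mpoly_rmorph_ext _ _ _ (mmap f y \o msym s) (mmap f (y \o s))) => [c|i] /=.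
  by rewrite mmapC /msym !mmapC.
by rewrite /msym mmapX mmap1U !mmapX !mmap1U.
Qed.

Lemma msym_homog n (R : comNzRingType) (s : 'S_n) d (P : {mpoly R[n]}) :
  P \is d.-homog -> msym s P \is d.-homog.
Proof.
move=> /dhomogP homP; apply/dhomogP => m; rewrite mcoeff_msupp mcoeff_sym -mcoeff_msupp.
move=> /homP /= <-; rewrite !mdegE (reindex_inj (@perm_inj _ s)) /=.
by apply: eq_bigr => i _; rewrite mnmE.
Qed.

Section FunctionField.
Variables (k E : fieldType) (iota : {rmorphism k -> E}) (x : 'I_4 -> E).
Hypothesis E_C : function_field_of_C iota x.

Lemma sum_power_perm (s : 'S_4) n : \sum_i x (s i) ^+ n = \sum_i x i ^+ n.
Proof. by rewrite [RHS](reindex_inj (@perm_inj _ s)). Qed.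

Lemma ff_ideal d (P A B : {mpoly k[4]}) :
  P \is d.-homog -> P = A * quadric k + B * cubic k -> mmap iota x P = 0.
Proof. by move=> homP eqP; apply/(E_C.1 d) => //; exists A, B. Qed.

Lemma homog_power_sum (R : comNzRingType) n : (\sum_(i < 4) 'X_i ^+ n : {mpoly R[4]}) \is n.-homog.
Proof.
apply: rpred_sum => i _; have : ('X_i : {mpoly R[4]}) \is 1.-homog by rewrite dhomogX /= mdeg1.
by move/(dhomogMn n); rewrite mul1n.
Qed.

Lemma ff_quadric : \sum_i x i ^+ 2 = 0.
Proof.
rewrite -(mmap_quadric iota); apply: (@ff_ideal 2 _ 1 0); first exact: homog_power_sum.
by rewrite mul1r mul0r addr0.
Qed.

Lemma ff_cubic : \sum_i x i ^+ 3 = 0.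
Proof.
rewrite -(mmap_cubic iota); apply: (@ff_ideal 3 _ 0 1); first exact: homog_power_sum.
by rewrite mul1r mul0r add0r.
Qed.

Lemma ff_vanish_perm (s : 'S_4) d (P : {mpoly k[4]}) :
  P \is d.-homog -> mmap iota x P = 0 -> mmap iota (x \o s) P = 0.
Proof.
move=> homP /(E_C.1 d _ homP) [A [B ->]].
rewrite rmorphD !rmorphM /= mmap_quadric mmap_cubic /=.
by rewrite !(sum_power_perm s) ff_quadric ff_cubic !mulr0 addr0.
Qed.

Lemma ff_vanish_permE (s : 'S_4) d (P : {mpoly k[4]}) :
  P \is d.-homog -> (mmap iota (x \o s) P == 0) = (mmap iota x P == 0).
Proof.
move=> homP; apply/eqP/eqP; last exact: ff_vanish_perm homP.
rewrite -mmap_msym => /(ff_vanish_perm s^-1%g (msym_homog s homP)).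
rewrite mmap_msym; suff -> : (x \o s^-1%g) \o s = x by [].
by apply: funext => i /=; rewrite permK.
Qed.

(** The ideal has no linear forms: along the j-th coordinate axis its elements vanish to order at
    least 2 at the origin, whereas the linear form has the term c_j t. *)
Lemma ff_linear_indep (c : 'I_4 -> k) : \sum_i iota (c i) * x i = 0 -> forall i, c i = 0.
Proof.
move=> cx0 j; pose P : {mpoly k[4]} := \sum_i c i *: 'X_i.
have homP : P \is 1.-homog.
  by apply: rpred_sum => i _; apply: rpredZ; rewrite dhomogX /= mdeg1.
have [A [B eqP]] : exists A B, P = A * quadric k + B * cubic k.
  apply/(E_C.1 1) => //; rewrite -[RHS]cx0 /P rmorph_sum; apply: eq_bigr => i _.
  by rewrite [LHS]mmapZ mmapX mmap1U.
pose v (i : 'I_4) : {poly k} := (i == j)%:R%:P * 'X.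
have := congr1 (fun Q => (mmap polyC v Q)`_1) eqP.
rewrite rmorphD !rmorphM /= mmap_quadric mmap_cubic /P rmorph_sum /=.
have vX n : \sum_i v i ^+ n.+1 = 'X ^+ n.+1.
  rewrite (bigD1 j) //= big1 ?addr0 /v ?eqxx ?mul1r // => i /negbTE ->.
  by rewrite mul0r expr0n.
rewrite !vX coefD !coefMXn /= addr0 (bigD1 j) //= big1 => [|i /negbTE ij].
  by rewrite addr0 mmapZ mmapX mmap1U /v eqxx mul1r coefCM coefX mulr1.
by rewrite mmapZ mmapX mmap1U /v ij mul0r mulr0.
Qed.

Lemma ff_coord_neq0 i : x i != 0.
Proof.
apply/eqP=> xi0; suff /eqP : (i == i)%:R = 0 :> k by rewrite eqxx oner_eq0.
apply: (@ff_linear_indep (fun j => (j == i)%:R) _ i).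
rewrite (bigD1 i) //= big1 => [|j /negbTE ->]; first by rewrite xi0 mulr0 addr0.
by rewrite rmorph0 mul0r.
Qed.

Lemma mmap_ratio d (P : {mpoly k[4]}) j :
  P \is d.-homog -> mmap iota x P / x j ^+ d = mmap iota (fun i => x i / x j) P.
Proof.
move=> homP; rewrite mulrC -exprVn -(mmap_scale iota _ _ homP).
by congr mmap; apply: funext => i; rewrite mulrC.
Qed.

Lemma subfield_mmap (S : set E) (v : 'I_4 -> E) (P : {mpoly k[4]}) :
  is_subfield S -> range iota `<=` S -> (forall i, S (v i)) -> S (mmap iota v P).
Proof.
move=> S_sub kS Sv; apply: subfield_sum => // m _; apply: subfieldM => //.
  by apply: kS; exists P@_m.
by apply: subfield_prod => // i _; apply: subfield_exp.
Qed.

Lemma ff_generated (S : set E) (f : E) :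
  is_subfield S -> range iota `<=` S -> (forall i j, S (x i / x j)) -> S f.
Proof.
move=> S_sub kS Sx; have [d [P [Q [homP homQ _ ->]]]] := E_C.2 f.
have xd0 : x ord0 ^+ d != 0 by rewrite expf_neq0 // ff_coord_neq0.
have -> : mmap iota x P / mmap iota x Q =
    (mmap iota x P / x ord0 ^+ d) / (mmap iota x Q / x ord0 ^+ d).
  by rewrite invf_div mulrA divfK.
by apply: subfield_div => //; rewrite mmap_ratio //; apply: subfield_mmap.
Qed.

Lemma ff_rmorph_ext (F : fieldType) (f g : {rmorphism E -> F}) :
  (forall c, f (iota c) = g (iota c)) ->
  (forall i j, f (x i / x j) = g (x i / x j)) -> f =1 g.
Proof.
move=> fgC fgx a; apply: (@ff_generated [set a | f a = g a]) => //=.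
  split=> [|b c /= eb ec|b c /= eb ec]; first by rewrite /= !rmorph1.
    by rewrite !rmorphB /= eb ec.
  by rewrite !fmorph_div /= eb ec.
by move=> _ [c _ <-] /=.
Qed.

(** Evaluating a fraction of forms at y is well defined, because two fractions agree exactly when a
    certain form vanishes, and the same forms vanish at x and at y. *)
Lemma ff_morphism_exists (F : fieldType) (j : {rmorphism k -> F}) (y : 'I_4 -> F) :
  (forall d (P : {mpoly k[4]}), P \is d.-homog -> (mmap j y P == 0) = (mmap iota x P == 0)) ->
  exists g : {rmorphism E -> F},
    (forall c, g (iota c) = j c) /\ (forall i i', g (x i / x i') = y i / y i').
Proof.
move=> y_x.
pose rel (f : E) (b : F) := exists d (P Q : {mpoly k[4]}),
  [/\ P \is d.-homog, Q \is d.-homog, mmap iota x Q != 0,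
      f = mmap iota x P / mmap iota x Q & b = mmap j y P / mmap j y Q].
have y_neq0 d (Q : {mpoly k[4]}) :
    Q \is d.-homog -> mmap iota x Q != 0 -> mmap j y Q != 0.
  by move=> homQ; rewrite (y_x d).
have ex f : exists b, rel f b.
  have [d [P [Q [homP homQ Q0 ->]]]] := E_C.2 f.
  by exists (mmap j y P / mmap j y Q), d, P, Q.
have rel_uniq f b b' : rel f b -> rel f b' -> b = b'.
  move=> [d [P [Q [homP homQ Q0 -> ->]]]] [d' [P' [Q' [homP' homQ' Q0' eqf ->]]]].
  apply/eqP; rewrite eqr_div ?(y_neq0 d Q) ?(y_neq0 d' Q') // -subr_eq0 -!rmorphM -rmorphB.
  rewrite (y_x (d + d')%N); last first.
    by apply: rpredB; [|rewrite addnC]; apply: dhomogM.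
  by rewrite rmorphB !rmorphM subr_eq0 -eqr_div //; apply/eqP.
pose g f := projT1 (cid (ex f)).
have gP f : rel f (g f) by rewrite /g; case: cid.
have gE f b : rel f b -> g f = b by apply: rel_uniq.
have g1 : g 1 = 1.
  apply: gE; exists 0%N, 1, 1; rewrite !rmorph1 !divr1 oner_neq0.
  by split=> //; apply: dhomog1.
have gB : additive g.
  move=> f f'; have [d [P [Q [homP homQ Q0 -> eqg]]]] := gP f.
  have [d' [P' [Q' [homP' homQ' Q0' -> eqg']]]] := gP f'.
  rewrite eqg eqg'; apply: gE.
  exists (d + d')%N, (P * Q' - P' * Q), (Q * Q').
  rewrite !rmorphB !rmorphM mulf_neq0 //; split=> //.
  - by apply: rpredB; [|rewrite addnC]; apply: dhomogM.
  - exact: dhomogM.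
  - by rewrite -[- (_ / _)]mulNr addf_div // mulNr.
  - by rewrite -[- (_ / _)]mulNr addf_div ?(y_neq0 d Q) ?(y_neq0 d' Q') // mulNr.
have gM : multiplicative g.
  split=> // f f'; have [d [P [Q [homP homQ Q0 -> eqg]]]] := gP f.
  have [d' [P' [Q' [homP' homQ' Q0' -> eqg']]]] := gP f'.
  rewrite eqg eqg'; apply: gE; exists (d + d')%N, (P * P'), (Q * Q').
  by rewrite !rmorphM mulf_neq0 // !mulf_div; split=> //; apply: dhomogM.
pose gm : {rmorphism E -> F} := HB.pack g (GRing.isAdditive.Build E F g gB)
  (GRing.isMultiplicative.Build E F g gM).
exists gm; split=> [c|i i']; apply: gE.
  exists 0%N, c%:MP, 1; rewrite !rmorph1 !divr1 oner_neq0 !mmapC; split=> //.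
    by rewrite -[c%:MP]mulr1 mul_mpolyC; apply: rpredZ; apply: dhomog1.
  exact: dhomog1.
exists 1%N, 'X_i, 'X_i'; rewrite !mmapX !mmap1U ff_coord_neq0.
by split=> //; rewrite dhomogX /= mdeg1.
Qed.
End FunctionField.

(** * Automorphisms and fixed fields *)

(** The order is reversed because products in ['S_4] are read from left to right: g_s (g_t x_i) is
    x_(s (t i)), and s (t i) is the image of i under [t * s]. *)
Definition S4_action (E : fieldType) (g : 'S_4 -> {rmorphism E -> E}) :=
  (forall a, g 1%g a = a) /\ (forall s t a, g s (g t a) = g (t * s)%g a).

Definition fixed_by (E : fieldType) (g : 'S_4 -> {rmorphism E -> E}) (H : {group 'S_4}) : set E :=
  [set a | forall h, h \in H -> g h a = a].

Definition group_norm (E : fieldType) (g : 'S_4 -> {rmorphism E -> E}) (H : {group 'S_4}) (a : E) :=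
  \prod_(h in H) g h a.

Section Action.
Variables (E : fieldType) (g : 'S_4 -> {rmorphism E -> E}).
Hypothesis g_act : S4_action g.
Variable H : {group 'S_4}.

Lemma big_group_translate (R : Type) (idx : R) (op : Monoid.com_law idx) (F : 'S_4 -> R) t :
  t \in H -> \big[op/idx]_(h in H) F (h * t)%g = \big[op/idx]_(h in H) F h.
Proof.
move=> tH; rewrite [RHS](reindex_inj (mulIg t)) /=.
by apply: eq_bigl => h; rewrite groupMr.
Qed.

Lemma group_norm_fixed a : fixed_by g H (group_norm g H a).
Proof.
move=> t tH; rewrite /group_norm rmorph_prod.
under eq_bigr do rewrite g_act.2.
exact: (@big_group_translate _ _ _ (fun h => g h a)).
Qed.

Lemma group_norm_neq0 a : a != 0 -> group_norm g H a != 0.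
Proof. by move=> a0; apply/prodf_neq0 => h _; rewrite fmorph_eq0. Qed.

Lemma fixed_by_subfield : is_subfield (fixed_by g H).
Proof.
split=> [h _|a b aH bH h hH|a b aH bH h hH]; first exact: rmorph1.
  by rewrite rmorphB aH ?bH.
by rewrite fmorph_div aH ?bH.
Qed.

Lemma fixed_by_cycle s : fixed_by g <[s]>%G = [set a | g s a = a].
Proof.
apply/seteqP; split=> a /= aP; first by apply: aP; apply: cycle_id.
have gX i : g (s ^+ i)%g a = a.
  elim: i => [|i IHi]; first by rewrite expg0 g_act.1.
  by rewrite expgS -g_act.2 aP.
by move=> h /cycleP[i ->].
Qed.
End Action.

Section Automorphisms.
Variables (k E : fieldType) (iota : {rmorphism k -> E}) (x : 'I_4 -> E).
Hypothesis E_C : function_field_of_C iota x.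

Lemma ff_automorphisms_exist : exists g : 'S_4 -> {rmorphism E -> E},
  [/\ S4_action g, (forall s c, g s (iota c) = iota c) &
      (forall s, permutes_coordinates x s (g s))].
Proof.
have /choice[g gP] : forall s, exists g : {rmorphism E -> E},
    (forall c, g (iota c) = iota c) /\ permutes_coordinates x s g.
  move=> s; apply: (ff_morphism_exists E_C) => d P; exact: (ff_vanish_permE E_C s).
have gC s c : g s (iota c) = iota c by case: (gP s).
have gx s : permutes_coordinates x s (g s) by case: (gP s).
exists g; split=> //; split=> [a|s t a].
  apply: (ff_rmorph_ext E_C (g := idfun)) => [c|i j] /=; first exact: gC.
  by rewrite gx !perm1.
apply: (ff_rmorph_ext E_C (f := g s \o g t)) => [c|i j] /=; first by rewrite !gC.
by rewrite !gx !permM.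
Qed.

Variable g : 'S_4 -> {rmorphism E -> E}.
Hypothesis g_act : S4_action g.
Hypothesis gC : forall s c, g s (iota c) = iota c.
Hypothesis gx : forall s, permutes_coordinates x s (g s).

(** Dividing by the H-invariant linear form u makes H permute the affine coordinates y_i = x_i / u.
    An invariant fraction can be written with invariant numerator and denominator, and averaging
    over H expresses each of them through orbit sums of monomials. *)
Lemma fixed_sub_coordinates (H : {group 'S_4}) (c : 'I_4 -> k) (S : set E) (a : E) :
  let u := \sum_i iota (c i) * x i in
  u != 0 -> (forall h i, h \in H -> c (h i) = c i) -> #|H|%:R != 0 :> k ->
  is_subfield S -> range iota `<=` S ->
  (forall m : 'X_{1..4}, S (\sum_(h in H) mmap1 (fun i => x (h i) / u) m)) ->
  fixed_by g H a -> S a.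
Proof.
move=> u u0 cH H0 S_sub kS Sm Ha.
pose y i := x i / u; have x0 := ff_coord_neq0 E_C ord0.
have gy h i : h \in H -> g h (y i) = y (h i).
  move=> hH; have yE j : y j = (x j / x ord0) / \sum_j iota (c j) * (x j / x ord0).
    under eq_bigr do rewrite mulrA; rewrite -mulr_suml -/u invf_div mulrA divfK //.
  rewrite yE fmorph_div gx rmorph_sum.
  under eq_bigr => j _ do rewrite rmorphM gC gx -(cH h j) // mulrA.
  rewrite -mulr_suml /y invf_div mulrA divfK ?(ff_coord_neq0 E_C) //.
  by rewrite /u [in RHS](reindex_inj (@perm_inj _ h)).
have mmapy B h : h \in H -> g h (mmap iota y B) = mmap iota y (msym h B).
  move=> hH; rewrite mmap_msym /mmap rmorph_sum; apply: eq_bigr => m _.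
  rewrite rmorphM gC rmorph_prod; congr (_ * _); apply: eq_bigr => i _.
  by rewrite rmorphXn /= gy.
have fixS B : fixed_by g H (mmap iota y B) -> S (mmap iota y B).
  move=> fixB; have H0' : #|H|%:R != 0 :> E by rewrite -(rmorph_nat iota) fmorph_eq0.
  have -> : mmap iota y B = (\sum_(h in H) g h (mmap iota y B)) / #|H|%:R.
    rewrite (eq_bigr (fun=> mmap iota y B)); last by move=> h hH; exact: fixB.
    by rewrite sumr_const -[X in X / _]mulr_natr mulfK.
  apply: subfield_div => //; last exact: subfield_nat.
  under eq_bigr => h hH do rewrite mmapy // mmap_msym.
  rewrite exchange_big /=; apply: subfield_sum => // m _.
  by rewrite -mulr_sumr; apply: subfieldM => //; [apply: kS; exists B@_m | apply: Sm].
have [d [P [Q [homP homQ Q0 aE]]]] := E_C.2 a.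
have ud0 : u ^+ d != 0 by rewrite expf_neq0.
have scaleE (B : {mpoly k[4]}) : B \is d.-homog -> mmap iota y B = mmap iota x B / u ^+ d.
  move=> homB; rewrite mulrC -exprVn -(mmap_scale iota _ _ homB).
  by congr mmap; apply: funext => i; rewrite /y mulrC.
have {}aE : a = mmap iota y P / mmap iota y Q.
  by rewrite !scaleE // invf_div mulrA divfK.
have q0 : mmap iota y Q != 0 by rewrite scaleE // mulf_neq0 // invr_eq0.
set q := mmap iota y Q in q0 aE.
(* The fraction is expanded by the other conjugates of the denominator, which thus becomes a norm;
   the numerator is then invariant as well. *)
pose N := \prod_(h in H) msym h Q; pose N' := \prod_(h in H | h != 1%g) msym h Q.
have normq : group_norm g H q = mmap iota y N.
  by rewrite rmorph_prod; apply: eq_bigr => h hH; rewrite /q mmapy.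
have NE : N = Q * N' by rewrite /N (bigD1 1%g) //= msym1m.
have n0 : mmap iota y N != 0 by rewrite -normq; apply: group_norm_neq0.
have aN : a * mmap iota y N = mmap iota y (P * N').
  by rewrite NE !rmorphM /= aE -mulrA [_^-1 * _]mulrA mulVf // mul1r.
have Nfix : fixed_by g H (mmap iota y N) by rewrite -normq; apply: group_norm_fixed.
rewrite -[a](mulfK n0) aN; apply: subfield_div => //; apply: fixS => //.
by rewrite -aN => h hH; rewrite rmorphM Ha // Nfix.
Qed.

End Automorphisms.

Lemma closed_root_in_constants (k : closedFieldType) (E : fieldType) (iota : {rmorphism k -> E})
    (p : {poly k}) (a : E) :
  p != 0 -> root (map_poly iota p) a -> exists c, a = iota c.
Proof.
move=> p0; have [r pE] := closed_field_poly_normal p.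
rewrite pE map_polyZ rmorph_prod rootZ ?fmorph_eq0 ?lead_coef_eq0 //.
rewrite rootE horner_prod prodf_seq_eq0 => /hasP[c _] /=.
rewrite map_polyXsubC hornerXsubC subr_eq0 => /eqP ->.
by exists c.
Qed.

(** Trivial action on ratios only says that x_(s i) = lambda x_i for one lambda. The product of all
    coordinates gives lambda^4 = 1, so lambda is a constant, and linear independence of the
    coordinates forces s i = i. *)
Lemma ff_faithful (k : closedFieldType) (E : fieldType) (iota : {rmorphism k -> E})
    (x : 'I_4 -> E) (g : {rmorphism E -> E}) s :
  function_field_of_C iota x -> permutes_coordinates x s g ->
  (forall a, g a = a) -> s = 1%g.
Proof.
move=> E_C gx gs; pose lam := x (s ord0) / x ord0.
have x0 := ff_coord_neq0 E_C.
have xs i : x (s i) = lam * x i.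
  have /eqP := gx i ord0; rewrite gs eq_sym eqr_div // => /eqP e.
  by apply: (mulIf (x0 ord0)); rewrite e /lam mulrAC divfK // mulrC.
have prodx : \prod_i x i != 0 by apply/prodf_neq0.
have lam4 : lam ^+ 4 = 1.
  apply: (mulIf prodx); rewrite mul1r [in RHS](reindex_inj (@perm_inj _ s)) /=.
  by rewrite (eq_bigr _ (fun i _ => xs i)) big_split /= prodr_const card_ord.
have [c lamE] : exists c, lam = iota c.
  apply: (@closed_root_in_constants _ _ iota ('X^4 - 1)).
    by rewrite -size_poly_eq0 size_XnsubC.
  by rewrite rmorphB rmorph1 /= map_polyXn rootE !hornerE lam4 subrr.
apply/permP => i; rewrite perm1; apply/eqP; apply: contraT => si.
have := @ff_linear_indep _ _ _ _ E_C (fun j => (j == s i)%:R - c * (j == i)%:R) _ i.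
rewrite eq_sym (negbTE si) eqxx mulr1 sub0r => /(_ _)/eqP; rewrite oppr_eq0.
have -> : (c == 0) = false.
  by apply/eqP => c0; move/eqP: lam4; rewrite lamE c0 rmorph0 expr0n eq_sym oner_eq0.
apply; rewrite (eq_bigr (fun j => (j == s i)%:R * x j - lam * ((j == i)%:R * x j))); last first.
  by move=> j _; rewrite rmorphB rmorphM -lamE !rmorph_nat mulrBl mulrA.
rewrite sumrB -mulr_sumr (bigD1 (s i)) //= big1 => [|j /negbTE ->]; last by rewrite mul0r.
rewrite (bigD1 i) //= big1 => [|j /negbTE ->]; last by rewrite mul0r.
by rewrite !eqxx !mul1r !addr0 xs subrr.
Qed.

(** * The quotient by the group generated by (1,2) and (3,4) *)

Definition klein_seq : seq 'S_4 := [:: 1; cycle12; cycle34; cycle12 * cycle34]%g.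

Lemma klein_seq_uniq : uniq klein_seq.
Proof.
rewrite /klein_seq; have [-> -> _ _] := cyclesE.
rewrite /= !inE !negb_or -!andbA.
by do ?[apply/andP; split] => //; perm4_neq.
Qed.

Lemma klein_group_set : group_set [set h in klein_seq].
Proof.
apply/group_setP; split=> [|h t]; rewrite !inE ?eqxx //.
have [-> -> _ _] := cyclesE.
case/or4P=> /eqP->; case/or4P=> /eqP->; rewrite ?mul1g ?mulg1 ?eqxx ?orbT //; apply/or4P;
  solve [apply: Or41; apply/eqP; perm4|apply: Or42; apply/eqP; perm4
        |apply: Or43; apply/eqP; perm4|apply: Or44; apply/eqP; perm4].
Qed.
Definition klein : {group 'S_4} := Group klein_group_set.

Lemma big_klein (R : nmodType) (F : 'S_4 -> R) :
  \sum_(h in klein) F h = F 1%g + F cycle12 + F cycle34 + F (cycle12 * cycle34)%g.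
Proof.
rewrite (eq_bigl (mem klein_seq)) => [|h]; last by rewrite inE.
by rewrite -big_uniq ?klein_seq_uniq //= !big_cons big_nil addr0 !addrA.
Qed.

Lemma klein_perm : [/\ cycle12 o0 = o1, cycle12 o1 = o0, cycle12 o2 = o2 & cycle12 o3 = o3] /\
  [/\ cycle34 o0 = o0, cycle34 o1 = o1, cycle34 o2 = o3 & cycle34 o3 = o2].
Proof.
have [-> -> _ _] := cyclesE.
by do 2!split; apply: val_inj; rewrite [LHS]/= val_tperm.
Qed.

Lemma big_ord4 (R : Type) (idx : R) (op : Monoid.law idx) (F : 'I_4 -> R) :
  \big[op/idx]_(i < 4) F i = op (F o0) (op (F o1) (op (F o2) (F o3))).
Proof.
rewrite !big_ord_recl big_ord0 Monoid.mulm1.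
by congr (op (F _) (op (F _) (op (F _) (F _)))); apply: val_inj.
Qed.

Lemma subfield_sym2 (E : fieldType) (S : set E) (y z : E) a b :
  is_subfield S -> S (y + z) -> S (y * z) -> S (y ^+ a * z ^+ b + z ^+ a * y ^+ b).
Proof.
move=> S_sub Sa Sm.
have Spow n : S (y ^+ n + z ^+ n).
  suff [] : S (y ^+ n + z ^+ n) /\ S (y ^+ n.+1 + z ^+ n.+1) by [].
  elim: n => [|n [IH0 IH1]]; first by rewrite !expr0 !expr1; split=> //;
    apply: (subfield_nat S_sub 2).
  split=> //; have -> : y ^+ n.+2 + z ^+ n.+2 =
      (y + z) * (y ^+ n.+1 + z ^+ n.+1) - y * z * (y ^+ n + z ^+ n) by rewrite !exprS; ring.
  by apply: subfieldB => //; apply: subfieldM.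
wlog le_ab : a b / (a <= b)%N.
  move=> IH; case/orP: (leq_total a b) => [|/IH]; first exact: IH.
  by rewrite addrC [z ^+ b * _]mulrC [y ^+ b * _]mulrC.
rewrite -(subnK le_ab) !exprD.
have -> : y ^+ a * (z ^+ (b - a) * z ^+ a) + z ^+ a * (y ^+ (b - a) * y ^+ a) =
  (y * z) ^+ a * (y ^+ (b - a) + z ^+ (b - a)) by rewrite exprMn; ring.
by apply: subfieldM => //; apply: subfield_exp.
Qed.

Section Klein.
Variables (k E : fieldType) (iota : {rmorphism k -> E}) (x : 'I_4 -> E).
Hypothesis E_C : function_field_of_C iota x.
Hypotheses (k2 : 2%:R != 0 :> k) (k3 : 3%:R != 0 :> k).
Variable g : 'S_4 -> {rmorphism E -> E}.
Hypothesis g_act : S4_action g.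
Hypothesis gC : forall s c, g s (iota c) = iota c.
Hypothesis gx : forall s, permutes_coordinates x s (g s).

Definition klein_coord : E := (x o0 + x o1) / (x o2 + x o3).

Lemma klein_denom_neq0 : x o2 + x o3 != 0.
Proof.
apply/eqP => e; have /eqP : (1 < o2)%N%:R = 0 :> k; last by rewrite oner_eq0.
apply: (@ff_linear_indep _ _ _ _ E_C (fun i : 'I_4 => (1 < i)%N%:R)).
by rewrite big_ord4 /= !rmorph0 rmorph1 !mul0r !mul1r !add0r.
Qed.

Lemma klein_coord_not_constant c : klein_coord != iota c.
Proof.
apply/eqP => e; have /eqP : (o0 <= 1)%N%:R - c * (1 < o0)%N%:R = 0 :> k; last first.
  by rewrite mulr0 subr0 oner_eq0.
apply: (@ff_linear_indep _ _ _ _ E_C (fun i : 'I_4 => (i <= 1)%N%:R - c * (1 < i)%N%:R)).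
rewrite big_ord4 /= !mulr0 !mulr1 !subr0 !sub0r !rmorphN !rmorph1 -e !mul1r !mulNr.
transitivity (x o0 + x o1 - klein_coord * (x o2 + x o3)); first by ring.
by rewrite /klein_coord divfK ?subrr // klein_denom_neq0.
Qed.

(** With u = x_2 + x_3 one has y_2 + y_3 = 1 and y_0 + y_1 = tau. The two equations of the curve
    then determine the products y_0 y_1 and y_2 y_3 as rational functions of tau, and V-invariants
    are built from these four symmetric functions. *)
Lemma klein_fixed_generated (S : set E) a :
  is_subfield S -> range iota `<=` S -> S klein_coord -> fixed_by g klein a -> S a.
Proof.
move=> S_sub kS Stau Ha; set u := x o2 + x o3; have u0 : u != 0 := klein_denom_neq0.
have [[a0 a1 a2 a3] [b0 b1 b2 b3]] := klein_perm.
have natE n : n%:R != 0 :> k -> n%:R != 0 :> E by rewrite -(rmorph_nat iota) fmorph_eq0.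
have E2 := natE _ k2; have E3 := natE _ k3.
have klein_card : #|klein|%:R = 2%:R * 2%:R :> k.
  have := big_klein (fun=> 1 : k); rewrite sumr_const => ->; ring.
have uE : u = \sum_(i < 4) iota ((1 < i)%N%:R) * x i.
  by rewrite big_ord4 /= !rmorph0 rmorph1 !mul0r !mul1r !add0r.
have S1 := subfield1 S_sub.
pose y i := x i / u.
have Sy01 : S (y o0 + y o1) by rewrite /y -mulrDl.
have Sy23 : y o2 + y o3 = 1 by rewrite /y -mulrDl divff.
have tauE : y o0 + y o1 = klein_coord by rewrite /y -mulrDl.
have tau1 : klein_coord - 1 != 0.
  by rewrite subr_eq0 -(rmorph1 iota) klein_coord_not_constant.
have yn n : \sum_i y i ^+ n = (\sum_i x i ^+ n) / u ^+ n.
  by rewrite mulr_suml; apply: eq_bigr => i _; rewrite expr_div_n.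
have y2 : y o0 ^+ 2 + y o1 ^+ 2 + y o2 ^+ 2 + y o3 ^+ 2 = 0.
  by have := yn 2; rewrite (ff_quadric E_C) mul0r big_ord4 /= !addrA.
have y3 : y o0 ^+ 3 + y o1 ^+ 3 + y o2 ^+ 3 + y o3 ^+ 3 = 0.
  by have := yn 3; rewrite (ff_cubic E_C) mul0r big_ord4 /= !addrA.
pose t := klein_coord.
(* For T = y_0 y_1 and U = y_2 y_3 the equations read t^2 - 2T + 1 - 2U = 0 and t^3 - 3tT + 1 - 3U =
   0. Twice the second minus three times the first eliminates U. *)
have eqT : y o0 * y o1 = (2%:R * t ^+ 3 - 3%:R * t ^+ 2 - 1) / (2%:R * 3%:R * (t - 1)).
  apply: (mulIf (_ : 2%:R * 3%:R * (t - 1) != 0)); first by rewrite !mulf_neq0.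
  rewrite divfK ?mulf_neq0 //; apply/eqP; rewrite -subr_eq0; apply/eqP.
  have y3E : y o3 = 1 - y o2 by rewrite -Sy23; ring.
  transitivity (- (2%:R * (y o0 ^+ 3 + y o1 ^+ 3 + y o2 ^+ 3 + y o3 ^+ 3)
     - 3%:R * (y o0 ^+ 2 + y o1 ^+ 2 + y o2 ^+ 2 + y o3 ^+ 2))); last by rewrite y2 y3; ring.
  rewrite /t -tauE y3E; ring.
have eqV : y o2 * y o3 = (t ^+ 2 + 1) / 2%:R - y o0 * y o1.
  apply: (mulIf E2); rewrite mulrBl divfK //.
  have y3E : y o3 = 1 - y o2 by rewrite -Sy23; ring.
  apply/eqP; rewrite -subr_eq0; apply/eqP.
  transitivity (- (y o0 ^+ 2 + y o1 ^+ 2 + y o2 ^+ 2 + y o3 ^+ 2)); last by rewrite y2 oppr0.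
  rewrite /t -tauE y3E; ring.
have Snat n := subfield_nat S_sub n.
have ST : S (y o0 * y o1).
  rewrite eqT; apply: subfield_div => //.
    by do !apply: (subfieldB S_sub) => //; apply: subfieldM => //; apply: subfield_exp.
  by apply: subfieldM => //; [apply: subfieldM|apply: subfieldB].
have SV : S (y o2 * y o3).
  rewrite eqV; apply: subfieldB => //; apply: subfield_div => //.
  by apply: subfieldD => //; apply: subfield_exp.
apply: (fixed_sub_coordinates E_C g_act gC gx (H := klein)
  (c := fun i : 'I_4 => (1 < i)%N%:R)) Ha => //.
- by rewrite -uE.
- move=> h i; rewrite !inE; have ordE : [|| i == o0, i == o1, i == o2 | i == o3].
    by case: i => -[|[|[|[|//]]]].
  by case/or4P=> /eqP ->; case/or4P: ordE => /eqP ->;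
    rewrite ?permM ?perm1 ?(a0,a1,a2,a3) ?(b0,b1,b2,b3).
- by rewrite klein_card mulf_neq0.
(* The orbit sum of a monomial under V is the product of a symmetric sum in y_0, y_1 and one in y_2,
   y_3. *)
move=> m; rewrite -uE big_klein /mmap1 !big_ord4 /= !permM !perm1 !(a0,a1,a2,a3) !(b0,b1,b2,b3).
have := subfieldM S_sub (subfield_sym2 (m o0) (m o1) S_sub Sy01 ST)
  (subfield_sym2 (m o2) (m o3) S_sub (_ : S (y o2 + y o3)) SV).
rewrite Sy23 => /(_ S1); congr S; rewrite -/(y o0) -/(y o1) -/(y o2) -/(y o3); ring.
Qed.
End Klein.

(** * Frobenius and reduction of the quotients *)

Lemma frobenius_commutes (p : nat) (k E : fieldType) (iota : {rmorphism k -> E}) (x : 'I_4 -> E)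
    (phi g : {rmorphism E -> E}) s :
  function_field_of_C iota x -> is_frobenius p iota x phi ->
  (forall c, g (iota c) = iota c) -> permutes_coordinates x s g ->
  forall a, g (phi a) = phi (g a).
Proof.
move=> E_C [phiC phix] gC gx.
apply: (ff_rmorph_ext E_C (f := g \o phi) (g := phi \o g)) => [c|i j] /=.
  by rewrite gC phiC rmorphXn /= gC.
by rewrite phix !gx phix.
Qed.

(** On the constants this is perfectness of k: c = c^(p^n) is the p-th power of c^(p^(n-1)). Ratios
    of coordinates are fixed. *)
Lemma frobenius_surjective (p : nat) (k : closedFieldType) (E : fieldType)
    (iota : {rmorphism k -> E}) (x : 'I_4 -> E) (phi : {rmorphism E -> E}) :
  algebraic_closure_of_Fp p k -> function_field_of_C iota x -> is_frobenius p iota x phi ->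
  forall a, exists b, phi b = a.
Proof.
move=> [_ perfect] E_C [phiC phix] a.
apply: (ff_generated E_C (S := [set a | exists b, phi b = a])) => /=.
- split=> [|_ _ [b <-] [c <-]|_ _ [b <-] [c <-]]; first by exists 1; rewrite rmorph1.
    by exists (b - c); rewrite rmorphB.
  by exists (b / c); rewrite fmorph_div.
- move=> _ [c _ <-] /=; have [[//|n] _ cE] := perfect c.
  by exists (iota (c ^+ (p ^ n))); rewrite phiC -rmorphXn -exprM -expnSr cE.
- by move=> i j; exists (x i / x j).
Qed.

Lemma smallest_subfield (E : fieldType) (B : set E) : is_subfield (smallest (@is_subfield E) B).
Proof.
split=> [A [A_sub _]|a b aS bS A [A_sub BA]|a b aS bS A [A_sub BA]].
- exact: subfield1.
- by apply: subfieldB => //; [apply: aS|apply: bS].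
- by apply: subfield_div => //; [apply: aS|apply: bS].
Qed.

Section PermutedQuotient.
Variables (R : comNzRingType) (F : fieldType) (j : {rmorphism R -> F}) (y : 'I_4 -> F).
Variables (s : 'S_4) (sigma : {rmorphism F -> F}).
Hypothesis sigmaC : forall c, sigma (j c) = j c.
Hypothesis sigmay : permutes_coordinates y s sigma.
Hypothesis y0 : forall i, y i != 0.

(** [sigma] permutes only ratios of coordinates, so a form has to be made a polynomial in ratios
    before [sigma] is applied; the denominator is permuted too. *)
Lemma permuted_form d (A : {mpoly R[4]}) : A \is d.-homog ->
  sigma (mmap j y A / y ord0 ^+ d) = mmap j (y \o s) A / y (s ord0) ^+ d.
Proof.
move=> homA; have scaleE (z : 'I_4 -> F) : z ord0 != 0 ->
    mmap j z A / z ord0 ^+ d = mmap j (fun i => z i / z ord0) A.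
  move=> z0; rewrite mulrC -exprVn -(mmap_scale j _ _ homA).
  by congr mmap; apply: funext => i; rewrite mulrC.
rewrite (scaleE y (y0 _)) (scaleE (y \o s) (y0 _)) /=.
rewrite /mmap rmorph_sum; apply: eq_bigr => m _; rewrite rmorphM sigmaC rmorph_prod.
by congr (_ * _); apply: eq_bigr => i _; rewrite rmorphXn /= sigmay.
Qed.

Lemma permuted_quotient d (A B : {mpoly R[4]}) : A \is d.-homog -> B \is d.-homog ->
  sigma (mmap j y A / mmap j y B) = mmap j (y \o s) A / mmap j (y \o s) B.
Proof.
move=> homA homB.
have div_scale (a b c : F) : c != 0 -> a / b = (a / c) / (b / c).
  by move=> c0; rewrite invf_div mulrA divfK.
rewrite (div_scale _ _ (y ord0 ^+ d)) ?expf_neq0 // fmorph_div !permuted_form //.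
by rewrite -div_scale // expf_neq0.
Qed.

Lemma permuted_form_neq0 d (B : {mpoly R[4]}) : B \is d.-homog ->
  mmap j y B != 0 -> mmap j (y \o s) B != 0.
Proof.
move=> homB B0; suff : mmap j (y \o s) B / y (s ord0) ^+ d != 0.
  by apply: contraNneq => ->; rewrite mul0r.
by rewrite -permuted_form // fmorph_eq0 mulf_neq0 // invr_eq0 expf_neq0.
Qed.
End PermutedQuotient.

Section Reduction.
Variables (p : nat) (p_prime : prime p) (p_ge5 : (5 <= p)%N).
Variables (K : fieldType) (iotaQ : {rmorphism rat -> K}) (X : 'I_4 -> K).
Hypothesis K_C : function_field_of_C iotaQ X.
Variables (k E : fieldType) (iota : {rmorphism k -> E}) (x : 'I_4 -> E).
Hypothesis E_C : function_field_of_C iota x.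
Hypothesis char_k : p \in [pchar k].
Variables (s : 'S_4) (tau : {rmorphism K -> K}) (g : 'S_4 -> {rmorphism E -> E}).
Hypothesis tauP : permutes_coordinates X s tau.
Hypothesis g_act : S4_action g.
Hypothesis gC : forall s c, g s (iota c) = iota c.
Hypothesis gx : forall s, permutes_coordinates x s (g s).

Let specialize d (P : {mpoly int[4]}) :
  P \is d.-homog -> mmap intr X P = 0 -> mmap intr x P = 0.
Proof.
apply: (vanishing_specializes p_prime _ _ K_C); first exact: leq_trans p_ge5.
- by rewrite (fmorph_pchar iota).
- exact: ff_quadric E_C.
- exact: ff_cubic E_C.
Qed.

(** Invariance of A/B says that the form A^s B - A B^s vanishes at X; it then vanishes at x. *)
Lemma reduction_fixed_sub a :
  reduction X x (fixed_subfield tau) a -> g s a = a.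
Proof.
move=> [f /= tauf [d [A [B [homA homB [BX Bx] fE aE]]]]].
have Bxs : mmap intr (x \o s) B != 0.
  by apply: (permuted_form_neq0 _ (gx s) (ff_coord_neq0 E_C) homB) => // c; rewrite rmorph_int.
have BXs : mmap intr (X \o s) B != 0.
  by apply: (permuted_form_neq0 _ tauP (ff_coord_neq0 K_C) homB) => // c; rewrite rmorph_int.
rewrite aE (permuted_quotient _ (gx s) (ff_coord_neq0 E_C) homA homB); last first.
  by move=> c; rewrite rmorph_int.
move: tauf;
  rewrite /fixed_subfield /= fE (permuted_quotient _ tauP (ff_coord_neq0 K_C) homA homB); last first.
  by move=> c; rewrite rmorph_int.
move/eqP; rewrite eqr_div // -!mmap_msym -!rmorphM -subr_eq0 -rmorphB => /eqP.
move/(@specialize (d + d)%N); rewrite rmorphB 2!rmorphM /= => e.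
by apply/eqP; rewrite eqr_div //; [rewrite -subr_eq0 e|rewrite mmap_msym] => //;
  rewrite rpredB // dhomogM // msym_homog.
Qed.

Lemma sum_coord_neq0 (k' F : fieldType) (j : {rmorphism k' -> F}) (y : 'I_4 -> F) :
  function_field_of_C j y -> \sum_i y i != 0.
Proof.
move=> F_C; apply/eqP => e; have /eqP : 1 = 0 :> k'; last by rewrite oner_eq0.
apply: (ff_linear_indep F_C (c := fun=> 1) _ ord0).
by rewrite -[RHS]e; apply: eq_bigr => i _; rewrite rmorph1 mul1r.
Qed.

(** The same expression over the rationals is invariant and has this residue: its numerator is an
    integral form, and its denominator, a power of the sum of the coordinates, vanishes neither at X
    nor at x. *)
Lemma orbit_sum_reduction (m : 'X_{1..4}) :
  reduction X x (fixed_subfield tau)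
    (\sum_(h in <[s]>%g) mmap1 (fun i => x (h i) / \sum_j x j) m).
Proof.
pose A : {mpoly int[4]} := \sum_(h in <[s]>%g) msym h 'X_[m].
pose B : {mpoly int[4]} := (\sum_(i < 4) 'X_i ^+ 1) ^+ mdeg m.
have homA : A \is (mdeg m).-homog.
  by apply: rpred_sum => h _; apply: msym_homog; rewrite dhomogX.
have homB : B \is (mdeg m).-homog.
  by rewrite -[mdeg m]mul1n; apply: dhomogMn; apply: homog_power_sum.
have BE (F : comNzRingType) (y : 'I_4 -> F) : mmap intr y B = (\sum_i y i) ^+ mdeg m.
  rewrite /B rmorphXn rmorph_sum; congr (_ ^+ _); apply: eq_bigr => i _.
  by rewrite expr1 /= mmapX mmap1U.
have AE (F : comNzRingType) (y : 'I_4 -> F) :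
    mmap intr y A = \sum_(h in <[s]>%g) mmap1 (y \o h) m.
  by rewrite /A rmorph_sum; apply: eq_bigr => h _ /=; rewrite mmap_msym mmapX.
exists (mmap intr X A / mmap intr X B); last first.
  exists (mdeg m), A, B; split=> //.
    by rewrite !BE !expf_neq0 // (sum_coord_neq0 K_C, sum_coord_neq0 E_C).
  rewrite AE BE mulr_suml; apply: eq_bigr => h _; rewrite mulrC -exprVn -mmap1_scale.
  by congr mmap1; apply: funext => i; rewrite mulrC.
rewrite /fixed_subfield /= (permuted_quotient _ tauP (ff_coord_neq0 K_C) homA homB); last first.
  by move=> c; rewrite rmorph_int.
rewrite !AE !BE [X in _ = _ / X ^+ _](reindex_inj (@perm_inj _ s)) /=; congr (_ / _).
rewrite -[RHS](@big_group_translate <[s]>%G _ _ _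
  (fun h : 'S_4 => mmap1 (X \o h) m) _ (cycle_id s)).
apply: eq_bigr => h _; congr mmap1; apply: funext => i /=; by rewrite permM.
Qed.

(** Since the order of s divides 24, which is invertible in k, the invariants on E are generated by
    orbit sums, and these lift to invariants in characteristic 0. *)
Lemma reduction_fixedE :
  24%:R != 0 :> k ->
  extend_constants iota (reduction X x (fixed_subfield tau)) = fixed_by g <[s]>%G.
Proof.
move=> k24; have S_sub := smallest_subfield (range iota `|` reduction X x (fixed_subfield tau)).
apply/seteqP; split=> a.
  apply; split; first exact: fixed_by_subfield.
  move=> b [[c _ <-] h _|bR]; first exact: gC.
  by rewrite (fixed_by_cycle g_act) /=; apply: reduction_fixed_sub.
have uE : \sum_i iota 1 * x i = \sum_i x i.
  by apply: eq_bigr => i _; rewrite rmorph1 mul1r.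
apply: (fixed_sub_coordinates E_C g_act gC gx (c := fun=> 1)) => //.
- by rewrite uE (sum_coord_neq0 E_C).
- have dvd24 : (#|<[s]>%G| %| 24)%N.
    have -> : 24%N = #|[set: 'S_4]%G| by rewrite cardsT card_Sn.
    by apply: cardSg; apply: finset.subsetT.
  by apply: contraNneq k24 => /eqP; case/dvdnP: dvd24 => q ->; rewrite natrM => /eqP ->;
    rewrite mulr0.
- by move=> b bk A [_]; apply; left.
- move=> m A [_]; apply; right; rewrite uE; exact: orbit_sum_reduction.
Qed.
End Reduction.

(** * Valuation rings *)

Section Subring.
Variables (E : fieldType) (R : set E).
Hypothesis R1 : R 1.
Hypothesis RBM : forall a b, R a -> R b -> R (a - b) /\ R (a * b).

Lemma subringB a b : R a -> R b -> R (a - b). Proof. by move=> Ra Rb; case: (RBM Ra Rb). Qed.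
Lemma subringM a b : R a -> R b -> R (a * b). Proof. by move=> Ra Rb; case: (RBM Ra Rb). Qed.
Lemma subring0 : R 0. Proof. by rewrite -(subrr 1); apply: subringB. Qed.
Lemma subringN a : R a -> R (- a).
Proof. by move=> Ra; rewrite -sub0r; apply: subringB => //; exact: subring0. Qed.
Lemma subringD a b : R a -> R b -> R (a + b).
Proof. by move=> Ra Rb; rewrite -[b]opprK; apply: subringB => //; apply: subringN. Qed.
Lemma subring_exp a n : R a -> R (a ^+ n).
Proof. by move=> Ra; elim: n => [//|n IHn]; rewrite exprS; apply: subringM. Qed.
Lemma subring_sum I (r : seq I) (P : pred I) F :
  (forall i, P i -> R (F i)) -> R (\sum_(i <- r | P i) F i).
Proof. by move=> RF; apply: big_ind => //; [exact: subring0|exact: subringD]. Qed.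
Lemma subring_horner (p : {poly E}) a : (forall i, R p`_i) -> R a -> R p.[a].
Proof.
move=> Rp Ra; rewrite horner_coef; apply: subring_sum => i _.
by apply: subringM => //; apply: subring_exp.
Qed.
End Subring.

(** * Existence of valuation rings over a given subring and ideal *)

Section PlaceExtension.
Variables (E : fieldType) (A I : set E).
Hypotheses (A1 : A 1) (ABM : forall a b, A a -> A b -> A (a - b) /\ A (a * b)).
Hypothesis IA : I `<=` A.
(** As a consequence the ideal generated by I in any ring R containing A consists of single products
    i r, so that sums need not be carried along. Both principal ideals and the maximal ideal of a
    valuation ring have this property. *)
Hypothesis I_directed : forall i j, I i -> I j ->
  exists m a b, [/\ I m, A a, A b, i = a * m & j = b * m].
Hypothesis I_nonunit : forall i, I i -> i != 0 -> ~ A i^-1.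

(* The subrings over A in which the elements of I remain non-units; a maximal
   one is a valuation ring. *)
Let good (R : set E) := [/\ A `<=` R, (forall a b, R a -> R b -> R (a - b) /\ R (a * b)) &
  forall i, I i -> i != 0 -> ~ R i^-1].

Lemma exists_maximal_good : exists2 R, good R & forall R', good R' -> R `<=` R' -> R' = R.
Proof.
have gA : good A by split.
pose rel (R R' : {R : set E | good R}) := `[< sval R `<=` sval R' >].
have [|||chain chainP|[R gR] Rmax] := @Zorn {R : set E | good R} rel.
- by move=> R; apply/asboolP.
- by move=> R1 R2 R3 /asboolP le12 /asboolP le23; apply/asboolP => a /le12 /le23.
- move=> [R1 g1] [R2 g2] /asboolP /= le12 /asboolP /= le21.
  have eR : R1 = R2 by apply/seteqP; split.
  by subst R2; congr exist; apply: Prop_irrelevance.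
- have [[R0 cR0]|nochain] := pselect (exists R0, chain R0); last first.
    by exists (exist _ A gA) => R cR; case: nochain; exists R.
  pose U : set E := [set a | exists2 R, chain R & sval R a].
  have gU : good U.
    split=> [a Aa|a b [R cR Ra] [R' cR' R'b]|i Ii i0 [R cR Ri]].
    - by exists R0 => //; case: (svalP R0) => + _ _; apply.
    - case: (chainP _ _ cR cR') => /asboolP le.
        have [_ clo _] := svalP R'; have [] := clo _ _ (le _ Ra) R'b.
        by split; exists R'.
      have [_ clo _] := svalP R; have [] := clo _ _ Ra (le _ R'b).
      by split; exists R.
    - by case: (svalP R) => _ _ /(_ i Ii i0).
  by exists (exist _ U gU) => R cR; apply/asboolP => a Ra; exists R.
exists R => // R' gR' RR'.
have RR'b : rel (exist _ R gR) (exist _ R' gR') by apply/asboolP.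
exact: (congr1 sval (Rmax _ RR'b)).
Qed.

Section Maximal.
Variable R : set E.
Hypotheses (gR : good R) (R_max : forall R', good R' -> R `<=` R' -> R' = R).

Let AR : A `<=` R. Proof. by case: gR. Qed.
Let R1 : R 1. Proof. exact: AR. Qed.
Let RBM a b : R a -> R b -> R (a - b) /\ R (a * b). Proof. by case: gR => _ + _; apply. Qed.
Let Rnonunit i : I i -> i != 0 -> ~ R i^-1. Proof. by case: gR => _ _; apply. Qed.
Let RB a b := @subringB _ _ RBM a b.
Let RM a b := @subringM _ _ RBM a b.
Let RD a b := @subringD _ _ R1 RBM a b.
Let RX a n := @subring_exp _ _ R1 RBM a n.

(** Inverting u = 1 - i r keeps the elements of I non-units, so u is already invertible by
    maximality. Indeed, if u^n / j is in R, where u^n = 1 - i r', then writing i = a m and j = b m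
    gives 1 = m (b u^n / j + a r'), making m a unit. *)
Lemma maximal_good_unit i r : I i -> R r -> 1 - i * r != 0 /\ R (1 - i * r)^-1.
Proof.
move=> Ii Rr; set u := 1 - i * r; have Ri : R i by apply/AR/IA.
have Ru : R u by apply: RB => //; apply: RM.
have not_unit j b : I j -> R b -> 1 != j * b.
  move=> Ij Rb; apply/eqP => jb; have j0 : j != 0.
    by apply: contra_eq_neq jb => ->; rewrite mul0r oner_neq0.
  by apply: (Rnonunit Ij j0); rewrite -[j^-1]mulr1 jb mulKf.
have u0 : u != 0 by rewrite subr_eq0; apply: not_unit.
split=> //; pose R' := [set c | exists n, R (c * u ^+ n)].
have RR' : R `<=` R' by move=> a Ra; exists 0%N; rewrite mulr1.
suff gR' : good R' by rewrite -(R_max gR' RR'); exists 1%N; rewrite mulVf.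
split=> [a /AR /RR' //|a b [n an] [m bm]|j Ij j0 [n jn]].
  split; exists (n + m)%N; last by rewrite exprD mulrACA; apply: RM.
  rewrite mulrBl exprD; apply: RB; first by rewrite mulrA; apply: RM => //; apply: RX.
  by rewrite [_ ^+ n * _]mulrC mulrA; apply: RM => //; apply: RX.
have [r' Rr' un] : exists2 r', R r' & u ^+ n = 1 - i * r'.
  elim: n {jn} => [|n [r' Rr' IHn]]; first by exists 0; [exact: subring0|rewrite mulr0 subr0].
  exists (r + r' - i * r * r'); last by rewrite exprS IHn /u; ring.
  by apply: RB; [apply: RD|do !apply: RM].
have [m [a [b [Im Aa Ab iE jE]]]] := I_directed Ii Ij.
have Rz : R (b * (j^-1 * u ^+ n) + a * r') by apply: RD; apply: RM => //; apply: AR.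
have /eqP[] := not_unit _ _ Im Rz.
by rewrite mulrDr !mulrA ![m * _]mulrC -iE -jE mulfV // mul1r un subrK.
Qed.

(** By maximality R[a] is not good, so some element of I becomes invertible in it. *)
Lemma maximal_good_degree a : ~ R a ->
  exists i (p : {poly E}), [/\ I i, i != 0, forall t, R p`_t & 1 = i * p.[a]].
Proof.
move=> nRa; pose R' := [set c | exists2 p : {poly E}, (forall t, R p`_t) & c = p.[a]].
have RR' : R `<=` R'.
  move=> c Rc; exists c%:P; last by rewrite hornerC.
  by move=> t; rewrite coefC; case: ifP => // _; exact: subring0.
have [gR'|ngR'] := pselect (good R').
  case: nRa; rewrite -(R_max gR' RR'); exists 'X; last by rewrite hornerX.
  by move=> t; rewrite coefX; case: (t == 1%N) => //; exact: subring0.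
apply: contra_notP ngR' => noi; split=> [b /AR /RR' //|_ _ [p Rp ->] [q Rq ->]|i Ii i0 [p Rp pE]].
  split; [exists (p - q)|exists (p * q)]; rewrite ?hornerE //.
    by move=> t; rewrite coefB; apply: RB.
  by move=> t; rewrite coefM; apply: subring_sum => // j _; apply: RM.
by apply: noi; exists i, p; split=> //; rewrite -pE mulfV.
Qed.

(** Otherwise both a and its inverse satisfy relations 1 = i p(a) and 1 = j q(1/a). With both
    degrees minimal, the relation of lower degree can be used to remove the leading term of the
    other one, a contradiction. *)
Lemma maximal_good_total a : R a \/ R a^-1.
Proof.
have [Ra|nRa] := pselect (R a); first by left.
have [Rb|nRb] := pselect (R a^-1); first by right.
pose rel (a : E) n := `[< exists i (p : {poly E}),
  [/\ I i, forall t, R p`_t, (size p <= n.+1)%N & 1 = i * p.[a]] >].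
have exrel c : ~ R c -> exists n, rel c n.
  move=> /maximal_good_degree[i [p [Ii i0 Rp e]]]; exists (size p); apply/asboolP.
  by exists i, p; split.
suff step c n m :
  c != 0 -> rel c n -> rel c^-1 m -> (m <= n)%N -> exists2 n', (n' < n)%N & rel c n'.
  have a0 : a != 0 by apply: contra_notN nRa => /eqP ->; exact: subring0.
  case: (ex_minnP (exrel _ nRa)) => n rn nmin; case: (ex_minnP (exrel _ nRb)) => m rm mmin.
  case/orP: (leq_total m n) => [le|le].
    by have [n' lt /nmin] := step _ _ _ a0 rn rm le; rewrite leqNgt lt.
  rewrite -[a]invrK in rn; have [n' lt /mmin] := step _ _ _ (invr_neq0 a0) rm rn le.
  by rewrite leqNgt lt.
move=> c0 /asboolP[i [p [Ii Rp sp pE]]] /asboolP[j [q [Ij Rq sq qE]]] le_mn.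
have [u0 Ru] := maximal_good_unit Ij (Rq 0%N); set u := 1 - j * q`_0 in u0 Ru.
(* A polynomial of degree less than n with r(c) = c^n: solve 1 = j q(1/c) for u = 1 - j q_0, then
   multiply by c^n / u. *)
pose r : {poly E} := \sum_(t < m) (u^-1 * j * q`_t.+1) *: 'X^(n - t.+1).
have Rr t : R r`_t.
  rewrite coef_sum; apply: subring_sum => // s _; rewrite coefZ coefXn.
  case: (_ == _); last by rewrite mulr0; exact: subring0.
  by rewrite mulr1; do !apply: RM => //; apply/AR/IA.
(* For n = 0 the relation would be 1 = i p_0, but 1 - i p_0 is nonzero. *)
have n0 : (0 < n)%N.
  case: n sp le_mn {r Rr} => // sp; rewrite leqn0 => /eqP m0.
  have [v0 _] := maximal_good_unit Ii (Rp 0%N); move: v0.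
  by rewrite [p]size1_polyC // hornerC coefC /= in pE *; rewrite -pE subrr eqxx.
have rE : r.[c] = c ^+ n.
  have qcE : u = \sum_(t < m) j * q`_t.+1 * c^-1 ^+ t.+1.
    rewrite /u {1}qE (horner_coef_wide _ sq) big_ord_recl expr0 mulr1 mulrDr addrC addKr.
    by rewrite mulr_sumr; apply: eq_bigr => t _; rewrite mulrA.
  rewrite horner_sum; transitivity (u^-1 * c ^+ n * u); last by rewrite mulrAC mulVf // mul1r.
  rewrite [X in _ = _ * X]qcE mulr_sumr; apply: eq_bigr => t _; rewrite hornerZ hornerXn.
  have le_tn : (t.+1 <= n)%N by apply: leq_trans (ltn_ord t) le_mn.
  rewrite expfB_cond ?(negbTE c0) //.
  rewrite exprVn; move: (c ^+ t.+1)^-1 (c ^+ n) => d e; ring.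
pose p' : {poly E} := take_poly n p + p`_n *: r.
exists n.-1; first by rewrite prednK.
apply/asboolP; exists i, p'; split=> // [t||].
- rewrite coefD coefZ coef_take_poly; apply: RD; last exact: RM.
  by case: ifP => // _; exact: subring0.
- rewrite prednK // (leq_trans (size_polyD _ _)) // geq_max size_take_poly /=.
  apply: leq_trans (size_scale_leq _ _) _; apply: leq_trans (size_sum _ _ _) _.
  apply/bigmax_leqP => t _; apply: leq_trans (size_scale_leq _ _) _.
  by rewrite size_polyXn -(prednK n0) subSS ltnS leq_subr.
- rewrite pE; congr (_ * _); rewrite hornerD hornerZ rE.
  rewrite -[in LHS](poly_take_drop n p) hornerD hornerM hornerXn; congr (_ + _ * _).
  rewrite [drop_poly n p]size1_polyC ?hornerC ?coef_drop_poly ?add0n //.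
  by rewrite size_drop_poly leq_subLR addn1.
Qed.
End Maximal.

Lemma valuation_ring_exists : exists W : set E,
  [/\ A `<=` W, (forall a b, W a -> W b -> W (a - b) /\ W (a * b)),
      (forall a, W a \/ W a^-1) & forall i, I i -> i != 0 -> ~ W i^-1].
Proof.
have [R gR R_max] := exists_maximal_good; exists R; case: (gR) => AR RBM Ri.
by split=> //; apply: maximal_good_total.
Qed.
End PlaceExtension.

Definition in_max_ideal (E : fieldType) (W : set E) (a : E) := W a /\ ~ is_unit W a.

Section ValuationRing.
Variables (k E : fieldType) (iota : {rmorphism k -> E}) (W : set E).
Hypothesis W_place : is_place iota [set: E] W.
Local Notation m := (in_max_ideal W).

Lemma place_const c : W (iota c). Proof. by case: W_place => + _ _ _ _; apply; exists c. Qed.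
Lemma place1 : W 1. Proof. by rewrite -(rmorph1 iota); apply: place_const. Qed.
Lemma placeBM a b : W a -> W b -> W (a - b) /\ W (a * b).
Proof. by case: W_place => _ _ _ + _; apply. Qed.
Lemma placeB a b : W a -> W b -> W (a - b). Proof. exact: (subringB placeBM). Qed.
Lemma placeM a b : W a -> W b -> W (a * b). Proof. exact: (subringM placeBM). Qed.
Lemma placeD a b : W a -> W b -> W (a + b). Proof. exact: (subringD place1 placeBM). Qed.
Lemma place0 : W 0. Proof. exact: (subring0 place1 placeBM). Qed.
Lemma placeN a : W a -> W (- a). Proof. exact: (subringN place1 placeBM). Qed.
Lemma placeX a n : W a -> W (a ^+ n). Proof. exact: (subring_exp place1 placeBM). Qed.
Lemma place_total a : W a \/ W a^-1. Proof. by case: W_place => _ _ _ _; apply. Qed.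
Lemma place_proper : exists a, ~ W a.
Proof.
case: W_place => _ _ WT _ _; apply: contra_notP WT => /forallNP W_all.
by apply/seteqP; split=> // a _; apply: contrapT.
Qed.

Lemma place_nonunit a : ~ W a -> m a^-1.
Proof.
move=> Wa; have [//|Wa'] := place_total a; split=> //.
by case=> _ _; rewrite invrK.
Qed.

Lemma place_unitP a : W a -> is_unit W a \/ m a.
Proof. by move=> Wa; have [?|?] := pselect (is_unit W a); [left|right]. Qed.

Lemma max_idealP a : m a <-> a = 0 \/ (a != 0 /\ ~ W a^-1).
Proof.
split=> [[Wa nu]|[->|[a0 Wa']]].
- by have [->|a0] := eqVneq a 0; [left|right; split=> // Wa'; apply: nu].
- by split; [exact: place0|case; rewrite eqxx].
- have [Wa|//] := place_total a; split=> //.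
  by case.
Qed.

Lemma unitM a b : is_unit W a -> is_unit W b -> is_unit W (a * b).
Proof.
move=> [a0 Wa Wa'] [b0 Wb Wb']; split; [exact: mulf_neq0|exact: placeM|].
by rewrite invfM; apply: placeM.
Qed.

Lemma unitV a : is_unit W a -> is_unit W a^-1.
Proof. by move=> [a0 Wa Wa']; split; rewrite ?invr_eq0 ?invrK. Qed.

Lemma unit_const c : c != 0 -> is_unit W (iota c).
Proof.
by move=> c0; split; rewrite ?fmorph_eq0 -?fmorphV //; apply: place_const.
Qed.

Lemma unit1 : is_unit W 1.
Proof. by rewrite -(rmorph1 iota); apply: unit_const; apply: oner_neq0. Qed.

Lemma unitXz a (n : int) : is_unit W a -> is_unit W (a ^ n).
Proof.
move=> au; suff uX j : is_unit W (a ^+ j) by case: n => j; [exact: uX|exact: (unitV (uX _))].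
by elim: j => [|j IHj]; [exact: unit1|rewrite exprS; apply: unitM].
Qed.

Lemma max_idealM a b : W a -> m b -> m (a * b).
Proof.
move=> Wa /max_idealP mb; apply/max_idealP.
have [->|a0] := eqVneq a 0; first by left; rewrite mul0r.
case: mb => [->|[b0 Wb']]; first by left; rewrite mulr0.
right; split=> [|Wab']; first by rewrite mulf_neq0.
by apply: Wb'; rewrite -[b^-1](mulVKf a0) -invfM; apply: placeM.
Qed.

Lemma max_ideal_sub a : m a -> W a. Proof. by case. Qed.

Lemma max_ideal0 : m 0. Proof. by apply/max_idealP; left. Qed.

Lemma max_idealD a b : m a -> m b -> m (a + b).
Proof.
wlog Wab : a b / W (a / b).
  move=> IH ma mb; have [Wab|Wba] := place_total (a / b); first exact: IH.
  by rewrite addrC; apply: IH => //; rewrite -invf_div.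
move=> ma mb; have [b0|b0] := eqVneq b 0; first by rewrite b0 addr0.
have -> : a + b = (a / b + 1) * b by rewrite mulrDl divfK // mul1r.
by apply: max_idealM => //; apply: placeD => //; exact: place1.
Qed.

Lemma max_idealN a : m a -> m (- a).
Proof. by move=> ma; rewrite -mulN1r; apply: max_idealM => //; apply: placeN; exact: place1. Qed.

Lemma max_ideal_sum I (r : seq I) (P : pred I) F :
  (forall i, P i -> m (F i)) -> m (\sum_(i <- r | P i) F i).
Proof. by move=> mF; apply: big_ind => //; [exact: max_ideal0|exact: max_idealD]. Qed.

Lemma unit_not_max a : is_unit W a -> ~ m a. Proof. by move=> au []. Qed.

Lemma unitD a b : is_unit W a -> m b -> is_unit W (a + b).
Proof.
move=> au mb;
  have [//|mab] := place_unitP (placeD (let: And3 _ Wa _ := au in Wa) (max_ideal_sub mb)).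
case: (unit_not_max au); rewrite -[a](addrK b); apply: max_idealD => //.
exact: max_idealN.
Qed.

Lemma max_ideal_const c : m (iota c) -> c = 0.
Proof. by move=> mc; apply/eqP; apply: contra_notT (mc.2) => c0; apply: unit_const. Qed.

Lemma unit_prod I (r : seq I) (F : I -> E) :
  (forall i, is_unit W (F i)) -> is_unit W (\prod_(i <- r) F i).
Proof. by move=> uF; apply: big_ind => //; [exact: unit1|exact: unitM]. Qed.

Lemma place_integrally_closed (p : {poly E}) a :
  p \is monic -> (forall i, W p`_i) -> root p a -> W a.
Proof.
move=> p_mon Wp; rewrite rootE horner_coef => /eqP pa.
apply: contrapT => nWa; have mb := place_nonunit nWa.
have a0 : a != 0 by apply: contra_notN nWa => /eqP ->; exact: place0.
have sp : (0 < size p)%N by rewrite lt0n size_poly_eq0 monic_neq0.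
move: pa; rewrite -(prednK sp) big_ord_recr /=.
have -> : p`_(size p).-1 = 1 by apply/eqP.
rewrite mul1r => /(congr1 (fun b => b * a^-1 ^+ (size p).-1)).
rewrite mulrDl mul0r -exprMn mulfV // expr1n => e.
suff m1 : m (\sum_(i < (size p).-1) p`_i * a ^+ i * a^-1 ^+ (size p).-1).
  apply: (unit_not_max unit1); rewrite -mulr_suml in m1.
  have -> : 1 = - (\sum_(i < (size p).-1) p`_i * a ^+ i * a^-1 ^+ (size p).-1).
    by apply/eqP; rewrite -addr_eq0 addrC -mulr_suml e.
  by apply: max_idealN; rewrite -mulr_suml.
apply: max_ideal_sum => -[i lti] _ /=; rewrite -mulrA; apply: max_idealM => //.
move: lti; move: (size p).-1 => n lt_in.
rewrite -{1}[n](subnK (ltnW lt_in)) addnC exprD mulrA -exprMn mulfV // expr1n mul1r.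
rewrite -(prednK (_ : 0 < n - i)%N) ?subn_gt0 // exprSr.
by apply: max_idealM => //; apply: placeX; apply: max_ideal_sub.
Qed.

Lemma has_order_uniq f n n' : has_order W f n -> has_order W f n' -> n = n'.
Proof.
suff le f1 n1 n2 : has_order W f1 n1 -> has_order W f1 n2 -> n1 <= n2.
  by move=> h h'; apply/eqP; rewrite eq_le !(le f).
move=> [t [u [tU uU ->]]] [t' [u' [t'U u'U e]]].
have [t0 Wt nt tdiv] := tU; have [t'0 Wt' nt' t'div] := t'U.
have vU : is_unit W (t / t').
  split; first by rewrite mulf_neq0 ?invr_eq0.
    exact: t'div.
  by rewrite invf_div; apply: tdiv.
rewrite leNgt; apply/negP => lt21; apply: (nt).
have [d dE] : exists d : nat, n1 - n2 = d.+1%:Z.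
  by exists `|n1 - n2|.-1; rewrite prednK ?absz_gt0 ?subr_eq0 ?gt_eqF // gtz0_abs ?subr_gt0.
have tE : t ^+ d.+1 = u' / u * (t / t') ^ (- n2).
  have [u0 _ _] := uU; rewrite expfzMl exprz_inv opprK.
  transitivity (u' * t' ^ n2 / u * t ^ (- n2)); last first.
    by move: (t' ^ n2) (t ^ (- n2)) u^-1 => ? ? ?; ring.
  by rewrite -e [u * _]mulrC mulfK // -expfzDr // dE.
have : is_unit W (t ^+ d.+1).
  by rewrite tE; apply: unitM; [apply: unitM => //; apply: unitV|apply: unitXz].
move=> /unit_not_max; case; rewrite exprS mulrC; apply: max_idealM => //.
exact: placeX.
Qed.

Lemma has_order_uniformizer f n t : is_uniformizer W t -> has_order W f n ->
  exists2 u, is_unit W u & f = u * t ^ n.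
Proof.
move=> tU [t' [u' [t'U u'U ->]]].
have [t0 Wt nt tdiv] := tU; have [t'0 Wt' nt' t'div] := t'U.
have vU : is_unit W (t' / t).
  split; first by rewrite mulf_neq0 ?invr_eq0.
    exact: tdiv.
  by rewrite invf_div; apply: t'div.
exists (u' * (t' / t) ^ n); first by apply: unitM => //; apply: unitXz.
by rewrite -mulrA -expfzMl divfK.
Qed.

End ValuationRing.

(** * Places *)

Section ConstantEvaluation.
Variables (k E : fieldType) (iota : {rmorphism k -> E}).

Definition const_eval (h : E) : {rmorphism {poly k} -> E} := horner_eval h \o map_poly iota.

Lemma const_evalC h c : const_eval h c%:P = iota c.
Proof. by rewrite /= map_polyC /horner_eval hornerC. Qed.
Lemma const_evalX h : const_eval h 'X = h.
Proof. by rewrite /= map_polyX /horner_eval hornerX. Qed.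

Definition rational_in (h : E) : set E :=
  [set a | exists al be, const_eval h be != 0 /\ a = const_eval h al / const_eval h be].

Lemma rational_in_subfield h : is_subfield (rational_in h).
Proof.
split=> [|_ _ [a [b [b0 ->]]] [c [d [d0 ->]]]|_ _ [a [b [b0 ->]]] [c [d [d0 ->]]]].
- by exists 1, 1; rewrite rmorph1 divr1 oner_neq0.
- exists (a * d - c * b), (b * d); rewrite rmorphB !rmorphM mulf_neq0 //; split=> //.
  by rewrite -[- (_ / _)]mulNr addf_div // mulNr.
- have [c0|c0] := eqVneq (const_eval h c) 0.
    by exists 0, 1; rewrite c0 mul0r invr0 mulr0 rmorph0 mul0r rmorph1 oner_neq0.
  exists (a * d), (b * c); rewrite !rmorphM mulf_neq0 //; split=> //.
  by rewrite invf_div mulf_div.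
Qed.

Lemma rational_in_const h : range iota `<=` rational_in h.
Proof.
by move=> _ [c _ <-]; exists c%:P, 1; rewrite rmorph1 oner_neq0 divr1 const_evalC.
Qed.

Lemma rational_in_gen h : rational_in h h.
Proof. by exists 'X, 1; rewrite rmorph1 oner_neq0 divr1 const_evalX. Qed.

Section InPlace.
Variable (W : set E).
Hypothesis W_place : is_place iota [set: E] W.
Variable h : E.

Lemma place_const_eval al : W h -> W (const_eval h al).
Proof.
move=> Wh; apply: (subring_horner (place1 W_place) (placeBM W_place)) => // i.
by rewrite coef_map; apply: place_const.
Qed.

Hypotheses (mh : in_max_ideal W h) (h0 : h != 0).
Let Wh : W h. Proof. by case: mh. Qed.

Lemma const_eval_split (al : {poly k}) : exists2 w, W w & const_eval h al = iota al`_0 + h * w.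
Proof.
exists (const_eval h (drop_poly 1 al)); first exact: place_const_eval.
have take1 : take_poly 1 al = (al`_0)%:P.
  by rewrite [take_poly 1 al]size1_polyC ?size_take_poly // coef_take_poly.
rewrite -{1}[al](poly_take_drop 1) take1 expr1 rmorphD rmorphM const_evalC const_evalX.
by rewrite mulrC.
Qed.

Lemma const_eval_unit (al : {poly k}) : al`_0 != 0 -> is_unit W (const_eval h al).
Proof.
move=> al0; have [w Ww ->] := const_eval_split al.
apply: (unitD W_place); first exact: (unit_const W_place).
by rewrite mulrC; apply: (max_idealM W_place).
Qed.

(** The first nonzero coefficient dominates, because h lies in the maximal ideal and nonzero
    constants are units. In particular h is transcendental over k. *)
Lemma const_eval_order (al : {poly k}) : al != 0 ->
  exists n u, is_unit W u /\ const_eval h al = h ^+ n * u.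
Proof.
have [n] := ubnP (size al); elim: n al => // n IHn al ltn al0.
have [z|nz] := eqVneq al`_0 0; last first.
  by exists 0%N, (const_eval h al); rewrite mul1r; split=> //; exact: const_eval_unit.
have alE : al = drop_poly 1 al * 'X.
  rewrite -{1}[al](poly_take_drop 1) expr1 -[RHS]add0r; congr (_ + _).
  by rewrite [take_poly 1 al]size1_polyC ?size_take_poly // coef_take_poly z.
have d0 : drop_poly 1 al != 0 by apply: contraNneq al0 => d; rewrite alE d mul0r.
have [|//|m [u [uU e]]] := IHn (drop_poly 1 al).
  by rewrite size_drop_poly; move: al0 ltn; rewrite -size_poly_gt0; lia.
exists m.+1, u; split=> //.
by rewrite alE rmorphM const_evalX e exprS mulrC mulrA.
Qed.
End InPlace.
End ConstantEvaluation.

(** * Discreteness of the places of a field algebraic over k(tau) *)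

Section DiscreteValuation.
Variables (k : closedFieldType) (E : fieldType) (iota : {rmorphism k -> E}).
Variables (g : 'S_4 -> {rmorphism E -> E}) (H : {group 'S_4}) (tau : E).
Hypothesis g_act : S4_action g.
Hypothesis H_gen : forall (S : set E) a,
  is_subfield S -> range iota `<=` S -> S tau -> fixed_by g H a -> S a.

Definition group_poly a : {poly E} := \prod_(h in H) ('X - (g h a)%:P).

Lemma group_poly_root a : root (group_poly a) a.
Proof.
rewrite rootE /group_poly (bigD1 1%g) //= hornerM hornerXsubC g_act.1 subrr mul0r //.
Qed.

Lemma group_poly_monic a : group_poly a \is monic.
Proof. by apply: monic_prod => h _; apply: monicXsubC. Qed.

Lemma size_group_poly a : size (group_poly a) = #|H|.+1.
Proof. by rewrite /group_poly -big_enum size_prod_XsubC -cardE. Qed.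

Lemma group_poly_coef0 a : a != 0 -> (group_poly a)`_0 != 0.
Proof.
move=> a0; rewrite -horner_coef0 /group_poly horner_prod; apply/prodf_neq0 => h _.
by rewrite hornerXsubC sub0r oppr_eq0 fmorph_eq0.
Qed.

Lemma group_poly_fixed a i : fixed_by g H (group_poly a)`_i.
Proof.
move=> t tH; rewrite -coef_map; suff -> : map_poly (g t) (group_poly a) = group_poly a by [].
rewrite rmorph_prod /=.
under eq_bigr => h _ do rewrite map_polyXsubC g_act.2.
exact: (@big_group_translate H _ _ _ (fun h => 'X - (g h a)%:P) t tH).
Qed.

Let N := #|H|.

Section Uniformizer.
Variable W : set E.
Hypothesis W_place : is_place iota [set: E] W.
Local Notation m := (in_max_ideal W).

(** h is a coordinate of the projective line at the point below W: the inverse of tau, or tau - c.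
    It satisfies k(h) = k(tau). *)
Lemma exists_parameter : exists h, [/\ m h, h != 0 & rational_in iota h tau].
Proof.
have [Wtau|nWtau] := pselect (W tau); last first.
  exists tau^-1; split; first exact: (place_nonunit W_place).
    by rewrite invr_eq0; apply: contra_notN nWtau => /eqP ->; exact: (place0 W_place).
  rewrite -{2}[tau]invrK; apply: subfieldV; first exact: rational_in_subfield.
  exact: rational_in_gen.
have [[c mc]|noc] := pselect (exists c, m (tau - iota c) /\ tau - iota c != 0).
  case: mc => mc c0; exists (tau - iota c); split=> //.
  rewrite -{2}[tau](subrK (iota c)); apply: subfieldD; first exact: rational_in_subfield.
    exact: rational_in_gen.
  by apply: rational_in_const; exists c.
(* Otherwise k(tau) is contained in W, and so is E, which is integral over it. *)
have unit_tau c : tau - iota c != 0 -> is_unit W (tau - iota c).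
  move=> c0; have Wc : W (tau - iota c).
    by apply: (placeB W_place) => //; exact: (place_const W_place).
  by case: (place_unitP Wc) => // mc; case: noc; exists c.
have unit_eval be : const_eval iota tau be != 0 -> is_unit W (const_eval iota tau be).
  have [r beE] := closed_field_poly_normal be.
  have -> : const_eval iota tau be = iota (lead_coef be) * \prod_(z <- r) (tau - iota z).
    rewrite beE /= map_polyZ /horner_eval hornerZ rmorph_prod horner_prod /=.
    congr (iota _ * _).
      by rewrite lead_coefZ (monicP (monic_prod_XsubC r xpredT id)) mulr1.
    by apply: eq_bigr => z _; rewrite map_polyXsubC hornerXsubC.
  rewrite mulf_eq0 negb_or fmorph_eq0 => /andP[l0 r0].
  apply: (unitM W_place); first exact: (unit_const W_place).
  rewrite prodf_seq_neq0 in r0; rewrite big_seq.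
  by apply: big_ind => [||z zr]; [exact: (unit1 W_place)|exact: (unitM W_place)|
    apply: unit_tau; move/allP: r0; apply].
have sub_W : rational_in iota tau `<=` W.
  move=> _ [al [be [be0 ->]]]; apply: (placeM W_place); first exact: place_const_eval.
  by case: (unit_eval _ be0).
have [a []] := place_proper W_place.
apply: (place_integrally_closed W_place (group_poly_monic a)); last exact: group_poly_root.
move=> i; apply: sub_W; apply: H_gen; [exact: rational_in_subfield|exact: rational_in_const| |].
  exact: rational_in_gen.
exact: group_poly_fixed.
Qed.

Section LocalCoordinate.
Variable h : E.
Hypotheses (mh : m h) (h0 : h != 0) (h_tau : rational_in iota h tau).
Let Wh : W h. Proof. by case: mh. Qed.

Lemma group_poly_relation a : exists2 al : 'I_N.+1 -> {poly k},
  exists2 d, d != 0 & forall i, const_eval iota h (al i) = (group_poly a)`_i * d &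
  \sum_i const_eval iota h (al i) * a ^+ i = 0.
Proof.
have rat (i : 'I_N.+1) : exists ab : {poly k} * {poly k}, const_eval iota h ab.2 != 0 /\
    (group_poly a)`_i = const_eval iota h ab.1 / const_eval iota h ab.2.
  have [] : rational_in iota h (group_poly a)`_i.
    apply: H_gen => //; [exact: rational_in_subfield|exact: rational_in_const|].
    exact: group_poly_fixed.
  by move=> al [be [be0 e]]; exists (al, be).
have [ab abP] := choice rat.
pose d := \prod_i const_eval iota h (ab i).2.
have d0 : d != 0 by apply/prodf_neq0 => i _; case: (abP i).
exists (fun i => (ab i).1 * \prod_(j | j != i) (ab j).2).
  exists d => // i; rewrite rmorphM rmorph_prod (abP i).2 /d [in RHS](bigD1 i) //.
  by rewrite mulrA divfK //; case: (abP i).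
transitivity (\sum_(i < N.+1) (group_poly a)`_i * a ^+ i * d).
  apply: eq_bigr => i _; rewrite rmorphM rmorph_prod (abP i).2 /d [in RHS](bigD1 i) //.
  by rewrite [RHS]mulrAC mulrA divfK //; case: (abP i).
rewrite -mulr_suml -(size_group_poly a) -horner_coef.
by rewrite (eqP (group_poly_root a)) mul0r.
Qed.

(** Common factors h are removed from the coefficients until the relation is nontrivial at h = 0.
    The degree of the top coefficient, nonzero because the group polynomial is monic, bounds the
    number of steps. *)
Lemma normalized_relation a : exists2 al : 'I_N.+1 -> {poly k},
  exists i, (al i)`_0 != 0 & \sum_i const_eval iota h (al i) * a ^+ i = 0.
Proof.
have [al [d d0 alE] sum0] := group_poly_relation a.
have al0 : al ord_max != 0.
  apply: contraNneq d0 => z; have := alE ord_max.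
  have -> : (group_poly a)`_(@ord_max N) = 1.
    by have /monicP := group_poly_monic a; rewrite lead_coefE size_group_poly.
  by rewrite z rmorph0 mul1r => <-.
have [n] := ubnP (size (al ord_max)).
elim: n al al0 sum0 {alE d d0} => // n IHn al al0 sum0 ltn.
have [[i nz]|allz] := pselect (exists i, (al i)`_0 != 0); first by exists al => //; exists i.
have z i : (al i)`_0 = 0 by apply/eqP; apply: contra_notT allz => nz; exists i.
have alE i : al i = drop_poly 1 (al i) * 'X.
  rewrite -{1}[al i](poly_take_drop 1) expr1 -[RHS]add0r; congr (_ + _).
  by rewrite [take_poly 1 _]size1_polyC ?size_take_poly // coef_take_poly z.
apply: (IHn (fun i => drop_poly 1 (al i))).
- by apply: contraNneq al0 => e; rewrite alE e mul0r.
- apply: (mulfI h0); rewrite mulr0 -[RHS]sum0 mulr_sumr; apply: eq_bigr => i _.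
  by rewrite {2}alE rmorphM const_evalX mulrA [h * _]mulrC.
- by rewrite size_drop_poly; move: al0 ltn; rewrite -size_poly_gt0; lia.
Qed.

(** Suppose b^(N+1) divides h. In a normalized relation for b let i be the least index whose
    coefficient is nonzero at h = 0. All other terms are divisible by b^(i+1): those above i through
    the power of b, those below because h divides their coefficients. So the i-th coefficient, a
    unit, would be divisible by b. *)
Lemma ramification_bound b : m b -> b != 0 -> ~ W (h / b ^+ N.+1).
Proof.
move=> mb b0 Whb; have Wb : W b by case: mb.
have [al exi sum0] := normalized_relation b.
have [i nzi mini] := @arg_minnP _ _ (fun i : 'I_N.+1 => (al i)`_0 != 0) (@nat_of_ord N.+1)
  (xchooseP exi).
suff : m (const_eval iota h (al i)).
  by apply: (unit_not_max (const_eval_unit W_place mh nzi)).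
have [w Ww e] : exists2 w, W w & const_eval iota h (al i) * b ^+ i = w * b ^+ i.+1.
  have term j : j != i -> exists2 w, W w & const_eval iota h (al j) * b ^+ j = w * b ^+ i.+1.
    move=> ji; have [lt_ij|le_ji] := ltnP i j.
      exists (const_eval iota h (al j) * b ^+ (j - i.+1)).
        by apply: (placeM W_place); [exact: place_const_eval|exact: (placeX W_place)].
      by rewrite -mulrA -exprD subnK.
    have z : (al j)`_0 = 0.
      apply/eqP; apply: contraT => nz; have := mini j nz; move: ji; rewrite -val_eqE /=; lia.
    have [w Ww ->] := const_eval_split W_place mh (al j).
    exists (h / b ^+ N.+1 * w * b ^+ (N - i) * b ^+ j).
      by do !apply: (placeM W_place) => //; exact: (placeX W_place).
    rewrite z rmorph0 add0r.
    have {1}-> : h = h / b ^+ N.+1 * (b ^+ (N - i) * b ^+ i.+1).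
      by rewrite -exprD addnS subnK -1?ltnS // divfK // expf_neq0.
    by move: (h / b ^+ N.+1) (b ^+ (N - i)) (b ^+ i.+1) => ? ? ?; ring.
  have [w wP] : exists w : 'I_N.+1 -> E, forall j, j != i -> W (w j) /\
      const_eval iota h (al j) * b ^+ j = w j * b ^+ i.+1.
    have /choice[w wP] : forall j, exists w, j != i -> W w /\
        const_eval iota h (al j) * b ^+ j = w * b ^+ i.+1.
      move=> j; have [->|ji] := eqVneq j i; first by exists 0.
      by have [w Ww e] := term j ji; exists w.
    by exists w.
  exists (- \sum_(j | j != i) w j).
    apply: (placeN W_place).
    by apply: (subring_sum (place1 W_place) (placeBM W_place)) => j /wP[].
  apply/eqP; rewrite -subr_eq0 mulNr opprK mulr_suml; apply/eqP.
  rewrite -[RHS]sum0 [RHS](bigD1 i) //=; congr (_ + _).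
  by apply: eq_bigr => j /wP[_ ->].
have bi0 : b ^+ i != 0 by rewrite expf_neq0.
have -> : const_eval iota h (al i) = w * b.
  by apply: (mulIf bi0); rewrite e exprS mulrA.
exact: (max_idealM W_place).
Qed.

(** The constant coefficient of an equation for a over k[h] is a multiple of a; being a nonzero
    polynomial in h, it is a power of h times a unit. This is what bounds orders. *)
Lemma coordinate_power_multiple a : W a -> a != 0 -> exists n w, W w /\ h ^+ n = a * w.
Proof.
move=> Wa a0; have [al [d d0 alE] sum0] := group_poly_relation a.
have e0 : const_eval iota h (al ord0) != 0 by rewrite alE mulf_neq0 // group_poly_coef0.
have al0 : al ord0 != 0 by apply: contraNneq e0 => ->; rewrite rmorph0.
have [n [u [uU e]]] := const_eval_order W_place mh h0 al0.
exists n, (- (\sum_(i < N) const_eval iota h (al (lift ord0 i)) * a ^+ i) * u^-1); split.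
  apply: (placeM W_place); last by case: uU.
  apply: (placeN W_place); apply: (subring_sum (place1 W_place) (placeBM W_place)) => i _.
  by apply: (placeM W_place); [exact: place_const_eval|exact: (placeX W_place)].
have u0 : u != 0 by case: uU.
apply: (mulIf u0); rewrite -e mulrA divfK //.
apply/eqP; rewrite mulrN -addr_eq0 mulr_sumr; apply/eqP.
rewrite -[RHS]sum0 big_ord_recl expr0 mulr1; congr (_ + _).
by apply: eq_bigr => i _; rewrite mulrCA -exprS.
Qed.

(** Choose t in the maximal ideal with t^j dividing h for the largest possible j. If t did not
    divide a non-unit c, then t = c d with d a non-unit, and the square of c or of d, whichever
    divides the other, would divide t. *)
Lemma uniformizer_exists_of_parameter : exists t, is_uniformizer W t.
Proof.
pose J j := `[< exists b, [/\ m b, b != 0 & W (h / b ^+ j)] >].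
have J1 : J 1%N.
  by apply/asboolP; exists h; split=> //; rewrite expr1 mulfV //; exact: (place1 W_place).
have J_le j : J j -> (j <= N)%N.
  move=> /asboolP[b [mb b0 Wb]]; rewrite leqNgt; apply/negP => ltNj.
  apply: (ramification_bound mb b0).
  have -> : h / b ^+ N.+1 = h / b ^+ j * b ^+ (j - N.+1).
    rewrite -{1}[j](subnK ltNj) exprD invfM -[RHS]mulrA; congr (_ * _).
    by rewrite mulrAC mulVf ?mul1r // expf_neq0.
  by apply: (placeM W_place) => //; apply: (placeX W_place); case: mb.
have [j /asboolP[t [mt t0 Wt]] jmax] := ex_maxnP (ex_intro (fun j => is_true (J j)) 1%N J1) J_le.
have j_gt0 : (0 < j)%N by exact: jmax J1.
exists t; split=> //; [by case: mt|by case: mt|].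
move=> c Wc nc; have mc : m c by split.
have [->|c0] := eqVneq c 0; first by rewrite mul0r; exact: (place0 W_place).
apply: contrapT => nW; have := place_nonunit W_place nW; rewrite invf_div.
set d := t / c => md; have tE : t = c * d by rewrite mulrC divfK.
have d0 : d != 0 by rewrite mulf_neq0 ?invr_eq0.
(* If b^2 divides t, then b^(2j) divides h, against the choice of j. *)
have contr b e : m b -> b != 0 -> t = b ^+ 2 * e -> W e -> False.
  move=> mb b0 tE' We; have /jmax : J (2 * j)%N; last by move: j_gt0; lia.
  apply/asboolP; exists b; split=> //.
  have e0 : e != 0 by apply: contraNneq t0 => ez; rewrite tE' ez mulr0.
  have -> : h / b ^+ (2 * j) = h / t ^+ j * e ^+ j.
    have -> : t ^+ j = b ^+ (2 * j) * e ^+ j by rewrite tE' exprMn -exprM.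
    by rewrite invfM mulrA -[RHS]mulrA mulVf ?mulr1 ?expf_neq0.
  by apply: (placeM W_place) => //; exact: (placeX W_place).
have [We|We] := place_total W_place (d / c).
  by apply: (contr c (d / c)) => //; rewrite tE expr2 -mulrA [c * (d / c)]mulrC divfK.
apply: (contr d (c / d)) => //; last by rewrite -invf_div.
by rewrite tE expr2 -mulrA [d * (c / d)]mulrC divfK // mulrC.
Qed.

Lemma has_order_exists_of_parameter a : a != 0 -> exists n, has_order W a n.
Proof.
have [t tU] := uniformizer_exists_of_parameter; have [t0 Wt nt tdiv] := tU.
have mt : m t by split.
suff pos b : W b -> b != 0 -> exists n : nat, has_order W b n.
  move=> a0; have [Wa|Wa] := place_total W_place a.
    by have [n ?] := pos a Wa a0; exists n.
  have [n [t' [u [t'U uU e]]]] := pos _ Wa (invr_neq0 a0).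
  exists (- n%:Z), t', u^-1; split=> //; first exact: (unitV uU).
  by rewrite -[a]invrK e invfM -exprnN.
move=> Wb b0; pose J j := `[< W (b / t ^+ j) >].
have J0 : exists j, J j by exists 0%N; apply/asboolP; rewrite expr0 divr1.
have [n [w [Ww hE]]] := coordinate_power_multiple Wb b0.
(* b divides h^n, and h divides t^(N+1) by the ramification bound; a higher power of t dividing b
   would make t a unit. *)
have J_le j : J j -> (j <= n * N.+1)%N.
  move=> /asboolP Wj; rewrite leqNgt; apply/negP => lt.
  have mth : m (t ^+ N.+1 / h).
    by rewrite -invf_div; apply: (place_nonunit W_place); exact: ramification_bound.
  apply: (nt); split=> //.
  have hn0 : h ^+ n != 0 by rewrite expf_neq0.
  have w0 : w != 0 by apply: contraNneq hn0 => z; rewrite hE z mulr0.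
  have -> : t^-1 = b / t ^+ j * w * (t ^+ N.+1 / h) ^+ n * t ^+ (j - (n * N.+1).+1).
    rewrite expr_div_n -exprM mulnC hE.
    have -> : b / t ^+ j * w * (t ^+ (n * N.+1) / (b * w)) * t ^+ (j - (n * N.+1).+1) =
       (t ^+ (n * N.+1) * t ^+ (j - (n * N.+1).+1)) / t ^+ j.
      move: (t ^+ (n * N.+1)) (t ^+ (j - (n * N.+1).+1)) (t ^+ j) => e1 e2 e3.
      have [->|e30] := eqVneq e3 0; first by rewrite invr0 !mulr0 !mul0r.
      by field; rewrite b0 w0 e30.
    rewrite -{2}[j](subnK lt) exprD exprS.
    have : t ^+ (n * N.+1) != 0 by rewrite expf_neq0.
    have : t ^+ (j - (n * N.+1).+1) != 0 by rewrite expf_neq0.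
    move: (t ^+ (n * N.+1)) (t ^+ (j - (n * N.+1).+1)) => e1 e2 e20 e10.
    by field; rewrite e10 e20 t0.
  by do !apply: (placeM W_place) => //; apply: (placeX W_place) => //; case: mth.
have [j /asboolP Wj jmax] := ex_maxnP J0 J_le.
exists j, t, (b / t ^+ j); split=> //; last first.
  by rewrite -[t ^ j]/(t ^+ j) divfK // expf_neq0.
apply: contrapT => nu; have /jmax : J j.+1; last by rewrite ltnn.
by apply/asboolP; rewrite exprSr invfM mulrA; apply: tdiv.
Qed.

(** At h = 0 the normalized relation becomes a nonzero polynomial p over k with p(a) in the maximal
    ideal. It splits over k, so one of its factors a - c is a non-unit. *)
Lemma residue_exists_of_parameter a : W a -> exists c, m (a - iota c).
Proof.
move=> Wa; have [al exi sum0] := normalized_relation a.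
pose p := \poly_(i < N.+1) (if insub i is Some j then (al j)`_0 else 0).
have pE (i : 'I_N.+1) : p`_i = (al i)`_0 by rewrite coef_poly ltn_ord valK.
have p0 : p != 0.
  by have [i nz] := exi; apply: contraNneq nz => p0; rewrite -pE p0 coef0.
have mp : m (const_eval iota a p).
  have -> : const_eval iota a p = - \sum_i (const_eval iota h (al i) - iota p`_i) * a ^+ i.
    under eq_bigr do rewrite mulrBl.
    rewrite sumrB sum0 sub0r opprK /= /horner_eval (@horner_coef_wide _ N.+1).
      by apply: eq_bigr => i _; rewrite coef_map.
    by apply: leq_trans (size_poly _ _) _; apply: size_poly.
  apply: (max_idealN W_place); apply: (max_ideal_sum W_place) => i _.
  have [w Ww ->] := const_eval_split W_place mh (al i).
  rewrite pE addrC addKr mulrC; apply: (max_idealM W_place); first exact: (placeX W_place).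
  by rewrite mulrC; apply: (max_idealM W_place).
apply: contrapT => noc; apply: (unit_not_max _ mp).
have [r pr] := closed_field_poly_normal p.
rewrite pr -mul_polyC rmorphM const_evalC rmorph_prod.
apply: (unitM W_place); first by apply: (unit_const W_place); rewrite lead_coef_eq0.
apply: (unit_prod W_place) => c; rewrite rmorphB const_evalX const_evalC.
have [//|mc] := place_unitP (placeB W_place Wa (place_const W_place c)).
by case: noc; exists c.
Qed.

End LocalCoordinate.

Lemma has_order_exists a : a != 0 -> exists n, has_order W a n.
Proof. by have [h [mh h0 hr]] := exists_parameter;
  exact: (has_order_exists_of_parameter mh h0 hr). Qed.

Lemma residue_exists a : W a -> exists c, m (a - iota c).
Proof. by have [h [mh h0 hr]] := exists_parameter;
  exact: (residue_exists_of_parameter mh h0 hr). Qed.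
End Uniformizer.
End DiscreteValuation.

(** * Orders and approximation *)

(** The default makes the order of 0 equal to 0 instead of infinity, which explains the conditions
    [a != 0] below. *)
Definition ord (E : fieldType) (W : set E) (a : E) : int := xget 0 [set n | has_order W a n].

Section Order.
Variables (k E : fieldType) (iota : {rmorphism k -> E}).
Local Notation place := (is_place iota [set: E]).
Hypothesis has_order_ex : forall W, place W -> forall a, a != 0 -> exists n, has_order W a n.

Section OnePlace.
Variable W : set E.
Hypothesis W_place : place W.
Local Notation m := (in_max_ideal W).

Lemma ordP a : a != 0 -> has_order W a (ord W a).
Proof. by move=> /(has_order_ex W_place)[n an];
  apply: (xgetPex 0 (P := [set n | has_order W a n])); exists n. Qed.

Lemma ordE a n : has_order W a n -> ord W a = n.
Proof.
move=> an; apply: (has_order_uniq W_place) (an).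
by apply: (xgetPex 0 (P := [set n | has_order W a n])); exists n.
Qed.

Lemma ord_one : ord W 1 = 0.
Proof.
apply: ordE; have [n [t [u [tU _ _]]]] := has_order_ex W_place (oner_neq0 E).
by exists t, 1; split=> //; [exact: (unit1 W_place)|rewrite expr0z mulr1].
Qed.

Lemma uniformizer_ex : exists t, is_uniformizer W t.
Proof. by have [n [t [u [tU _ _]]]] := has_order_ex W_place (oner_neq0 E); exists t. Qed.

Lemma ordM a b : a != 0 -> b != 0 -> ord W (a * b) = ord W a + ord W b.
Proof.
move=> /ordP an /ordP bn; have [t tU] := uniformizer_ex; have [t0 _ _ _] := tU.
have [u uU aE] := has_order_uniformizer W_place tU an.
have [v vU bE] := has_order_uniformizer W_place tU bn.
apply: ordE; exists t, (u * v); split=> //; first exact: (unitM W_place).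
by rewrite {1}aE {1}bE expfzDr // mulrACA.
Qed.

Lemma ordV a : a != 0 -> ord W a^-1 = - ord W a.
Proof.
move=> a0; have := ordM (invr_neq0 a0) a0; rewrite mulVf // ord_one => /eqP.
by rewrite eq_sym addr_eq0 => /eqP.
Qed.

Lemma ordX a n : a != 0 -> ord W (a ^+ n) = ord W a * n%:Z.
Proof.
move=> a0; elim: n => [|n IHn]; first by rewrite expr0 ord_one mulr0.
by rewrite exprS ordM ?expf_neq0 // IHn intS mulrDr mulr1.
Qed.

Lemma ordXz a (n : int) : a != 0 -> ord W (a ^ n) = ord W a * n.
Proof.
move=> a0; case: n => n; first exact: ordX.
by rewrite NegzE -exprnN ordV ?expf_neq0 // ordX // mulrN.
Qed.

Lemma ord_prod I (r : seq I) (P : pred I) (F : I -> E) : (forall i, P i -> F i != 0) ->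
  ord W (\prod_(i <- r | P i) F i) = \sum_(i <- r | P i) ord W (F i).
Proof.
move=> F0; elim: r => [|i r IHr]; first by rewrite !big_nil ord_one.
rewrite !big_cons; case: ifP => // Pi; rewrite ordM ?IHr ?F0 //.
by apply: (big_ind (fun x => x != 0)) => [|x y x0 y0|j /F0 //];
  [exact: oner_neq0|rewrite mulf_neq0].
Qed.

Lemma ord_unit a : is_unit W a -> ord W a = 0.
Proof.
move=> aU; apply: ordE; have [t tU] := uniformizer_ex.
by exists t, a; split=> //; rewrite expr0z mulr1.
Qed.

Lemma ord_uniformizer t : is_uniformizer W t -> ord W t = 1.
Proof. by move=> tU; apply: ordE; exists t, 1; split=> //;
  [exact: (unit1 W_place)|rewrite mul1r]. Qed.

Lemma ord_gt0 a : a != 0 -> m a <-> 0 < ord W a.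
Proof.
move=> a0; split.
  move=> ma; have [t tU] := uniformizer_ex; have [t0 Wt nt tdiv] := tU.
  have [u [u0 Wu Wu'] aE] := has_order_uniformizer W_place tU (ordP a0).
  move: ma aE; case: (ord W a) => [[|n]|n] ma aE //.
    by case: ma => _ []; rewrite aE expr0z mulr1.
  exfalso; have Wa : W a by case: ma.
  apply: nt; split=> //.
  have -> : t^-1 = a * u^-1 * t ^+ n.
    rewrite aE [u * _]mulrC mulfK // NegzE -exprnN exprS invfM -mulrA mulVf ?mulr1 //.
    by rewrite expf_neq0.
  by do !apply: (placeM W_place) => //; exact: (placeX W_place).
move=> gt0; have [Wa|nWa] := pselect (W a).
  by split=> // /ord_unit e; rewrite e in gt0.
have [t tU] := uniformizer_ex; have [t0 Wt nt tdiv] := tU.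
have [u [u0 Wu Wu'] aE] := has_order_uniformizer W_place tU (ordP a0).
case: nWa; rewrite aE; apply: (placeM W_place) => //.
by move: gt0; case: (ord W a) => // n _; exact: (placeX W_place).
Qed.

Lemma ord_ge0 a : a != 0 -> W a <-> 0 <= ord W a.
Proof.
move=> a0; split=> [Wa|].
  have [/ord_unit -> //|/(ord_gt0 a0)/ltW //] := place_unitP Wa.
rewrite le_eqVlt => /orP[/eqP z|/(ord_gt0 a0)[]//].
have [t tU] := uniformizer_ex.
have [u [u0 Wu Wu'] aE] := has_order_uniformizer W_place tU (ordP a0).
by rewrite aE -z expr0z mulr1.
Qed.

Lemma ord_eq0 a : a != 0 -> ord W a = 0 -> is_unit W a.
Proof.
move=> a0 z; have Wa : W a by apply/(ord_ge0 a0); rewrite z.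
by have [//|/(ord_gt0 a0)] := place_unitP Wa; rewrite z.
Qed.

Lemma ord_const c : c != 0 -> ord W (iota c) = 0.
Proof. by move=> c0; apply: ord_unit; apply: (unit_const W_place). Qed.

Lemma ordD_lt a b : a != 0 -> b != 0 -> ord W a < ord W b ->
  a + b != 0 /\ ord W (a + b) = ord W a.
Proof.
move=> a0 b0 lt; have ba0 : b / a != 0 by rewrite mulf_neq0 ?invr_eq0.
have mba : m (b / a) by apply/(ord_gt0 ba0); rewrite ordM ?invr_eq0 // ordV // subr_gt0.
have U : is_unit W (1 + b / a) by apply: (unitD W_place) => //; exact: (unit1 W_place).
have -> : a + b = a * (1 + b / a) by rewrite mulrDr mulr1 mulrCA mulfV // mulr1.
have U0 : 1 + b / a != 0 by case: U.
by rewrite mulf_neq0 // ordM // (ord_unit U) addr0.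
Qed.

End OnePlace.

(** An element b of V outside W has negative order at W, so every c is an element of W times a power
    of b, hence in V. *)
Lemma place_sub_eq W V : place W -> place V -> W `<=` V -> W = V.
Proof.
move=> Wp Vp WV; apply/seteqP; split=> // b Vb; apply: contrapT => nWb.
have b0 : b != 0 by apply: contra_notN nWb => /eqP ->; exact: (place0 Wp).
have ob : ord W b < 0.
  by rewrite ltNge; apply: contra_notN nWb => /(ord_ge0 Wp b0).
have [c nVc] := place_proper Vp.
have c0 : c != 0 by apply: contra_notN nVc => /eqP ->; exact: (place0 Vp).
apply: nVc; have Wq : W (c / b ^+ `|ord W c|%N).
  apply/ord_ge0 => //; first by rewrite mulf_neq0 ?invr_eq0 ?expf_neq0.
  rewrite ordM ?invr_eq0 ?expf_neq0 // ordV ?expf_neq0 // ordX //.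
  by nia.
have -> : c = c / b ^+ `|ord W c|%N * b ^+ `|ord W c|%N by rewrite divfK // expf_neq0.
by apply: (placeM Vp); [exact: WV|exact: (placeX Vp)].
Qed.

Lemma ord_opposite W V : place W -> place V -> W <> V ->
  exists y, [/\ y != 0, 0 < ord W y & ord V y < 0].
Proof.
move=> Wp Vp neq.
have sep W1 W2 : place W1 -> place W2 -> W1 <> W2 -> exists a, W1 a /\ ~ W2 a.
  move=> p1 p2 neq12; apply: contra_notP neq12 => noa; apply: place_sub_eq => // a W1a.
  by apply: contrapT => nW2; apply: noa; exists a.
have neg U c : place U -> ~ U c -> c != 0 /\ ord U c < 0.
  move=> Up nUc; have c0 : c != 0 by apply: contra_notN nUc => /eqP ->; exact: (place0 Up).
  by split=> //; rewrite ltNge; apply: contra_notN nUc => /(ord_ge0 Up c0).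
have [a [Wa nVa]] := sep _ _ Wp Vp neq; have [b [Vb nWb]] := sep _ _ Vp Wp (nesym neq).
have [a0 oa] := neg _ _ Vp nVa; have [b0 ob] := neg _ _ Wp nWb.
exists (a / b); rewrite mulf_neq0 ?invr_eq0 //; split=> //.
  rewrite ordM ?invr_eq0 // ordV //; have /(ord_ge0 Wp a0) := Wa; lia.
rewrite ordM ?invr_eq0 // ordV //; have /(ord_ge0 Vp b0) := Vb; lia.
Qed.

Lemma negative_dominates (Vs : seq (set E)) (z y : E) (r0 : nat) :
  (forall V, V \in Vs -> ord V z < 0) ->
  exists2 r : nat, (r0 <= r)%N & forall V, V \in Vs -> ord V z * r%:Z + ord V y < 0.
Proof.
elim: Vs => [_|V Vs IH neg]; first by exists r0.
have [|r ler rP] := IH; first by move=> U UVs; apply: neg; rewrite inE UVs orbT.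
exists (r + `|ord V y| + 1)%N; first by lia.
move=> U; rewrite inE => /predU1P[->|UVs].
  have := neg V (mem_head _ _); nia.
have := rP U UVs; have := neg U; rewrite inE UVs orbT => /(_ isT); nia.
Qed.

Lemma weak_approximation W (Vs : seq (set E)) : place W ->
  (forall V, V \in Vs -> place V /\ W <> V) ->
  exists z, [/\ z != 0, 0 < ord W z & forall V, V \in Vs -> ord V z < 0].
Proof.
move=> Wp; elim: Vs => [_|V Vs IH VsP].
  have [t tU] := uniformizer_ex Wp; exists t; split=> //; first by case: tU.
  by rewrite (ord_uniformizer Wp tU).
have [|z [z0 zW zVs]] := IH; first by move=> U UVs; apply: VsP; rewrite inE UVs orbT.
have [Vp neqV] := VsP V (mem_head _ _).
have pl U : U \in Vs -> place U by move=> UVs; case: (VsP U); rewrite // inE UVs orbT.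
have [y [y0 yW yV]] := ord_opposite Wp Vp neqV.
have [r r1 rP] := negative_dominates y 1 zVs.
have zr0 : z ^+ r != 0 by rewrite expf_neq0.
have [zV|zV] := leP (ord V z) 0.
  exists (z ^+ r * y); rewrite mulf_neq0 //; split=> // [|U].
    by rewrite ordM // ordX //; nia.
  rewrite inE => /predU1P[->|UVs]; first by rewrite ordM // ordX //; nia.
  by rewrite (ordM (pl U UVs)) // (ordX (pl U UVs)) //; apply: rP.
(* When z also has a zero at V, the factor 1 + z^r replaces z^r: it is a unit where z vanishes and
   has the same order as z^r where z has a pole. *)
have one_plus U : place U -> 0 < ord U z -> 1 + z ^+ r != 0 /\ ord U (1 + z ^+ r) = 0.
  move=> Up zU; have := @ordD_lt U Up 1 (z ^+ r) (oner_neq0 _) zr0.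
  by rewrite ord_one // ordX //; apply; nia.
have [w0 wW] := one_plus W Wp zW; have [_ wV] := one_plus V Vp zV.
exists ((1 + z ^+ r) * y); rewrite mulf_neq0 //; split=> // [|U].
  by rewrite ordM // wW add0r.
rewrite inE => /predU1P[->|UVs]; first by rewrite ordM // wV add0r.
have Up := pl U UVs; have zU := zVs U UVs.
have lt : ord U (z ^+ r) < ord U 1 by rewrite ord_one // ordX //; nia.
have [_] := ordD_lt Up zr0 (oner_neq0 _) lt.
by rewrite addrC ordX // ordM // => ->; apply: rP.
Qed.

(** The function is (t + z^r) / (1 + z^r), with t a uniformizer at W and z vanishing at W with poles
    along Vs. At W it behaves like t because r is at least 2; at the other places z^r dominates
    numerator and denominator. *)
Lemma separating_function W (Vs : seq (set E)) : place W ->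
  (forall V, V \in Vs -> place V /\ W <> V) ->
  exists f, [/\ f != 0, ord W f = 1 & forall V, V \in Vs -> ord V f = 0].
Proof.
move=> Wp VsP; have [z [z0 zW zVs]] := weak_approximation Wp VsP.
have [t tU] := uniformizer_ex Wp; have tW := ord_uniformizer Wp tU; have [t0 _ _ _] := tU.
have [r r2 rP] := negative_dominates t^-1 2 zVs.
have zr0 : z ^+ r != 0 by rewrite expf_neq0.
have [w0 wW] : 1 + z ^+ r != 0 /\ ord W (1 + z ^+ r) = 0.
  have := @ordD_lt W Wp 1 (z ^+ r) (oner_neq0 _) zr0.
  by rewrite ord_one // ordX //; apply; nia.
have [s0 sW] : t + z ^+ r != 0 /\ ord W (t + z ^+ r) = 1.
  by have := @ordD_lt W Wp t (z ^+ r) t0 zr0; rewrite tW ordX //; apply; nia.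
exists ((t + z ^+ r) / (1 + z ^+ r)); rewrite mulf_neq0 ?invr_eq0 //; split=> // [|V VVs].
  by rewrite ordM ?invr_eq0 // ordV // sW wW subr0.
have [Vp _] := VsP V VVs; have zV := zVs V VVs; have := rP V VVs; rewrite ordV // => rV.
rewrite ordM ?invr_eq0 // ordV // [t + _]addrC [1 + _]addrC.
have lt1 : ord V (z ^+ r) < ord V 1 by rewrite ord_one // ordX //; nia.
have ltt : ord V (z ^+ r) < ord V t by rewrite ordX //; lia.
have [_ ->] := ordD_lt Vp zr0 (oner_neq0 _) lt1; have [_ ->] := ordD_lt Vp zr0 t0 ltt.
exact: subrr.
Qed.

Section Preimage.
Variable phi : {rmorphism E -> E}.
Hypothesis phi_surj : forall a, exists b, phi b = a.
Hypothesis phi_const : forall c, exists d, phi (iota c) = iota d.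

Lemma place_preimage W : place W -> place (phi @^-1` W).
Proof.
move=> Wp; split=> //.
- by move=> _ [c _ <-] /=; have [d ->] := phi_const c; exact: (place_const Wp).
- move=> e; have [a nWa] := place_proper Wp; have [b ba] := phi_surj a.
  have : (phi @^-1` W) b by rewrite e.
  by rewrite /= ba.
- by move=> a b /= Wa Wb; rewrite rmorphB rmorphM; split; [exact: (placeB Wp)|exact: (placeM Wp)].
- by move=> a _ /=; rewrite fmorphV; exact: (place_total Wp).
Qed.

Lemma is_unit_preimage W a : is_unit (phi @^-1` W) a <-> is_unit W (phi a).
Proof.
split=> -[a0 Wa Wa']; split=> //.
- by rewrite fmorph_eq0.
- by rewrite -fmorphV.
- by rewrite -(fmorph_eq0 phi).
- by rewrite /= fmorphV.
Qed.

Lemma ord_preimage W a : place W -> a != 0 -> ord (phi @^-1` W) a = ord W (phi a).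
Proof.
move=> Wp a0; have [t [u [tU uU aE]]] := ordP (place_preimage Wp) a0.
apply/esym/(ordE Wp); exists (phi t), (phi u); split; last 2 first.
- exact/is_unit_preimage.
- by rewrite {1}aE rmorphM fmorphXz.
have [t0 Wt nt tdiv] := tU; split; rewrite ?fmorph_eq0 //.
  by move/(is_unit_preimage W t).2.
move=> b; have [c <-] := phi_surj b => Wc nc; rewrite -fmorph_div; apply: tdiv => //.
by move/(is_unit_preimage W c).1.
Qed.

End Preimage.
End Order.

(** * Ramification in quotients *)

(** The decomposition group of W. As all residues are constants, it acts trivially on them and is
    also the inertia group. *)
Definition stabilizer (E : fieldType) (g : 'S_4 -> {rmorphism E -> E}) (H : {group 'S_4})
    (W : set E) : {set 'S_4} := [set h in H | `[< g h @^-1` W = W >]].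

Section GroupOnPlaces.
Variables (k E : fieldType) (iota : {rmorphism k -> E}).
Local Notation place := (is_place iota [set: E]).
Hypothesis has_order_ex : forall W, place W -> forall a, a != 0 -> exists n, has_order W a n.
Hypothesis residue_ex : forall W, place W -> forall a, W a -> exists c, in_max_ideal W (a - iota c).
Variable g : 'S_4 -> {rmorphism E -> E}.
Hypothesis g_act : S4_action g.
Hypothesis gC : forall s c, g s (iota c) = iota c.
Hypothesis g_faithful : forall s, (forall a, g s a = a) -> s = 1%g.

Lemma act_surj h a : exists b, g h b = a.
Proof. by exists (g h^-1%g a); rewrite g_act.2 mulVg g_act.1. Qed.

Lemma place_act h W : place W -> place (g h @^-1` W).
Proof. by apply: place_preimage; [exact: act_surj|move=> c; exists c; rewrite gC]. Qed.

Lemma ord_act h W a : place W -> a != 0 -> ord (g h @^-1` W) a = ord W (g h a).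
Proof. by apply: (ord_preimage has_order_ex); [exact: act_surj|move=> c; exists c; rewrite gC]. Qed.

Lemma place_act1 W : g 1%g @^-1` W = W.
Proof. by apply/seteqP; split=> a /=; rewrite g_act.1. Qed.

Lemma place_actM h t W : g h @^-1` (g t @^-1` W) = g (h * t)%g @^-1` W.
Proof. by apply/seteqP; split=> a /=; rewrite g_act.2. Qed.

Lemma place_act_inj h W W' : g h @^-1` W = g h @^-1` W' -> W = W'.
Proof. by move/(congr1 (fun V => g h^-1%g @^-1` V)); rewrite !place_actM mulVg !place_act1. Qed.

Variable H : {group 'S_4}.

Lemma stabilizerP W h : h \in H -> (h \in stabilizer g H W) <-> g h @^-1` W = W.
Proof. by move=> hH; rewrite inE hH /=; split=> /asboolP. Qed.

Lemma group_set_stabilizer W : group_set (stabilizer g H W).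
Proof.
apply/group_setP; split=> [|h t]; first by rewrite inE group1; apply/asboolP/place_act1.
rewrite !inE => /andP[hH /asboolP hW] /andP[tH /asboolP tW].
by rewrite groupM //=; apply/asboolP; rewrite -place_actM tW.
Qed.
Canonical stabilizer_group W := Group (group_set_stabilizer W).

Lemma stabilizer_sub W : stabilizer g H W \subset H.
Proof. by apply/fintype.subsetP => h; rewrite inE => /andP[]. Qed.

Lemma ord_group_norm W a : place W -> a != 0 ->
  ord W (group_norm g H a) = \sum_(h in H) ord (g h @^-1` W) a.
Proof.
move=> Wp a0; rewrite (ord_prod has_order_ex Wp) => [|h _]; last by rewrite fmorph_eq0.
by apply: eq_bigr => h _; rewrite ord_act.
Qed.

(** If W' is not conjugate to W, take f of order 1 at W' and order 0 at the conjugates of W and the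
    other conjugates of W'. Its norm is invariant, a unit at W and a non-unit at W'. *)
Lemma place_transitive W W' : place W -> place W' ->
  (forall a, fixed_by g H a -> W a <-> W' a) -> exists2 h, h \in H & g h @^-1` W = W'.
Proof.
move=> Wp W'p WW'; apply: contrapT => norbit.
have neq h : h \in H -> W' <> g h @^-1` W by move=> hH e; apply: norbit; exists h.
pose Vs := [seq g h @^-1` W | h <- enum H] ++
  [seq V <- [seq g h @^-1` W' | h <- enum H] | V != W'].
have [V|f [f0 fW' fVs]] := @separating_function _ _ _ has_order_ex W' Vs W'p.
  rewrite mem_cat => /orP[/mapP[h]|].
    by rewrite mem_enum => hH ->; split; [exact: place_act|exact: neq].
  rewrite mem_filter => /andP[/eqP neV /mapP[h _ e]]; split; last exact: nesym.
  by rewrite e; exact: place_act.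
have n0 := group_norm_neq0 g H f0; have nfix := group_norm_fixed g_act f (H := H).
have nW : ord W (group_norm g H f) = 0.
  rewrite ord_group_norm // big1 // => h hH; apply: fVs.
  by rewrite mem_cat; apply/orP; left; apply/mapP; exists h; rewrite ?mem_enum.
have nW' : 0 < ord W' (group_norm g H f).
  rewrite ord_group_norm // (bigD1 1%g) //= place_act1 fW' ltr_pwDl // sumr_ge0 // => h /andP[hH _].
  have [->|ne] := eqVneq (g h @^-1` W') W'; first by rewrite fW'.
  rewrite fVs // mem_cat mem_filter ne /= orbC.
  by apply/orP; left; apply/mapP; exists h; rewrite ?mem_enum.
have inv_fix : fixed_by g H (group_norm g H f)^-1.
  by move=> h hH; rewrite fmorphV nfix.
have /(ord_ge0 has_order_ex W'p (invr_neq0 n0)) : W' (group_norm g H f)^-1.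
  apply/(WW' _ inv_fix); apply/(ord_ge0 has_order_ex Wp); first exact: invr_neq0.
  by rewrite (ordV has_order_ex Wp) // nW.
by rewrite (ordV has_order_ex W'p) //; lia.
Qed.

(** The norm of a function of order 1 at W and 0 at its other conjugates: each element of the
    stabilizer contributes 1. *)
Lemma fixed_order_exact W : place W ->
  exists a, [/\ fixed_by g H a, a != 0 & ord W a = #|stabilizer g H W|%:Z].
Proof.
move=> Wp; pose Vs := [seq V <- [seq g h @^-1` W | h <- enum H] | V != W].
have [V|f [f0 fW fVs]] := @separating_function _ _ _ has_order_ex W Vs Wp.
  rewrite mem_filter => /andP[/eqP neV /mapP[h _ e]]; split; last exact: nesym.
  by rewrite e; exact: place_act.
exists (group_norm g H f); split; [exact: group_norm_fixed|exact: group_norm_neq0|].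
rewrite ord_group_norm // (bigID (mem (stabilizer g H W))) /= [X in _ + X]big1 ?addr0.
  rewrite (eq_bigr (fun=> 1)) => [|h /andP[hH /(stabilizerP W hH) ->]//].
  rewrite sumr_const -[RHS]natz; congr (1 *+ _); apply: eq_card => h.
  by rewrite -topredE /= !inE; case: (h \in H).
move=> h /andP[hH hS]; apply: fVs; rewrite mem_filter; apply/andP; split.
  by apply: contraNneq hS => e; apply/(stabilizerP W hH).
by apply/mapP; exists h; rewrite ?mem_enum.
Qed.

(** * Tame ramification in a cyclic quotient *)

Section Tame.
Hypothesis k24 : 24%:R != 0 :> k.
Hypothesis H_cyclic : cyclic H.
Variable W : set E.
Hypothesis Wp : place W.
Local Notation m := (in_max_ideal W).

Lemma residueM a b c d : m (a - iota c) -> m (b - iota d) -> m (a * b - iota (c * d)).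
Proof.
move=> ma mb.
have Wa : W a by rewrite -[a](subrK (iota c)); apply: (placeD Wp) (place_const Wp c); case: ma.
have -> : a * b - iota (c * d) = a * (b - iota d) + iota d * (a - iota c).
  by rewrite rmorphM; ring.
by apply: (max_idealD Wp); apply: (max_idealM Wp) => //; exact: (place_const Wp).
Qed.

Lemma residue1 : m (1 - iota 1). Proof. by rewrite rmorph1 subrr; exact: (max_ideal0 Wp). Qed.

Lemma residueX a c n : m (a - iota c) -> m (a ^+ n - iota (c ^+ n)).
Proof. by move=> ma; elim: n => [|n IHn]; [exact: residue1|rewrite !exprS; exact: residueM]. Qed.

Lemma residueV a c : c != 0 -> m (a - iota c) -> m (a^-1 - iota c^-1).
Proof.
move=> c0 ma; have aU : is_unit W a.
  by rewrite -[a](subrK (iota c)) addrC; apply: (unitD Wp) => //; exact: (unit_const Wp).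
have [a0 _ Wa'] := aU; have c0' : iota c != 0 by rewrite fmorph_eq0.
have -> : a^-1 - iota c^-1 = a^-1 * iota c^-1 * (- (a - iota c)).
  by rewrite fmorphV; field; rewrite a0 c0'.
apply: (max_idealM Wp); last exact: (max_idealN Wp).
by apply: (placeM Wp) => //; exact: (place_const Wp).
Qed.

Lemma residueXz a c (n : int) : c != 0 -> m (a - iota c) -> m (a ^ n - iota (c ^ n)).
Proof.
move=> c0 ma; case: n => n; first exact: residueX.
by rewrite NegzE -!exprnN; apply: residueV; [rewrite expf_neq0|exact: residueX].
Qed.

Lemma residue_uniq a c d : m (a - iota c) -> m (a - iota d) -> c = d.
Proof.
move=> ma mb; apply/eqP; rewrite -subr_eq0; apply/eqP; apply: (max_ideal_const Wp).
have -> : iota (c - d) = (a - iota d) - (a - iota c) by rewrite rmorphB; ring.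
by apply: (max_idealD Wp) => //; exact: (max_idealN Wp).
Qed.

Lemma stab_max_ideal h a : h \in stabilizer g H W -> m a -> m (g h a).
Proof.
rewrite inE => /andP[hH /asboolP hW] [Wa nu]; have Wga : W (g h a) by rewrite -hW /= in Wa.
split=> // -[ga0 _ Wga']; apply: nu; split=> //; first by rewrite -(fmorph_eq0 (g h)).
by rewrite -hW /= fmorphV.
Qed.

Lemma stab_residue h a c : h \in stabilizer g H W -> m (a - iota c) -> m (g h a - iota c).
Proof. by move=> hS /(stab_max_ideal hS); rewrite rmorphB gC. Qed.

Lemma residue_ratio h a : h \in stabilizer g H W -> is_unit W a -> m (g h a / a - iota 1).
Proof.
move=> hS aU; have [a0 Wa Wa'] := aU.
have [c mc] := residue_ex Wp Wa; have gc := stab_residue hS mc.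
have -> : g h a / a - iota 1 = a^-1 * ((g h a - iota c) - (a - iota c)).
  by rewrite rmorph1 mulrC; field.
by apply: (max_idealM Wp) => //; apply: (max_idealD Wp) => //; exact: (max_idealN Wp).
Qed.

Variable t : E.
Hypothesis tU : is_uniformizer W t.
Let t0 : t != 0. Proof. by case: tU. Qed.

Lemma inertia_character h : h \in stabilizer g H W ->
  exists2 z, z != 0 & m (g h t / t - iota z).
Proof.
move=> hS; have gt0 : g h t != 0 by rewrite fmorph_eq0.
have gtt0 : g h t / t != 0 by rewrite mulf_neq0 ?invr_eq0.
have U : is_unit W (g h t / t).
  apply: (ord_eq0 has_order_ex Wp gtt0).
  rewrite (ordM has_order_ex Wp) ?invr_eq0 // (ordV has_order_ex Wp) // -ord_act //.
  move: hS; rewrite inE => /andP[_ /asboolP ->]; exact: subrr.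
have [z mz] := residue_ex Wp (let: And3 _ W' _ := U in W').
exists z => //; apply: contra_not_neq (unit_not_max U) => z0.
by rewrite z0 rmorph0 subr0 in mz.
Qed.

(** Write a = u t^n with u a unit; since h fixes residues, only t^n contributes. *)
Lemma residue_character h z a : h \in stabilizer g H W -> m (g h t / t - iota z) -> z != 0 ->
  a != 0 -> m (g h a / a - iota (z ^ ord W a)).
Proof.
move=> hS mz z0 a0.
have [u uU aE] := has_order_uniformizer Wp tU (ordP has_order_ex Wp a0).
have [u0 _ _] := uU; set n := ord W a in aE *.
have -> : g h a / a = (g h u / u) * (g h t / t) ^ n.
  by rewrite aE rmorphM fmorphXz invfM mulrACA expfzMl exprz_inv invr_expz.
rewrite -[z ^ n]mul1r; apply: residueM; first exact: residue_ratio.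
exact: residueXz.
Qed.

(** Here h c / c has residue 1 for every nonzero c. If b = h a - a were nonzero, the sum of its
    images under the powers of h would telescope to 0, while each image divided by b has residue 1.
    So the order of h would vanish in k, although it divides 24. *)
Lemma inertia_trivial h : h \in stabilizer g H W -> m (g h t / t - iota 1) -> h = 1%g.
Proof.
move=> hS mh; apply: g_faithful => a; apply/eqP; apply: contraT => ne.
pose b := g h a - a; have b0 : b != 0 by rewrite subr_eq0.
have ratio c : c != 0 -> m (g h c / c - iota 1).
  by move=> c0; have := residue_character hS mh (oner_neq0 _) c0; rewrite exp1rz.
have hXS i : (h ^+ i)%g \in stabilizer g H W by exact: (groupX (G := stabilizer_group W)).
have ratioX i : m (g (h ^+ i)%g b / b - iota 1).
  elim: i => [|i IHi].
    by rewrite expg0 g_act.1 mulfV // rmorph1 subrr; exact: (max_ideal0 Wp).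
  have ghb0 : g (h ^+ i)%g b != 0 by rewrite fmorph_eq0.
  have -> : g (h ^+ i.+1)%g b / b = (g h (g (h ^+ i)%g b) / g (h ^+ i)%g b) * (g (h ^+ i)%g b / b).
    by rewrite mulrA divfK // g_act.2 -expgSr.
  by have := residueM (ratio _ ghb0) IHi; rewrite mulr1.
have sum0 : \sum_(i < #[h]%g) g (h ^+ i)%g b = 0.
  rewrite -(big_mkord xpredT (fun i => g (h ^+ i)%g b)).
  under eq_bigr do rewrite rmorphB g_act.2 -expgS.
  rewrite (telescope_sumr (fun i => g (h ^+ i)%g a)) //.
  by rewrite expg_order expg0 subrr.
have [] : ~ m (iota #[h]%g%:R).
  apply: (unit_not_max (unit_const Wp _)).
  have dvd24 : (#[h]%g %| 24)%N.
    have -> : 24%N = #|[set: 'S_4]%G| by rewrite cardsT card_Sn.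
    by apply: cardSg; exact: finset.subsetT.
  by apply: contraNneq k24; case/dvdnP: dvd24 => q ->; rewrite natrM => ->; rewrite mulr0.
have -> : iota #[h]%g%:R = - \sum_(i < #[h]%g) (g (h ^+ i)%g b / b - iota 1).
  by rewrite sumrB -mulr_suml sum0 mul0r sub0r opprK rmorph1 sumr_const card_ord rmorph_nat.
by apply: (max_idealN Wp); apply: (max_ideal_sum Wp).
Qed.

(** A generator u of the stabilizer multiplies t by a constant z up to higher order. Invariance of a
    gives z^n = 1 for n = ord a, so u^n acts on t with residue 1 and is therefore trivial. *)
Lemma fixed_order_dvd a : fixed_by g H a -> a != 0 -> (#|stabilizer g H W|%:Z %| ord W a)%Z.
Proof.
move=> afix a0; have /cyclicP[u uS] : cyclic (stabilizer_group W).
  by apply: cyclicS H_cyclic; exact: stabilizer_sub.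
have uS' :
  u \in stabilizer g H W by rewrite -[stabilizer g H W]/(gval (stabilizer_group W)) uS cycle_id.
have [z z0 mz] := inertia_character uS'.
have zn : z ^ ord W a = 1.
  apply: residue_uniq (residue_character uS' mz z0 a0) _.
  rewrite afix ?mulfV //; first exact: residue1.
  by move: uS'; rewrite inE => /andP[].
have -> : #|stabilizer g H W| = #[u]%g.
  by rewrite -[stabilizer g H W]/(gval (stabilizer_group W)) uS.
have zN : z ^+ `|ord W a| = 1.
  by move: zn; case: (ord W a) => n //; rewrite NegzE -exprnN => /(congr1 GRing.inv);
    rewrite invrK invr1.
rewrite dvdzE /= order_dvdn; apply/eqP; apply: inertia_trivial.
  exact: (groupX (G := stabilizer_group W)).
rewrite -zN; elim: `|ord W a|%N => [|n IHn].
  by rewrite expg0 expr0 g_act.1 mulfV //; exact: residue1.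
have gt0 : g (u ^+ n)%g t != 0 by rewrite fmorph_eq0.
have -> : g (u ^+ n.+1)%g t / t = g u (g (u ^+ n)%g t / t) * (g u t / t).
  by rewrite fmorph_div g_act.2 -expgSr mulrA divfK // fmorph_eq0.
by rewrite exprSr; apply: residueM => //; exact: stab_residue.
Qed.
End Tame.
End GroupOnPlaces.

(** * Divisors on quotients *)

Section FixedField.
Variables (k E : fieldType) (iota : {rmorphism k -> E}).
Local Notation place := (is_place iota [set: E]).
Hypothesis has_order_ex : forall W, place W -> forall a, a != 0 -> exists n, has_order W a n.
Hypothesis residue_ex : forall W, place W -> forall a, W a -> exists c, in_max_ideal W (a - iota c).
Variable g : 'S_4 -> {rmorphism E -> E}.
Hypothesis g_act : S4_action g.
Hypothesis gC : forall s c, g s (iota c) = iota c.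
Hypothesis g_faithful : forall s, (forall a, g s a = a) -> s = 1%g.
Hypothesis k24 : 24%:R != 0 :> k.
Variable H : {group 'S_4}.
Hypothesis H_cyclic : cyclic H.
Local Notation M := (fixed_by g H).
Local Notation stab := (stabilizer g H).
Let M_sub := fixed_by_subfield g H.

Lemma constants_fixed : range iota `<=` M.
Proof. by move=> _ [c _ <-] h _; rewrite gC. Qed.

Lemma card_stabilizer_gt0 W : (0 < #|stab W|)%N.
Proof. by apply/card_gt0P; exists 1%g; rewrite inE group1; apply/asboolP/(place_act1 g_act). Qed.

Lemma place_restrict W : place W -> is_place iota M (W `&` M).
Proof.
move=> Wp; split.
- by move=> a ia; split; [case: ia => c _ <-; exact: (place_const Wp)|exact: constants_fixed].
- by move=> a [].
- move=> e; have [a [aM a0 oa]] := fixed_order_exact has_order_ex g_act gC H Wp.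
  have [/(ord_ge0 has_order_ex Wp (invr_neq0 a0))] : (W `&` M) a^-1.
    by rewrite e; apply: (subfieldV M_sub).
  by rewrite (ordV has_order_ex Wp) // oa; have := card_stabilizer_gt0 W; lia.
- move=> a b [Wa Ma] [Wb Mb]; split; split.
  + exact: (placeB Wp).
  + exact: (subfieldB M_sub).
  + exact: (placeM Wp).
  + exact: (subfieldM M_sub).
- move=> a Ma; case: (place_total Wp a); [left|right]; split=> //; exact: (subfieldV M_sub).
Qed.

(** The existence theorem is applied to v and its maximal ideal. Of two elements of a valuation ring
    one divides the other, whence directedness. *)
Lemma place_extend v : is_place iota M v -> exists W, place W /\ W `&` M = v.
Proof.
move=> [kv vM vneq vBM vtot].
pose I : set E := [set a | v a /\ (a != 0 -> ~ v a^-1)].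
have v1 : v 1 by apply: kv; exists 1; rewrite ?rmorph1.
have Iv : I `<=` v by move=> a [].
have Inonunit i : I i -> i != 0 -> ~ v i^-1 by case.
have Idir i j : I i -> I j -> exists m a b, [/\ I m, v a, v b, i = a * m & j = b * m].
  move=> Ii Ij; have [i0|i0] := eqVneq i 0.
    by exists j, 0, 1; rewrite i0 mul0r mul1r; split=> //; apply: (subring0 v1 vBM).
  have [j0|j0] := eqVneq j 0.
    by exists i, 1, 0; rewrite j0 mul0r mul1r; split=> //; apply: (subring0 v1 vBM).
  have [vi vj] := (Iv _ Ii, Iv _ Ij).
  have [vij|vji] := vtot _ (subfield_div M_sub (vM _ vi) (vM _ vj)).
    by exists j, (i / j), 1; rewrite divfK // mul1r.
  by rewrite invf_div in vji; exists i, 1, (j / i); rewrite divfK // mul1r.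
have [W [vW WBM Wtot Wnonunit]] := valuation_ring_exists v1 vBM Iv Idir Inonunit.
have [a Ma nva] : exists2 a, M a & ~ v a.
  apply: contra_notP vneq => noa; apply/seteqP; split=> // a Ma.
  by apply: contrapT => nva; apply: noa; exists a.
have nonunit b : M b -> ~ v b -> ~ W b.
  move=> Mb nvb Wb; have b0 : b != 0.
    by apply: contra_notN nvb => /eqP ->; exact: (subring0 v1 vBM).
  have [//|vb'] := vtot b Mb; apply: (Wnonunit b^-1); rewrite ?invr_eq0 ?invrK //.
  by split=> // _; rewrite invrK.
exists W; split; first split=> //.
- by move=> _ [c _ <-]; apply/vW/kv; exists c.
- by move=> e; apply: (nonunit a) => //; rewrite e.
apply/seteqP; split=> [b [Wb Mb]|b vb]; last by split; [exact: vW|exact: vM].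
by apply: contrapT => nvb; apply: (nonunit b).
Qed.

(** The ramification index is the order of the stabilizer: all orders of invariant functions are
    multiples of it, so an invariant function of exactly this order is a uniformizer below. *)
Lemma has_order_restrict W a n : place W -> M a -> a != 0 ->
  has_order (W `&` M) a n <-> ord W a = n * #|stab W|%:Z.
Proof.
move=> Wp Ma a0; have [pi [piM pi0 opi]] := fixed_order_exact has_order_ex g_act gC H Wp.
have e_gt0 := card_stabilizer_gt0 W; set e := #|stab W| in opi e_gt0 *.
have piU : is_uniformizer (W `&` M) pi.
  split=> //.
  - by split=> //; apply/(ord_ge0 has_order_ex Wp pi0); rewrite opi; lia.
  - move=> [_ _ [/(ord_ge0 has_order_ex Wp (invr_neq0 pi0))]].
    by rewrite (ordV has_order_ex Wp) // opi; lia.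
  - move=> b [Wb Mb] nb; split; last exact: (subfield_div M_sub).
    have [->|b0] := eqVneq b 0; first by rewrite mul0r; exact: (place0 Wp).
    apply/(ord_ge0 has_order_ex Wp); first by rewrite mulf_neq0 ?invr_eq0.
    rewrite (ordM has_order_ex Wp) ?invr_eq0 // (ordV has_order_ex Wp) // opi.
    have mb : in_max_ideal W b.
      split=> // -[_ _ Wb']; apply: nb; split=> //; split=> //; exact: (subfieldV M_sub).
    have /(ord_gt0 has_order_ex Wp b0) ob := mb.
    have := fixed_order_dvd has_order_ex residue_ex g_act gC g_faithful k24 H_cyclic Wp.
    have [t tU] := uniformizer_ex has_order_ex Wp.
    move=> /(_ t tU b Mb b0) /dvdzP[q]; rewrite -/e => oq.
    have e_gt0' : 0 < e%:Z by rewrite ltz_nat.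
    have q_gt0 : 0 < q by rewrite oq pmulr_lgt0 // in ob.
    by rewrite oq -[X in _ - X]mul1r -mulrBl mulr_ge0 ?subr_ge0 //; lia.
split=> [[t [u [tU uU aE]]]|oa].
  have [t0 [Wt Mt] nt tdiv] := tU; have [u0 [Wu Mu] [Wu' _]] := uU.
  have oT : ord W t = e.
    have [_ Wpi npi pidiv] := piU.
    have o1 : 0 <= ord W (t / pi).
      apply/(ord_ge0 has_order_ex Wp); first by rewrite mulf_neq0 ?invr_eq0.
      by have [] := pidiv t (conj Wt Mt) nt.
    have o2 : 0 <= ord W (pi / t).
      apply/(ord_ge0 has_order_ex Wp); first by rewrite mulf_neq0 ?invr_eq0.
      by have [] := tdiv pi Wpi npi.
    move: o1 o2; rewrite !(ordM has_order_ex Wp) ?invr_eq0 // !(ordV has_order_ex Wp) // opi.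
    lia.
  rewrite aE (ordM has_order_ex Wp) ?expfz_neq0 // (ordXz has_order_ex Wp) // oT.
  by rewrite (ord_unit has_order_ex Wp) ?add0r 1?mulrC.
have pin0 : pi ^ n != 0 by rewrite expfz_neq0.
have Mpin : M (pi ^ n).
  by case: (n) => j; [|apply: (subfieldV M_sub) => //]; apply: (subfield_exp M_sub).
exists pi, (a / pi ^ n); split=> //; last by rewrite divfK.
have [u0 Wu Wu'] : is_unit W (a / pi ^ n).
  apply: (ord_eq0 has_order_ex Wp); first by rewrite mulf_neq0 ?invr_eq0.
  rewrite (ordM has_order_ex Wp) ?invr_eq0 // (ordV has_order_ex Wp) //.
  by rewrite (ordXz has_order_ex Wp) // oa opi mulrC subrr.
by split=> //; split=> //; [|apply: (subfieldV M_sub) => //]; apply: (subfield_div M_sub).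
Qed.

(** Every place of the quotient lies under a place of E, so principal divisors of the quotient can
    be tested upstairs. *)
Lemma is_principalE D : is_principal iota M D <->
  exists f, [/\ M f, f != 0 & forall W, place W -> ord W f = D (W `&` M) * #|stab W|%:Z].
Proof.
split=> -[f [Mf f0 fD]]; exists f; split=> //.
  by move=> W Wp; apply/has_order_restrict => //; apply: fD; exact: place_restrict.
move=> v /place_extend[W [Wp <-]]; apply/has_order_restrict => //; exact: fD.
Qed.

Lemma lin_equiv_refl D : lin_equiv iota M D D.
Proof.
apply/is_principalE; exists 1; split; [exact: (subfield1 M_sub)|exact: oner_neq0|].
by move=> W Wp; rewrite (ord_one has_order_ex Wp) subrr mul0r.
Qed.

Lemma is_principalB D D' : is_principal iota M D -> is_principal iota M D' ->
  is_principal iota M (D - D').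
Proof.
move=> /is_principalE[f [Mf f0 fD]] /is_principalE[f' [Mf' f'0 f'D]].
apply/is_principalE; exists (f / f'); split;
  [exact: (subfield_div M_sub)|by rewrite mulf_neq0 ?invr_eq0|].
move=> W Wp; rewrite (ordM has_order_ex Wp) ?invr_eq0 // (ordV has_order_ex Wp) //.
by rewrite fD // f'D // -mulrBl.
Qed.

End FixedField.

Section FiniteSupport.
Variable T : choiceType.

Lemma finite_support_seq (D : T -> int) :
  finite_set [set V | D V != 0] -> exists2 s : seq T, uniq s & forall V, V \notin s -> D V = 0.
Proof.
move=> /finite_seqP[s Ds]; exists (undup s); first exact: undup_uniq.
move=> V; rewrite mem_undup => Vs; apply/eqP; apply: contraNT Vs => DV.
by have : [set V | D V != 0] V by []; rewrite Ds.
Qed.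

Lemma fsbig_uniq_seq (s : seq T) (D : T -> int) :
  uniq s -> (forall V, V \notin s -> D V = 0) ->
  \sum_(V \in [set: T]) D V = \sum_(V <- s) D V.
Proof.
move=> us Ds; rewrite (fsbigTE [fset V in s]%fset); last first.
  by move=> V; rewrite inE => /Ds.
by apply: perm_big; rewrite perm_sym; apply/uniq_perm; rewrite ?fset_uniq // => V; rewrite inE.
Qed.

Lemma finite_support_of_seq (s : seq T) (D : T -> int) :
  (forall V, V \notin s -> D V = 0) -> finite_set [set V | D V != 0].
Proof.
move=> Ds; apply: (sub_finite_set _ (finite_seq s)) => V /=.
by apply: contraTT => /Ds ->; rewrite eqxx.
Qed.
End FiniteSupport.

Lemma frob_divisor_finite_support (E : fieldType) (phi : E -> E) (D : set E -> int) :
  (forall a, exists b, phi b = a) ->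
  finite_set [set V | D V != 0] -> finite_set [set V | frob_divisor phi D V != 0].
Proof.
move=> surj /finite_support_seq[s us Ds].
apply: (@finite_support_of_seq _ [seq phi @` V | V <- s]) => V Vs; apply: Ds.
apply: contraNN Vs => Vs; apply/mapP; exists (phi @^-1` V) => //.
apply/seteqP; split=> [a Va|_ [a Va <-]//].
by have [b ba] := surj a; exists b => //; rewrite /= ba.
Qed.

Lemma divisorBE (T : Type) (D D' : T -> int) V : (D - D') V = D V - D' V.
Proof. by []. Qed.

Section Divisors.
Variables (k E : fieldType) (iota : {rmorphism k -> E}).
Local Notation place := (is_place iota [set: E]).
Hypothesis has_order_ex : forall W, place W -> forall a, a != 0 -> exists n, has_order W a n.
Hypothesis residue_ex : forall W, place W -> forall a, W a -> exists c, in_max_ideal W (a - iota c).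
Variable g : 'S_4 -> {rmorphism E -> E}.
Hypothesis g_act : S4_action g.
Hypothesis gC : forall s c, g s (iota c) = iota c.
Hypothesis g_faithful : forall s, (forall a, g s a = a) -> s = 1%g.
Hypothesis k24 : 24%:R != 0 :> k.
Variable H : {group 'S_4}.
Hypothesis H_cyclic : cyclic H.
Local Notation M := (fixed_by g H).
Local Notation stab := (stabilizer g H).
Let princE := is_principalE has_order_ex residue_ex g_act gC g_faithful k24 H_cyclic.

(** The multiplicity is the ramification index. Divisors are functions on all sets, hence the value
    0 off the places. *)
Definition pullback (D : set E -> int) : set E -> int := fun W =>
  if `[< is_place iota [set: E] W >] then D (W `&` fixed_by g H) * #|stabilizer g H W|%:Z else 0.

(** Residue degrees are 1, so the fibres are summed with multiplicity one. *)
Definition pushforward (D : set E -> int) : set E -> int := fun v =>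
  \sum_(W \in [set: set E]) (if W `&` fixed_by g H == v then D W else 0).

Lemma place_actE h W : place (g h @^-1` W) <-> place W.
Proof.
split; last exact: (place_act g_act gC).
by move=> /(place_act g_act gC h^-1%g); rewrite (place_actM g_act) mulVg (place_act1 g_act).
Qed.

Lemma act_restrict h W : h \in H -> (g h @^-1` W) `&` M = W `&` M.
Proof.
move=> hH; apply/seteqP; split=> a [Wa aM]; split=> //.
  by move: Wa; rewrite /= aM.
by rewrite /= aM.
Qed.

Lemma card_orbit_fiber V W : place V -> place W -> V `&` M = W `&` M ->
  #|[set h in H | `[< g h @^-1` W = V >]]| = #|stab W|.
Proof.
move=> Vp Wp VW.
have [|h0 h0H h0W] := place_transitive has_order_ex g_act gC (H := H) Wp Vp.
  move=> a aM; split=> [Wa|Va].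
    by have [] : (V `&` M) a by rewrite VW.
  by have [] : (W `&` M) a by rewrite -VW.
rewrite -(card_lcoset (stabilizer_group g_act H W) h0); apply: eq_card => h.
rewrite mem_lcoset !inE groupMl ?groupV //; congr (_ && _).
apply/asboolP/asboolP => [hW|/(congr1 (fun U => g h0 @^-1` U))].
  by apply: (@place_act_inj _ _ g_act h0); rewrite (place_actM g_act) mulKVg hW h0W.
by rewrite (place_actM g_act) mulKVg h0W.
Qed.

Lemma card_stabilizer_act h W : h \in H -> place W -> #|stab (g h @^-1` W)| = #|stab W|.
Proof.
move=> hH Wp; have hWp := (place_actE h W).2 Wp.
rewrite -(card_orbit_fiber hWp Wp (act_restrict W hH)).
rewrite -[RHS](card_rcoset _ h^-1%g); apply: eq_card => t.
rewrite mem_rcoset invgK !inE groupMr //; congr (_ && _).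
by rewrite (place_actM g_act).
Qed.

Lemma pullback_add D D' : pullback (D - D') = pullback D - pullback D'.
Proof.
apply: funext => W; rewrite divisorBE /pullback divisorBE.
by case: asboolP => _; rewrite ?subr0 // mulrBl.
Qed.

Lemma pushforward_seq (s : seq (set E)) D : uniq s -> (forall V, V \notin s -> D V = 0) ->
  forall v, pushforward D v = \sum_(W <- s) (if W `&` M == v then D W else 0).
Proof.
move=> us Ds v; rewrite /pushforward (fsbig_uniq_seq us) // => V /Ds ->.
by rewrite if_same.
Qed.

Lemma pushforward_add D D' : is_divisor iota [set: E] D -> is_divisor iota [set: E] D' ->
  pushforward (D - D') = pushforward D - pushforward D'.
Proof.
move=> [/finite_support_seq[s us Ds] _] [/finite_support_seq[s' us' Ds'] _].
apply: funext => v; rewrite divisorBE.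
have Dss V : V \notin undup (s ++ s') -> D V = 0 /\ D' V = 0.
  by rewrite mem_undup mem_cat negb_or => /andP[/Ds-> /Ds'->].
rewrite !(pushforward_seq (undup_uniq (s ++ s'))) => [|V /Dss[]//|V /Dss[]//|V /Dss[Dv D'v]].
  rewrite -sumrB; apply: eq_bigr => W _; case: ifP => _; rewrite ?subr0 //.
by rewrite divisorBE Dv D'v subrr.
Qed.

(** H is transitive on the fibre through W, and the elements carrying W to a given place of it form
    a coset of the stabilizer. *)
Lemma sum_conjugates D W : is_divisor iota [set: E] D -> place W ->
  \sum_(h in H) D (g h @^-1` W) = pushforward D (W `&` M) * #|stab W|%:Z.
Proof.
move=> [/finite_support_seq[s us Ds] Dp] Wp; rewrite (pushforward_seq us Ds).
have DE V : D V = \sum_(U <- s) (if U == V then D U else 0).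
  have [Vs|/[dup] Vs /Ds ->] := boolP (V \in s).
    rewrite (bigD1_seq V) //= eqxx big1 ?addr0 // => U /negbTE -> //.
  by rewrite big_seq big1 // => U Us; case: eqP Us Vs => // -> ->.
under eq_bigr do rewrite DE.
rewrite exchange_big mulr_suml /=; apply: eq_bigr => V _.
rewrite -big_mkcondr /= sumr_const.
have [DV|DV] := eqVneq (D V) 0; first by rewrite DV mul0rn if_same mul0r.
have Vp := Dp V DV.
rewrite -[LHS]mulr_natr natz.
case: eqP => [VW|nVW].
  rewrite -(card_orbit_fiber Vp Wp VW); congr (_ * _%:Z); apply: eq_card => h.
  rewrite !inE -topredE /=; congr (_ && _).
  by apply/eqP/asboolP => ->.
rewrite (@eq_card0 _ _) ?mulr0 ?mul0r // => h; rewrite -topredE /=.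
apply/andP => -[hH /eqP VE]; apply: nVW; rewrite VE; exact: act_restrict.
Qed.

Lemma pushforward_divisor D : is_divisor iota [set: E] D -> is_divisor iota M (pushforward D).
Proof.
move=> [/finite_support_seq[s us Ds] Dp]; split=> [|v].
  apply: (@finite_support_of_seq _ [seq W `&` M | W <- s]) => v vs.
  rewrite (pushforward_seq us Ds) big_seq big1 // => W Ws; case: eqP => // e.
  by case/negP: vs; rewrite -e; apply: map_f.
rewrite (pushforward_seq us Ds) => nz.
have [[W [Ws <- DW]]|noW] := pselect (exists W, [/\ W \in s, W `&` M = v & D W != 0]).
  exact: (place_restrict has_order_ex g_act gC k24 H_cyclic (Dp W DW)).
case/negP: nz; apply/eqP; rewrite big_seq big1 // => W Ws; case: eqP => // e.
by apply/eqP; apply: contra_notT noW => DW; exists W.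
Qed.

Lemma degree_pushforward D : is_divisor iota [set: E] D -> degree (pushforward D) = degree D.
Proof.
move=> [/finite_support_seq[s us Ds] Dp]; rewrite /degree (fsbig_uniq_seq us Ds).
rewrite (fsbig_uniq_seq (undup_uniq [seq W `&` M | W <- s])); last first.
  move=> v; rewrite mem_undup (pushforward_seq us Ds) => vs.
  rewrite big_seq big1 // => W Ws; case: eqP => // e.
  by case/negP: vs; rewrite -e; apply: map_f.
under eq_bigr do rewrite (pushforward_seq us Ds).
rewrite exchange_big /= big_seq [RHS]big_seq; apply: eq_bigr => W Ws.
have mem_v : W `&` M \in undup [seq V `&` M | V <- s].
  by rewrite mem_undup; apply: (map_f (fun V => V `&` M)).
rewrite (bigD1_seq _ mem_v (undup_uniq _)) /= eqxx big1 ?addr0 // => v.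
by rewrite eq_sym => /negbTE ->.
Qed.

Lemma pullback_divisor D : is_divisor iota M D -> is_divisor iota [set: E] (pullback D).
Proof.
move=> [/finite_support_seq[s us Ds] Dp]; split=> [|W]; last first.
  by rewrite /pullback; case: asboolP => // _; rewrite eqxx.
have /choice[ext extP] v : exists W, is_place iota M v -> place W /\ W `&` M = v.
  have [vp|nvp] := pselect (is_place iota M v); last by exists set0.
  by have [W ?] := place_extend vp; exists W.
apply: (@finite_support_of_seq _ [seq g h @^-1` ext v | v <- s, h <- enum H]) => W.
rewrite /pullback; case: asboolP => // Wp Ws.
have [->|DW] := eqVneq (D (W `&` M)) 0; first by rewrite mul0r.
case/negP: Ws; have [Up UW] := extP _ (Dp _ DW).
have [|h hH hU] := place_transitive has_order_ex g_act gC (H := H) Up Wp.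
  move=> a aM; split=> [Ua|Wa].
    by have [] : (W `&` M) a by rewrite -UW.
  by have [] : (ext (W `&` M) `&` M) a by rewrite UW.
rewrite -{1}hU; apply/allpairsP; exists (W `&` M, h) => /=; split=> //.
  by apply: contraNT DW => /Ds ->.
by rewrite mem_enum.
Qed.

Lemma pushforward_pullback D : is_divisor iota M D ->
  pushforward (pullback D) = D *+ #|H|.
Proof.
move=> Ddiv; have pbdiv := pullback_divisor Ddiv; have [Dfin Dp] := Ddiv.
apply: funext => v; rewrite natmulfctE /=.
have [vp|nvp] := pselect (is_place iota M v); last first.
  have -> : D v = 0 by apply/eqP; apply: contra_notT nvp; apply: Dp.
  have [_ pfp] := pushforward_divisor pbdiv.
  by rewrite mul0rn; apply/eqP; apply: contra_notT nvp; apply: pfp.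
have [W [Wp <-]] := place_extend vp.
have e0 : #|stab W|%:Z != 0 by have := card_stabilizer_gt0 g_act H W; lia.
apply: (mulIf e0); rewrite -sum_conjugates // mulrnAl -sumr_const; apply: eq_bigr => h hH.
rewrite /pullback asboolT; last by apply/place_actE.
by rewrite act_restrict // card_stabilizer_act.
Qed.

Lemma degree_pullback D : is_divisor iota M D -> degree (pullback D) = degree D *+ #|H|.
Proof.
move=> Ddiv; rewrite -(degree_pushforward (pullback_divisor Ddiv)) pushforward_pullback //.
have [/finite_support_seq[s us Ds] _] := Ddiv.
rewrite /degree (fsbig_uniq_seq us Ds) (fsbig_uniq_seq us) => [|V /Ds DV].
  by rewrite -sumrMnl; apply: eq_bigr => V _; rewrite natmulfctE.
by rewrite natmulfctE /= DV mul0rn.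
Qed.

Lemma pullback_pushforward D : is_divisor iota [set: E] D ->
  pullback (pushforward D) = \sum_(h in H) frob_divisor (g h) D.
Proof.
move=> Ddiv; apply: funext => W; rewrite fct_sumE /pullback.
case: asboolP => Wp; first by rewrite -sum_conjugates.
rewrite big1 // => h _; rewrite /frob_divisor; apply/eqP; apply: contra_notT Wp => DhW.
by apply/(place_actE h); apply: Ddiv.2.
Qed.

Lemma pullback_principal D : is_principal iota M D ->
  exists f, f != 0 /\ forall W, place W -> ord W f = pullback D W.
Proof.
move=> /princE[f [_ f0 fD]]; exists f; split=> // W Wp.
by rewrite fD // /pullback asboolT.
Qed.

Lemma pushforward_principal D f : is_divisor iota [set: E] D -> f != 0 ->
  (forall W, place W -> ord W f = D W) -> is_principal iota M (pushforward D).
Proof.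
move=> Ddiv f0 fD; apply/princE; exists (group_norm g H f); split.
- exact: group_norm_fixed.
- exact: group_norm_neq0.
- move=> W Wp; rewrite (ord_group_norm has_order_ex g_act gC) // -sum_conjugates //.
  by apply: eq_bigr => h _; apply: fD; apply/place_actE.
Qed.

Section Frobenius.
Variable phi : {rmorphism E -> E}.
Hypothesis phi_surj : forall a, exists b, phi b = a.
Hypothesis phi_const : forall c, exists d, phi (iota c) = iota d.
Hypothesis phi_const_inv : forall c, exists d, phi (iota d) = iota c.
Hypothesis phi_comm : forall h a, g h (phi a) = phi (g h a).

Lemma place_preimageE W : place (phi @^-1` W) <-> place W.
Proof.
split; last exact: place_preimage.
move=> Wp; split=> //.
- by move=> _ [c _ <-]; have [d <-] := phi_const_inv c; exact: (place_const Wp d).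
- by move=> e; have [a] := place_proper Wp; case; rewrite e.
- move=> a b; have [a' <-] := phi_surj a; have [b' <-] := phi_surj b => Wa Wb.
  rewrite -rmorphB -rmorphM; exact: (placeBM Wp).
- move=> a _; have [a' <-] := phi_surj a; rewrite -fmorphV; exact: (place_total Wp).
Qed.

Lemma preimage_inj (W W' : set E) : phi @^-1` W = phi @^-1` W' -> W = W'.
Proof.
move=> e; apply/seteqP; split=> a; have [b <-] := phi_surj a => Wb.
  by have : (phi @^-1` W') b by rewrite -e.
by have : (phi @^-1` W) b by rewrite e.
Qed.

Lemma pullback_frobenius D : pullback (frob_divisor phi D) = frob_divisor phi (pullback D).
Proof.
apply: funext => W; rewrite /frob_divisor /pullback.
have -> : `[< place (phi @^-1` W) >] = `[< place W >] by apply/asbool_equiv_eq/place_preimageE.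
case: asboolP => // Wp.
have -> : phi @^-1` (W `&` M) = (phi @^-1` W) `&` M.
  apply/seteqP; split=> a [Wa aM]; split=> // h hH; last by rewrite phi_comm aM.
  by apply: (fmorph_inj phi); rewrite -phi_comm aM.
congr (_ * _%:Z); apply: eq_card => h; rewrite !inE; congr (_ && _).
have e : g h @^-1` (phi @^-1` W) = phi @^-1` (g h @^-1` W).
  by apply/seteqP; split=> a /=; rewrite phi_comm.
by apply/asboolP/asboolP => [hW|]; [rewrite e hW|rewrite e => /preimage_inj].
Qed.
End Frobenius.

End Divisors.

(** * Torsion classes and the norm to the projective line *)

Section RationalQuotient.
Variables (k : closedFieldType) (E : fieldType) (iota : {rmorphism k -> E}).
Local Notation place := (is_place iota [set: E]).
Variables (g : 'S_4 -> {rmorphism E -> E}) (H : {group 'S_4}) (tau : E).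
Hypothesis g_act : S4_action g.
Hypothesis gC : forall s c, g s (iota c) = iota c.
Hypothesis H_gen : forall (S : set E) a,
  is_subfield S -> range iota `<=` S -> S tau -> fixed_by g H a -> S a.
Hypothesis tau_const : forall c, tau != iota c.
Let has_order_ex := has_order_exists g_act H_gen.

(** The existence theorem is applied to k[tau] and the ideal of tau - c. This ideal is proper
    because tau, not being a constant, is transcendental over the algebraically closed field k. *)
Lemma zero_of_coordinate c : exists W, place W /\ in_max_ideal W (tau - iota c).
Proof.
pose A : set E := range (const_eval iota tau).
pose I : set E := [set (tau - iota c) * a | a in A].
have tc0 : tau - iota c != 0 by rewrite subr_eq0.
have A1 : A 1 by exists 1; rewrite ?rmorph1.
have ABM a b : A a -> A b -> A (a - b) /\ A (a * b).
  by move=> [p _ <-] [q _ <-]; split; [exists (p - q)|exists (p * q)]; rewrite ?rmorphB ?rmorphM.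
have Atc : A (tau - iota c).
  by exists ('X - c%:P); rewrite // rmorphB const_evalX const_evalC.
have IA : I `<=` A by move=> _ [a Aa <-]; apply: (ABM _ _ Atc Aa).2.
have Idir i j : I i -> I j -> exists m a b, [/\ I m, A a, A b, i = a * m & j = b * m].
  move=> [a Aa <-] [b Ab <-]; exists (tau - iota c), a, b.
  by split=> //; [exists 1; rewrite ?mulr1|rewrite mulrC|rewrite mulrC].
have Inonunit i : I i -> i != 0 -> ~ A i^-1.
  move=> [_ [p _ <-] <-] i0 [q _ qE].
  have eq1 : const_eval iota tau (('X - c%:P) * p * q) = 1.
    by rewrite !rmorphM rmorphB const_evalX const_evalC qE mulfV.
  pose P := ('X - c%:P) * p * q - 1.
  have P0 : P != 0.
    apply/eqP => /(congr1 (fun p => p.[c])); rewrite !hornerE subrr !mul0r sub0r => /eqP.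
    by rewrite oppr_eq0 oner_eq0.
  have [|d /eqP] := @closed_root_in_constants _ _ iota P tau P0; last by apply/negP.
  by rewrite rootE -[_.[tau]]/(const_eval iota tau P) rmorphB rmorph1 eq1 subrr.
have [W [AW WBM Wtot Wnonunit]] := valuation_ring_exists A1 ABM IA Idir Inonunit.
have nW : ~ W (tau - iota c)^-1 by apply: Wnonunit => //; exists 1; rewrite ?mulr1.
exists W; split; first split=> //.
- by move=> _ [d _ <-]; apply: AW; exists d%:P => //; rewrite const_evalC.
- by move=> e; apply: nW; rewrite e.
by split; [exact: AW|case].
Qed.

Lemma ord_coordinate_le W c : place W -> in_max_ideal W (tau - iota c) ->
  0 < ord W (tau - iota c) <= #|H|%:Z.
Proof.
move=> Wp mc; have tc0 : tau - iota c != 0 by rewrite subr_eq0.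
apply/andP; split; first exact/(ord_gt0 has_order_ex Wp).
have h_tau : rational_in iota (tau - iota c) tau.
  rewrite -{2}[tau](subrK (iota c)); apply: subfieldD; first exact: rational_in_subfield.
    exact: rational_in_gen.
  by apply: rational_in_const; exists c.
have [t tU] := uniformizer_ex has_order_ex Wp; have [t0 Wt nt _] := tU.
have := ramification_bound g_act H_gen Wp mc tc0 h_tau (conj Wt nt) t0.
rewrite leNgt; apply: contra_notN => lt.
apply/(ord_ge0 has_order_ex Wp); first by rewrite mulf_neq0 ?invr_eq0 ?expf_neq0.
rewrite (ordM has_order_ex Wp) ?invr_eq0 ?expf_neq0 // (ordV has_order_ex Wp) ?expf_neq0 //.
rewrite (ordX has_order_ex Wp) // (ord_uniformizer Wp tU); lia.
Qed.

Lemma ord_coordinate_eq0 W c d : place W -> in_max_ideal W (tau - iota c) -> d != c ->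
  ord W (tau - iota d) = 0.
Proof.
move=> Wp mc dc; apply: (ord_unit has_order_ex Wp).
have -> : tau - iota d = iota (c - d) + (tau - iota c) by rewrite rmorphB; ring.
by apply: (unitD Wp) => //; apply: (unit_const Wp); rewrite subr_eq0 eq_sym.
Qed.

Lemma sum_count (T : eqType) (s r : seq T) (F : T -> int) : uniq r -> {subset s <= r} ->
  \sum_(c <- s) F c = \sum_(c <- r) F c * (count_mem c s)%:Z.
Proof.
move=> ur; elim: s => [_|a s IHs sub] /=; first by rewrite big_nil big1 // => c _; rewrite mulr0.
rewrite big_cons IHs => [|c cs]; last by apply: sub; rewrite inE cs orbT.
have ar : a \in r by apply: sub; rewrite mem_head.
have -> : F a = \sum_(c <- r) F c * (a == c)%:Z.
  rewrite (bigD1_seq a) //= eqxx mulr1 big1 ?addr0 // => c.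
  by rewrite eq_sym => /negbTE ->; rewrite mulr0.
by rewrite -big_split /=; apply: eq_bigr => c _; rewrite -mulrDr PoszD.
Qed.

(* The quotient by H has genus 0, so the norm to it of a torsion class is
   trivial: if N D = div f, then the norm of f is, up to its C-th power and a
   constant, the N-th power of a function. *)
Lemma norm_torsion_principal (D : set E -> int) (N : nat) f : (0 < N)%N -> f != 0 ->
  (forall W, place W -> ord W f = D W * N%:Z) ->
  exists G, G != 0 /\ forall W, place W ->
    ord W G = (\sum_(h in H) D (g h @^-1` W)) * (factorial #|H|)%:Z.
Proof.
move=> N0 f0 fD; set C := (factorial #|H|).
have [al [be [be0 FE]]] : rational_in iota tau (group_norm g H f).
  apply: H_gen; [exact: rational_in_subfield|exact: rational_in_const|exact: rational_in_gen|].
  exact: group_norm_fixed.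
have F0 : group_norm g H f != 0 by exact: group_norm_neq0.
have al0 : const_eval iota tau al != 0.
  by apply: contraNneq F0 => z; rewrite FE z mul0r.
have tc0 c : tau - iota c != 0 by rewrite subr_eq0.
have roots (p : {poly k}) : const_eval iota tau p != 0 -> exists s : seq k,
    forall W, place W -> ord W (const_eval iota tau p) = \sum_(c <- s) ord W (tau - iota c).
  move=> p0; have [s pE] := closed_field_poly_normal p; exists s => W Wp.
  have l0 : iota (lead_coef p) != 0.
    by rewrite fmorph_eq0 lead_coef_eq0; apply: contraNneq p0 => ->; rewrite rmorph0.
  have -> : const_eval iota tau p = iota (lead_coef p) * \prod_(c <- s) (tau - iota c).
    rewrite {1}pE -mul_polyC rmorphM const_evalC rmorph_prod; congr (_ * _).
    by apply: eq_bigr => c _; rewrite rmorphB const_evalX const_evalC.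
  have prod0 : \prod_(c <- s) (tau - iota c) != 0.
    by rewrite prodf_seq_neq0; apply/allP => c _; exact: tc0.
  rewrite (ordM has_order_ex Wp) // (ord_const has_order_ex Wp) ?add0r.
    by rewrite (ord_prod has_order_ex Wp).
  by rewrite -(fmorph_eq0 iota).
have [A ordA] := roots _ al0; have [B ordB] := roots _ be0.
pose cs := undup (A ++ B); have ucs : uniq cs by exact: undup_uniq.
have Acs : {subset A <= cs} by move=> c cA; rewrite mem_undup mem_cat cA.
have Bcs : {subset B <= cs} by move=> c cB; rewrite mem_undup mem_cat cB orbT.
pose m c : int := (count_mem c A)%:Z - (count_mem c B)%:Z.
pose S W := \sum_(h in H) D (g h @^-1` W).
have ordF W : place W -> S W * N%:Z = \sum_(c <- cs) ord W (tau - iota c) * m c.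
  move=> Wp; have := ord_group_norm has_order_ex g_act gC H Wp f0.
  rewrite (eq_bigr (fun h => D (g h @^-1` W) * N%:Z)) => [|h _]; last first.
    by apply: fD; exact: (place_act g_act gC).
  rewrite -mulr_suml => <-; rewrite FE (ordM has_order_ex Wp) ?invr_eq0 //.
  rewrite (ordV has_order_ex Wp) // ordA // ordB //.
  rewrite (sum_count _ ucs Acs) (sum_count _ ucs Bcs) -sumrB.
  by apply: eq_bigr => c _; rewrite -mulrBr.
(* At a place above tau = c only the factor tau - c has nonzero order e, so e m_c is a multiple of
   N. As e is at most |H|, it divides |H|!, which gives a factor that works for all places. *)
have dvd_m c : c \in cs -> (N%:Z %| m c * C%:Z)%Z.
  move=> ccs; have [W [Wp mc]] := zero_of_coordinate c.
  have /andP[e0 eH] := ord_coordinate_le Wp mc; have := ordF W Wp.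
  rewrite (bigD1_seq c) //= big1 ?addr0 => [e|d dc]; last first.
    by rewrite (ord_coordinate_eq0 Wp mc dc) mul0r.
  have /dvdzP[q Cq] : (ord W (tau - iota c) %| C%:Z)%Z.
    move: e0 eH; case: (ord W _) => // n n0 nH.
    by rewrite dvdzE /= dvdn_fact //; lia.
  by apply/dvdzP; exists (S W * q); rewrite Cq mulrCA mulrC -mulrA [m c * _]mulrC -e; ring.
pose q c := ((m c * C%:Z) %/ N%:Z)%Z.
have qE c : c \in cs -> q c * N%:Z = m c * C%:Z by move=> /dvd_m; exact: divzK.
exists (\prod_(c <- cs) (tau - iota c) ^ q c); split.
  by rewrite prodf_seq_neq0; apply/allP => c _; rewrite expfz_neq0.
move=> W Wp; rewrite (ord_prod has_order_ex Wp) => [|c _]; last by rewrite expfz_neq0.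
have N0' : N%:Z != 0 by lia.
apply: (mulIf N0'); rewrite mulrAC ordF // !mulr_suml big_seq [RHS]big_seq.
apply: eq_bigr => c ccs; rewrite (ordXz has_order_ex Wp) // -!mulrA; congr (_ * _).
exact: qE.
Qed.
End RationalQuotient.

(** * Matrices of operators on Tate modules *)

Section Ladic.
Variable l : nat.

Lemma ladic_const a : is_ladic l (fun=> a). Proof. by []. Qed.

Lemma ladicM a b : is_ladic l a -> is_ladic l b -> is_ladic l (fun n => a n * b n).
Proof. by move=> al bl n; rewrite -modzMm al bl modzMm. Qed.

Lemma ladicB a b : is_ladic l a -> is_ladic l b -> is_ladic l (fun n => a n - b n).
Proof.
move=> al bl n; apply/eqP; rewrite eqz_mod_dvd.
have -> : a n.+1 - b n.+1 - (a n - b n) = (a n.+1 - a n) - (b n.+1 - b n) by ring.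
by rewrite rpredB // -eqz_mod_dvd; apply/eqP.
Qed.

Lemma ladic_sum (I : Type) (r : seq I) (P : pred I) (F : I -> nat -> int) :
  (forall i, P i -> is_ladic l (F i)) -> is_ladic l (fun n => \sum_(i <- r | P i) F i n).
Proof.
move=> Fl n; elim: r => [|i r IHr]; first by rewrite !big_nil.
by rewrite !big_cons; case: ifP => // Pi; rewrite -modzDm (Fl i Pi) IHr modzDm.
Qed.
End Ladic.

Section LinearEquivalence.
Variables (k E : fieldType) (iota : {rmorphism k -> E}) (M : set E).

(** For a general set M this is a condition; for the fixed fields it follows from the existence of
    orders. *)
Definition principal_subgroup := is_principal iota M 0 /\
  forall D D', is_principal iota M D -> is_principal iota M D' -> is_principal iota M (D - D').

Hypothesis M_sub : principal_subgroup.
Local Notation P := (is_principal iota M).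
Local Notation equiv := (lin_equiv iota M).

Lemma principal0 : P 0. Proof. by case: M_sub. Qed.
Lemma principalB D D' : P D -> P D' -> P (D - D'). Proof. by case: M_sub => _; apply. Qed.
Lemma principalN D : P D -> P (- D).
Proof. by rewrite -sub0r; apply: principalB; exact: principal0. Qed.
Lemma principalD D D' : P D -> P D' -> P (D + D').
Proof. by move=> PD PD'; rewrite -[D']opprK; apply: principalB => //; exact: principalN. Qed.
Lemma principalMz D (a : int) : P D -> P (D *~ a).
Proof.
move=> PD; have PDn n : P (D *+ n).
  elim: n => [|n IHn]; first by rewrite mulr0n; exact: principal0.
  by rewrite mulrS; exact: principalD.
by case: a => n; [exact: PDn|rewrite NegzE mulrNz; apply: principalN; exact: PDn].
Qed.
Lemma principal_sum I (r : seq I) (Q : pred I) F : (forall i, Q i -> P (F i)) ->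
  P (\sum_(i <- r | Q i) F i).
Proof. by move=> PF; apply: big_ind => //; [exact: principal0|exact: principalD]. Qed.

Lemma linear_equiv_refl D : equiv D D. Proof. by rewrite /lin_equiv subrr; exact: principal0. Qed.
Lemma linear_equiv_sym D D' : equiv D D' -> equiv D' D.
Proof. by rewrite /lin_equiv -[D' - D]opprB; exact: principalN. Qed.
Lemma linear_equiv_trans D D' D'' : equiv D D' -> equiv D' D'' -> equiv D D''.
Proof. by rewrite /lin_equiv => /principalD DD /DD; rewrite addrA subrK. Qed.
Lemma linear_equiv_sum I (r : seq I) (Q : pred I) F G : (forall i, Q i -> equiv (F i) (G i)) ->
  equiv (\sum_(i <- r | Q i) F i) (\sum_(i <- r | Q i) G i).
Proof. by move=> FG; rewrite /lin_equiv -sumrB; exact: principal_sum. Qed.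
Lemma linear_equivMz D D' (a : int) : equiv D D' -> equiv (D *~ a) (D' *~ a).
Proof. by move=> DD; rewrite /lin_equiv -mulrzBl; exact: principalMz. Qed.
Lemma linear_equivMn D D' n : equiv D D' -> equiv (D *+ n) (D' *+ n).
Proof. exact: (@linear_equivMz D D' n). Qed.

Lemma tate_torsion l D n : in_tate_module iota M l D -> P (D n *+ (l ^ n)).
Proof.
move=> [_ D0 DS]; suff : equiv (D n *+ (l ^ n)) 0 by rewrite /lin_equiv subr0.
elim: n => [|n IHn]; first by rewrite expn0.
by apply: linear_equiv_trans IHn; rewrite expnS mulrnA; apply: linear_equivMn.
Qed.
End LinearEquivalence.

Section Operators.
Variables (k E : fieldType) (iota : {rmorphism k -> E}).
Local Notation div := (set E -> int).

(** C is the domain on which [Op] is known to be additive: the divisors for the pushforward, whose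
    sums need finite support, and all functions for the pullback and for automorphisms. *)
Record class_operator (M M' : set E) (C : div -> Prop) (Op : div -> div) : Prop := {
  class0 : C 0;
  classB : forall D D', C D -> C D' -> C (D - D');
  operatorB : forall D D', C D -> C D' -> Op (D - D') = Op D - Op D';
  operator_principal : forall D, C D -> is_principal iota M D -> is_principal iota M' (Op D) }.

Section OneOperator.
Variables (M M' : set E) (C : div -> Prop) (Op : div -> div).
Hypothesis Op_class : class_operator M M' C Op.

Lemma classN D : C D -> C (- D).
Proof. by move=> CD; rewrite -sub0r; apply: (classB Op_class) => //; exact: (class0 Op_class). Qed.
Lemma classD D D' : C D -> C D' -> C (D + D').
Proof. by move=> CD CD'; rewrite -[D']opprK; apply: (classB Op_class) => //; exact: classN. Qed.
Lemma class_sum I (r : seq I) (Q : pred I) F :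
  (forall i, Q i -> C (F i)) -> C (\sum_(i <- r | Q i) F i).
Proof. by move=> CF; apply: big_ind => //; [exact: (class0 Op_class)|exact: classD]. Qed.
Lemma classMn D n : C D -> C (D *+ n).
Proof.
move=> CD; elim: n => [|n IHn]; first by rewrite mulr0n; exact: (class0 Op_class).
by rewrite mulrS; exact: classD.
Qed.
Lemma classMz D (a : int) : C D -> C (D *~ a).
Proof. by move=> CD; case: a => n; [|rewrite NegzE mulrNz; apply: classN]; exact: classMn. Qed.

Lemma operator0 : Op 0 = 0.
Proof. by rewrite -(subrr 0) (operatorB Op_class) ?subrr //; exact: (class0 Op_class). Qed.
Lemma operatorN D : C D -> Op (- D) = - Op D.
Proof.
by move=> CD; rewrite -sub0r (operatorB Op_class) // ?operator0 ?sub0r //; exact: (class0 Op_class).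
Qed.
Lemma operatorD D D' : C D -> C D' -> Op (D + D') = Op D + Op D'.
Proof.
move=> CD CD'; rewrite -{1}[D']opprK (operatorB Op_class) //; last exact: classN.
by rewrite operatorN // opprK.
Qed.
Lemma operatorMn D n : C D -> Op (D *+ n) = Op D *+ n.
Proof.
move=> CD; elim: n => [|n IHn]; first by rewrite !mulr0n operator0.
by rewrite !mulrS operatorD // ?IHn //; exact: classMn.
Qed.
Lemma operatorMz D (a : int) : C D -> Op (D *~ a) = Op D *~ a.
Proof.
move=> CD; case: a => n; first exact: operatorMn.
by rewrite NegzE !mulrNz operatorN; [congr (- _); exact: operatorMn|exact: classMn].
Qed.
Lemma operator_sum I (r : seq I) F : (forall i, C (F i)) ->
  Op (\sum_(i <- r) F i) = \sum_(i <- r) Op (F i).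
Proof.
move=> CF; elim: r => [|i r IHr]; first by rewrite !big_nil operator0.
by rewrite !big_cons operatorD // ?IHr //; exact: class_sum.
Qed.

Lemma operator_equiv D D' :
  C D -> C D' -> lin_equiv iota M D D' -> lin_equiv iota M' (Op D) (Op D').
Proof.
move=> CD CD'; rewrite /lin_equiv -(operatorB Op_class) //.
by apply: (operator_principal Op_class); exact: (classB Op_class).
Qed.

Lemma operator_tate l D :
  (forall D, is_divisor iota M D -> C D) ->
  (forall D, is_divisor iota M D -> degree D = 0 ->
     is_divisor iota M' (Op D) /\ degree (Op D) = 0) ->
  in_tate_module iota M l D -> in_tate_module iota M' l (fun n => Op (D n)).
Proof.
move=> divC Opdiv [Ddiv D0 DS]; have CD n : C (D n) by apply: divC; case: (Ddiv n).
split=> [n||n].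
- by have [? ?] := Ddiv n; exact: Opdiv.
- by rewrite -operator0; apply: operator_equiv => //; exact: (class0 Op_class).
- by rewrite -operatorMn //; apply: operator_equiv => //; exact: classMn.
Qed.
End OneOperator.

(* The rows of N n are the coordinates modulo l^n of the images under Op of the
   basis e. *)
Definition represents (M' : set E) (l r r' : nat) (e : 'I_r -> nat -> div)
    (e' : 'I_r' -> nat -> div) (Op : div -> div) (N : nat -> 'M[int]_(r, r')) :=
  (forall i j, is_ladic l (fun n => N n i j)) /\
  (forall i n, lin_equiv iota M' (Op (e i n)) (\sum_j e' j n *~ N n i j)).

Lemma represents_exists M' l r r' (e : 'I_r -> nat -> div) (e' : 'I_r' -> nat -> div) Op :
  is_tate_basis iota M' l e' -> (forall i, in_tate_module iota M' l (fun n => Op (e i n))) ->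
  exists N, represents M' l e e' Op N.
Proof.
move=> [_ gen _] Op_e.
have /choice[a aP] i : exists a : 'I_r' -> nat -> int, (forall j, is_ladic l (a j)) /\
    forall n, lin_equiv iota M' (Op (e i n)) (\sum_j e' j n *~ a j n).
  by have [a al aE] := gen _ (Op_e i); exists a.
exists (fun n => \matrix_(i, j) a i j n); split=> [i j n|i n].
  by rewrite !mxE; have [al _] := aP i; exact: al.
by under eq_bigr do rewrite mxE; have [_ aE] := aP i; exact: aE.
Qed.

Lemma represents_uniq M' l r r' (e : 'I_r -> nat -> div) (e' : 'I_r' -> nat -> div) Op Op' N N' :
  principal_subgroup iota M' -> is_tate_basis iota M' l e' ->
  represents M' l e e' Op N -> represents M' l e e' Op' N' ->
  (forall i n, lin_equiv iota M' (Op (e i n)) (Op' (e i n))) ->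
  forall n i j, ((l ^ n)%N%:Z %| N n i j - N' n i j)%Z.
Proof.
move=> sub' [_ _ indep] [Nl NE] [N'l N'E] OpE n i j.
rewrite -[_ - _]subr0 -eqz_mod_dvd; apply/eqP.
apply: (indep (fun j n => N n i j - N' n i j)) => [j'|n']; first exact: ladicB.
have -> : \sum_j e' j n' *~ (N n' i j - N' n' i j) =
    \sum_j e' j n' *~ N n' i j - \sum_j e' j n' *~ N' n' i j.
  by rewrite -sumrB; apply: eq_bigr => j' _; rewrite mulrzBr.
rewrite /lin_equiv subr0 -/(lin_equiv iota M' _ _).
apply: (linear_equiv_trans sub' (linear_equiv_sym sub' (NE i n'))).
exact: (linear_equiv_trans sub' (OpE i n') (N'E i n')).
Qed.

(** Images are stored in rows, so the matrix of the operator applied first stands on the left. *)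
Lemma represents_comp M M' C l r r' r'' (e : 'I_r -> nat -> div) (e' : 'I_r' -> nat -> div)
    (e'' : 'I_r'' -> nat -> div) Op1 Op2 N1 N2 :
  principal_subgroup iota M' ->
  class_operator M M' C Op2 -> (forall i n, C (Op1 (e i n))) -> (forall i n, C (e' i n)) ->
  represents M l e e' Op1 N1 -> represents M' l e' e'' Op2 N2 ->
  represents M' l e e'' (Op2 \o Op1) (fun n => N1 n *m N2 n).
Proof.
move=> sub' Op2C CO Ce' [N1l N1E] [N2l N2E]; split=> [i j|i n].
  have := @ladic_sum l _ (index_enum _) xpredT (fun j' n => N1 n i j' * N2 n j' j)
    (fun j' _ => ladicM (N1l i j') (N2l j' j)).
  by move=> h n; have := h n; rewrite !mxE.
have CM j (a : int) : C (e' j n *~ a) by apply: (classMz Op2C).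
apply: (linear_equiv_trans sub' (operator_equiv Op2C (CO i n) _ (N1E i n))).
  by apply: (class_sum Op2C).
rewrite (operator_sum Op2C) //.
have -> : \sum_j e'' j n *~ (N1 n *m N2 n) i j =
    \sum_j (\sum_j' e'' j' n *~ N2 n j j') *~ N1 n i j.
  under [RHS]eq_bigr do rewrite mulrz_suml.
  rewrite exchange_big /=; apply: eq_bigr => j _; rewrite mxE mulrz_sumr.
  by apply: eq_bigr => j' _; rewrite -mulrzA mulrC.
apply: (linear_equiv_sum sub') => j _; rewrite (operatorMz Op2C) //.
exact: (linear_equivMz sub').
Qed.

Lemma represents_sum (I : finType) (A : {set I}) M' l r r' (e : 'I_r -> nat -> div)
    (e' : 'I_r' -> nat -> div) (Op : I -> div -> div) (N : I -> nat -> 'M[int]_(r, r')) :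
  principal_subgroup iota M' -> (forall h, h \in A -> represents M' l e e' (Op h) (N h)) ->
  represents M' l e e' (fun D => \sum_(h in A) Op h D) (fun n => \sum_(h in A) N h n).
Proof.
move=> sub' rep; split=> [i j|i n].
  have := @ladic_sum l _ (index_enum I) (mem A) (fun h n => N h n i j)
    (fun h hA => (rep h hA).1 i j).
  by move=> H n; have := H n; rewrite !summxE.
have -> : \sum_j e' j n *~ (\sum_(h in A) N h n) i j =
    \sum_(h in A) \sum_j e' j n *~ N h n i j.
  by rewrite exchange_big; apply: eq_bigr => j _; rewrite summxE mulrz_sumr.
by apply: (linear_equiv_sum sub') => h hA; case: (rep h hA).
Qed.

Lemma representsMn M' l r r' (e : 'I_r -> nat -> div) (e' : 'I_r' -> nat -> div) Op N c :
  principal_subgroup iota M' -> represents M' l e e' Op N ->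
  represents M' l e e' (fun D => Op D *+ c) (fun n => N n *+ c).
Proof.
have mxE' n i j : (N n *+ c) i j = N n i j * c%:Z by rewrite mulmxnE -[LHS]mulr_natr natz.
move=> sub' [Nl NE]; split=> [i j n|i n].
  by rewrite !mxE'; exact: ladicM (Nl i j) (@ladic_const l c%:Z) n.
have -> : \sum_j e' j n *~ (N n *+ c) i j = (\sum_j e' j n *~ N n i j) *+ c.
  by rewrite -sumrMnl; apply: eq_bigr => j _; rewrite mxE' mulrzA.
exact: (linear_equivMn sub').
Qed.

Lemma represents_id M' l r (e : 'I_r -> nat -> div) :
  principal_subgroup iota M' -> represents M' l e e id (fun=> 1%:M).
Proof.
move=> sub'; split=> [i j|i n]; first exact: ladic_const.
rewrite (bigD1 i) //= big1 => [|j /negbTE ji]; last by rewrite mxE eq_sym ji mulr0z.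
by rewrite addr0 mxE eqxx mulr1z; exact: (linear_equiv_refl sub').
Qed.

Lemma represents0 M' l r r' (e : 'I_r -> nat -> div) (e' : 'I_r' -> nat -> div) Op :
  (forall i n, is_principal iota M' (Op (e i n))) -> represents M' l e e' Op (fun=> 0).
Proof.
move=> OpP; split=> [i j|i n]; first exact: ladic_const.
by rewrite big1 => [|j _]; [rewrite /lin_equiv subr0|rewrite mxE mulr0z].
Qed.

End Operators.

Lemma intr_Zp_eq0 (m : nat) (a : int) : (1 < m)%N -> (a%:~R == 0 :> 'Z_m) = (m%:Z %| a)%Z.
Proof.
move=> m1; have natE n : (n%:R == 0 :> 'Z_m) = (m %| n)%N.
  by rewrite -val_eqE /= val_Zp_nat.
case: a => n; first by rewrite -pmulrn natE.
by rewrite NegzE mulrNz oppr_eq0 -pmulrn natE dvdzE abszN.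
Qed.

(** * Reciprocal polynomials and traces *)

(** With d fixed, reversal is additive, unlike [reciprocal_poly], which depends on the degree of its
    argument; multiplicativity can thus be checked on monomials. *)
Definition reverse_upto (d : nat) (f : {poly int}) : {poly int} :=
  \sum_(i < d.+1) f`_i *: 'X^(d - i).

Lemma reverse_upto_sum d I (r : seq I) (F : I -> {poly int}) :
  reverse_upto d (\sum_(i <- r) F i) = \sum_(i <- r) reverse_upto d (F i).
Proof.
rewrite /reverse_upto exchange_big /=; apply: eq_bigr => i _.
by rewrite coef_sum scaler_suml.
Qed.

Lemma reverse_upto_monomial d c e : (e <= d)%N ->
  reverse_upto d (c *: 'X^e) = c *: 'X^(d - e).
Proof.
move=> le_ed; rewrite /reverse_upto (bigD1 (Ordinal (le_ed : (e < d.+1)%N))) //= big1 => [|i ie].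
  by rewrite coefZ coefXn eqxx mulr1 addr0.
by rewrite coefZ coefXn; move: ie; rewrite -val_eqE /= => /negbTE ->; rewrite mulr0 scale0r.
Qed.

Lemma reciprocal_polyE (f : {poly int}) d : size f = d.+1 -> reciprocal_poly f = reverse_upto d f.
Proof.
move=> sf; rewrite /reciprocal_poly sf /= poly_def /reverse_upto (reindex_inj rev_ord_inj) /=.
apply: eq_bigr => i _; rewrite subSS; congr (_ *: _); congr (f`_ _).
by rewrite subKn // -ltnS.
Qed.

Lemma reciprocal_polyM (f h : {poly int}) : f \is monic -> h \is monic ->
  reciprocal_poly (f * h) = reciprocal_poly f * reciprocal_poly h.
Proof.
move=> fm hm; have [a sf] : exists a, size f = a.+1.
  by exists (size f).-1; rewrite prednK // size_poly_gt0 monic_neq0.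
have [b sh] : exists b, size h = b.+1.
  by exists (size h).-1; rewrite prednK // size_poly_gt0 monic_neq0.
have sfh : size (f * h) = (a + b).+1 by rewrite size_monicM ?monic_neq0 // sf sh addnS.
rewrite (reciprocal_polyE sf) (reciprocal_polyE sh) (reciprocal_polyE sfh).
have polyE (q : {poly int}) d : size q = d.+1 -> q = \sum_(i < d.+1) q`_i *: 'X^i.
  by move=> sq; rewrite -poly_def -sq coefK.
rewrite {1}(polyE f a sf) mulr_suml reverse_upto_sum /reverse_upto mulr_suml.
apply: eq_bigr => i _; rewrite -/(reverse_upto _ _) {1}(polyE h b sh) mulr_sumr reverse_upto_sum.
rewrite mulr_sumr; apply: eq_bigr => j _.
rewrite -!scalerAl -!scalerAr !scalerA -!exprD.
have [li lj] := (ltn_ord i, ltn_ord j); rewrite reverse_upto_monomial; last by lia.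
by congr (_ *: 'X^_); lia.
Qed.

Section Traces.
Variable R : comNzRingType.

(** By cyclicity tr(A^m Q P) = tr(P A^m Q) = tr(A'^m P Q). *)
Lemma trace_quotient r r' (A : 'M[R]_r) (A' : 'M[R]_r')
    (P : 'M[R]_(r', r)) (Q : 'M[R]_(r, r')) c m :
  P *m Q = c%:M -> A' *m P = P *m A ->
  c * \tr (A' ^+ m) = \tr (A ^+ m *m (Q *m P)).
Proof.
move=> PQ AP; have AmP : A' ^+ m *m P = P *m A ^+ m.
  elim: m => [|m IHm]; first by rewrite !expr0 mul1mx mulmx1.
  by rewrite exprS -[A' * _]/(A' *m _) -mulmxA IHm mulmxA AP -mulmxA -[A *m _]/(A * _) -exprS.
by rewrite mulmxA mxtrace_mulC mulmxA -AmP -mulmxA PQ mul_mx_scalar mxtraceZ.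
Qed.

Lemma S4_traces r (A : 'M[R]_r) (S : 'S_4 -> 'M[R]_r) (c : R) m :
  (forall h, S h *m A = A *m S h) -> (forall t h, S (t * h)%g = S t *m S h) ->
  S 1%g = 1%:M -> c *: \sum_(h in klein) S h = 0 ->
  c * (24%:R * \tr (A ^+ m)) =
  c * (12%:R * \tr (A ^+ m *m \sum_(h in <[cycle12]>%g) S h)
       + 8%:R * \tr (A ^+ m *m \sum_(h in <[cycle123]>%g) S h)
       + 6%:R * \tr (A ^+ m *m \sum_(h in <[cycle1234]>%g) S h)).
Proof.
move=> SA SM S1 Sklein; pose chi h := \tr (A ^+ m *m S h).
have SAm h : S h *m A ^+ m = A ^+ m *m S h.
  elim: m {chi} => [|i IHi]; first by rewrite !expr0 mul1mx mulmx1.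
  by rewrite exprS -[A * _]/(A *m _) mulmxA SA -mulmxA IHi mulmxA.
have sumE (B : {set 'S_4}) : \tr (A ^+ m *m \sum_(h in B) S h) = \sum_(h in B) chi h.
  by rewrite mulmx_sumr raddf_sum.
rewrite !sumE; have -> : \tr (A ^+ m) = chi 1%g by rewrite /chi S1 mulmx1.
apply: class_fun_relation => [t h|h].
  by rewrite /chi !SM [in LHS]mulmxA -SAm -[in LHS]mulmxA mxtrace_mulC -[in LHS]mulmxA.
have -> : chi h + chi (cycle12 * h)%g + chi (cycle34 * h)%g + chi (cycle12 * cycle34 * h)%g =
    \tr (A ^+ m *m ((\sum_(t in klein) S t) *m S h)).
  by rewrite big_klein !mulmxDl !mulmxDr !mxtraceD /chi -!SM !mul1g.
by rewrite -mxtraceZ scalemxAr scalemxAl Sklein mul0mx mulmx0 mxtrace0.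
Qed.
End Traces.

(** * Traces of Frobenius on quotients *)

Lemma degree_frob_divisor (E : fieldType) (phi : {rmorphism E -> E}) (D : set E -> int) :
  (forall a, exists b, phi b = a) -> finite_set [set V | D V != 0] ->
  degree (frob_divisor phi D) = degree D.
Proof.
move=> surj /finite_support_seq[s us Ds].
have imageK V : phi @^-1` (phi @` V) = V.
  by apply/seteqP; split=> [a [b Vb /fmorph_inj <-]//|a Va]; exists a.
have preimageK V : phi @` (phi @^-1` V) = V.
  apply/seteqP; split=> [_ [a Va <-]//|a Va].
  by have [b ba] := surj a; exists b => //; rewrite /= ba.
have u_image : uniq [seq phi @` V | V <- s].
  by rewrite map_inj_uniq // => V V' e; rewrite -[V]imageK e imageK.
rewrite /degree (fsbig_uniq_seq us Ds) (fsbig_uniq_seq u_image) => [|V Vs].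
  by rewrite big_map; apply: eq_bigr => V _; rewrite /frob_divisor imageK.
apply: Ds; apply: contraNN Vs => Vs; apply/mapP; by exists (phi @^-1` V).
Qed.

(** Operators agreeing on the basis have equal matrices only modulo l^n at level n. The bound on l^n
    is there because ['Z_1] is by convention the ring with two elements. *)
Lemma represents_red (k E : fieldType) (iota : {rmorphism k -> E}) M' l r r'
    (e : 'I_r -> nat -> set E -> int) (e' : 'I_r' -> nat -> set E -> int) Op Op' N N' n :
  principal_subgroup iota M' -> is_tate_basis iota M' l e' ->
  represents iota M' l e e' Op N -> represents iota M' l e e' Op' N' ->
  (forall i n, Op (e i n) = Op' (e i n)) -> (1 < l ^ n)%N ->
  map_mx (intr : int -> 'Z_(l ^ n)) (N n) = map_mx intr (N' n).
Proof.
move=> sub' basis rep rep' OpE ln1; apply/matrixP => i j; rewrite !mxE.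
apply/eqP; rewrite -subr_eq0 -rmorphB /= (intr_Zp_eq0 _ ln1).
apply: (represents_uniq sub' basis rep rep') => i' n'; rewrite OpE; exact: (linear_equiv_refl sub').
Qed.

Section Assembly.
Variables (k E : fieldType) (iota : {rmorphism k -> E}).
Local Notation place := (is_place iota [set: E]).
Hypothesis has_order_ex : forall W, place W -> forall a, a != 0 -> exists n, has_order W a n.
Hypothesis residue_ex : forall W, place W -> forall a, W a -> exists c, in_max_ideal W (a - iota c).
Variable g : 'S_4 -> {rmorphism E -> E}.
Hypothesis g_act : S4_action g.
Hypothesis gC : forall s c, g s (iota c) = iota c.
Hypothesis g_faithful : forall s, (forall a, g s a = a) -> s = 1%g.
Hypothesis k24 : 24%:R != 0 :> k.

(** C is treated as its quotient by the trivial group, so that the results on fixed fields apply to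
    it. *)
Lemma fixed_by_cycle1 : fixed_by g <[1]>%G = [set: E].
Proof. by rewrite (fixed_by_cycle g_act); apply/seteqP; split=> a //= _; rewrite g_act.1. Qed.

Lemma principalTE D : is_principal iota [set: E] D <->
  exists f, f != 0 /\ forall W, place W -> ord W f = D W.
Proof.
have princE := is_principalE has_order_ex residue_ex g_act gC g_faithful k24 (cycle_cyclic 1%g).
have stab1 W : #|stabilizer g <[1]>%G W| = 1%N.
  apply/eqP; rewrite eqn_leq (card_stabilizer_gt0 g_act) andbT.
  apply: leq_trans (subset_leq_card (stabilizer_sub g _ W)) _.
  by rewrite -[#|_|]/(#[1]%g) order1.
rewrite -fixed_by_cycle1 princE fixed_by_cycle1; split=> -[f].
  by move=> [_ f0 fD]; exists f; split=> // W Wp; rewrite fD // stab1 mulr1 setIT.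
by move=> [f0 fD]; exists f; split=> // W Wp; rewrite fD // stab1 mulr1 setIT.
Qed.

Lemma principal_subgroup_fixed (H : {group 'S_4}) : cyclic H ->
  principal_subgroup iota (fixed_by g H).
Proof.
move=> cH; split.
  have := lin_equiv_refl has_order_ex residue_ex g_act gC g_faithful k24 cH 0.
  by rewrite /lin_equiv subr0.
by move=> D D'; exact: (is_principalB has_order_ex residue_ex g_act gC g_faithful k24 cH).
Qed.

Lemma principal_subgroupT : principal_subgroup iota [set: E].
Proof. by rewrite -fixed_by_cycle1; apply: principal_subgroup_fixed; exact: cycle_cyclic. Qed.

Lemma pullback_operator (H : {group 'S_4}) : cyclic H ->
  class_operator iota (fixed_by g H) [set: E] (fun=> True) (pullback iota g H).
Proof.
move=> cH; split=> // [D D' _ _|D _ PD]; first exact: pullback_add.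
apply/principalTE.
exact: (pullback_principal has_order_ex residue_ex g_act gC g_faithful k24 cH PD).
Qed.

Lemma divisorB D D' : is_divisor iota [set: E] D -> is_divisor iota [set: E] D' ->
  is_divisor iota [set: E] (D - D').
Proof.
move=> [/finite_support_seq[s us Ds] Dp] [/finite_support_seq[s' us' Ds'] D'p]; split.
  apply: (@finite_support_of_seq _ (s ++ s')) => V; rewrite mem_cat negb_or => /andP[Vs Vs'].
  by rewrite divisorBE Ds // Ds' // subrr.
move=> V; have [D0|D0 _] := eqVneq (D V) 0; last exact: Dp.
by rewrite divisorBE D0 sub0r oppr_eq0; exact: D'p.
Qed.

Lemma divisor0 : is_divisor iota [set: E] 0.
Proof.
split=> [|V]; last by rewrite eqxx.
by apply: (@finite_support_of_seq _ [::]).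
Qed.

Lemma pushforward_operator (H : {group 'S_4}) : cyclic H ->
  class_operator iota [set: E] (fixed_by g H) (is_divisor iota [set: E]) (pushforward g H).
Proof.
move=> cH; split=> [|D D'|D D' dD dD'|D dD /principalTE[f [f0 fD]]].
- exact: divisor0.
- exact: divisorB.
- exact: (pushforward_add (iota := iota)).
- exact: (pushforward_principal has_order_ex residue_ex g_act gC g_faithful k24 cH dD f0 fD).
Qed.

Lemma frob_operator (phi : {rmorphism E -> E}) :
  (forall a, exists b, phi b = a) -> (forall c, exists d, phi (iota c) = iota d) ->
  class_operator iota [set: E] [set: E] (fun=> True) (frob_divisor phi).
Proof.
move=> surj const; split=> // D _ /principalTE[f [f0 fD]]; apply/principalTE.
(* The order of f at the preimage of W is the order of phi(f) at W. *)
exists (phi f); split=> [|W Wp]; first by rewrite fmorph_eq0.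
rewrite -(ord_preimage has_order_ex) // fD //; exact: place_preimage.
Qed.

Lemma frob_divisor_act_divisor h D : is_divisor iota [set: E] D ->
  is_divisor iota [set: E] (frob_divisor (g h) D).
Proof.
move=> [Dfin Dp]; split; first exact: (frob_divisor_finite_support (act_surj g_act h)).
by move=> V DV; apply/(place_actE g_act gC h); apply: Dp.
Qed.

Section Tate.
Variable l : nat.
Variables (r : nat) (e : 'I_r -> nat -> set E -> int).
Hypothesis e_basis : is_tate_basis iota [set: E] l e.

Let e_tate i : in_tate_module iota [set: E] l (e i). Proof. by case: e_basis. Qed.
Let e_div i n : is_divisor iota [set: E] (e i n). Proof. by case: (e_tate i) => /(_ n)[]. Qed.

Lemma act_represented h : exists S, represents iota [set: E] l e e (frob_divisor (g h)) S.
Proof.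
apply: represents_exists => // i.
have surj := act_surj g_act h.
apply: (operator_tate (frob_operator surj _)) => // [c|D dD D0].
  by exists c; rewrite gC.
split; first exact: frob_divisor_act_divisor.
by rewrite degree_frob_divisor //; case: dD.
Qed.

Section Quotient.
Variable H : {group 'S_4}.
Hypothesis H_cyclic : cyclic H.
Variables (r' : nat) (e' : 'I_r' -> nat -> set E -> int).
Hypothesis e'_basis : is_tate_basis iota (fixed_by g H) l e'.

Let e'_tate i : in_tate_module iota (fixed_by g H) l (e' i). Proof. by case: e'_basis. Qed.
Let e'_div i n : is_divisor iota (fixed_by g H) (e' i n).
Proof. by case: (e'_tate i) => /(_ n)[]. Qed.

Lemma pullback_represented : exists P, represents iota [set: E] l e' e (pullback iota g H) P.
Proof.
apply: represents_exists => // i.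
apply: (operator_tate (pullback_operator H_cyclic)) => // D dD D0; split.
  exact: (pullback_divisor has_order_ex g_act gC).
by rewrite (degree_pullback has_order_ex g_act gC k24 H_cyclic) // D0 mul0rn.
Qed.

Lemma pushforward_represented : exists Q, represents iota (fixed_by g H) l e e' (pushforward g H) Q.
Proof.
apply: represents_exists => // i.
apply: (operator_tate (pushforward_operator H_cyclic)) => // D dD D0; split.
  exact: (pushforward_divisor has_order_ex g_act gC k24 H_cyclic).
by rewrite (degree_pushforward (iota := iota)).
Qed.

Variable phi : {rmorphism E -> E}.
Hypothesis phi_surj : forall a, exists b, phi b = a.
Hypothesis phi_const : forall c, exists d, phi (iota c) = iota d.
Hypothesis phi_const_inv : forall c, exists d, phi (iota d) = iota c.
Hypothesis phi_comm : forall h a, g h (phi a) = phi (g h a).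
Variables (A : nat -> 'M[int]_r) (A' : nat -> 'M[int]_r') (S : 'S_4 -> nat -> 'M[int]_r).
Hypothesis A_rep : represents iota [set: E] l e e (frob_divisor phi) A.
Hypothesis A'_rep : represents iota (fixed_by g H) l e' e' (frob_divisor phi) A'.
Hypothesis S_rep : forall h, represents iota [set: E] l e e (frob_divisor (g h)) (S h).

Lemma quotient_trace n m : (1 < l ^ n)%N ->
  #|H|%:R * \tr (map_mx (intr : int -> 'Z_(l ^ n)) (A' n) ^+ m) =
  \tr (map_mx intr (A n) ^+ m *m \sum_(h in H) map_mx intr (S h n)).
Proof.
move=> ln1; have subT := principal_subgroupT; have subH := principal_subgroup_fixed H_cyclic.
have [P P_rep] := pullback_represented; have [Q Q_rep] := pushforward_represented.
have pbC := pullback_operator H_cyclic; have pfC := pushforward_operator H_cyclic.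
have frC := frob_operator phi_surj phi_const.
have pbdiv i n' : is_divisor iota [set: E] (pullback iota g H (e' i n')).
  exact: (pullback_divisor has_order_ex g_act gC).
have -> : \sum_(h in H) map_mx (intr : int -> 'Z_(l ^ n)) (S h n) =
    map_mx intr (Q n) *m map_mx intr (P n).
  have rep1 := represents_comp subT pbC (fun _ _ => I) (fun _ _ => I) Q_rep P_rep.
  have rep2 := represents_sum subT (fun h (_ : h \in H) => S_rep h).
  rewrite -map_mxM (represents_red subT e_basis rep1 rep2 _ ln1) ?raddf_sum // => i n' /=.
  exact: (pullback_pushforward has_order_ex g_act gC).
apply: trace_quotient; rewrite -!map_mxM.
  have rep1 := represents_comp subH pfC pbdiv e_div P_rep Q_rep.
  have rep2 := representsMn #|H| subH (represents_id l e' subH).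
  rewrite (represents_red subH e'_basis rep1 rep2 _ ln1).
    by rewrite raddfMn /= map_mx1 -scaler_nat scalemx1.
  by move=> i n' /=; rewrite (pushforward_pullback has_order_ex g_act gC k24 H_cyclic).
have rep1 := represents_comp subT pbC (fun _ _ => I) (fun _ _ => I) A'_rep P_rep.
have rep2 := represents_comp subT frC (fun _ _ => I) (fun _ _ => I) P_rep A_rep.
apply: (represents_red subT e_basis rep1 rep2 _ ln1) => i n' /=.
exact: pullback_frobenius.
Qed.

End Quotient.
Variable phi : {rmorphism E -> E}.
Hypothesis phi_surj : forall a, exists b, phi b = a.
Hypothesis phi_const : forall c, exists d, phi (iota c) = iota d.
Hypothesis phi_comm : forall h a, g h (phi a) = phi (g h a).
Variables (A : nat -> 'M[int]_r) (S : 'S_4 -> nat -> 'M[int]_r).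
Hypothesis A_rep : represents iota [set: E] l e e (frob_divisor phi) A.
Hypothesis S_rep : forall h, represents iota [set: E] l e e (frob_divisor (g h)) (S h).
Variable C : nat.
Hypothesis l_gt0 : (0 < l)%N.
Hypothesis klein_torsion : forall (D : set E -> int) (N : nat) f, (0 < N)%N -> f != 0 ->
  (forall W, place W -> ord W f = D W * N%:Z) ->
  exists G, G != 0 /\ forall W, place W ->
    ord W G = (\sum_(h in klein) D (g h @^-1` W)) * C%:Z.

Lemma reduced_traces n m : (1 < l ^ n)%N ->
  C%:R * (24%:R * \tr (map_mx (intr : int -> 'Z_(l ^ n)) (A n) ^+ m)) =
  C%:R * (12%:R * \tr (map_mx (intr : int -> 'Z_(l ^ n)) (A n) ^+ m
        *m \sum_(h in <[cycle12]>%g) map_mx intr (S h n))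
    + 8%:R * \tr (map_mx (intr : int -> 'Z_(l ^ n)) (A n) ^+ m
        *m \sum_(h in <[cycle123]>%g) map_mx intr (S h n))
    + 6%:R * \tr (map_mx (intr : int -> 'Z_(l ^ n)) (A n) ^+ m
        *m \sum_(h in <[cycle1234]>%g) map_mx intr (S h n))).
Proof.
move=> ln1; have subT := principal_subgroupT.
have frC := frob_operator phi_surj phi_const.
have gfrC h : class_operator iota [set: E] [set: E] (fun=> True) (frob_divisor (g h)).
  by apply: frob_operator; [exact: act_surj|move=> c; exists c; rewrite gC].
pose trivC := fun (_ : 'I_r) (_ : nat) => I.
apply: (S4_traces (S := fun h => map_mx intr (S h n))) => [h|t h||].
- rewrite -!map_mxM.
  have rep1 := represents_comp subT frC trivC trivC (S_rep h) A_rep.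
  have rep2 := represents_comp subT (gfrC h) trivC trivC A_rep (S_rep h).
  apply: (represents_red subT e_basis rep1 rep2 _ ln1) => i n' /=.
  by apply: funext => W; congr (e i n'); apply/seteqP; split=> a /=; rewrite phi_comm.
- rewrite -!map_mxM.
  have rep1 := represents_comp subT (gfrC h) trivC trivC (S_rep t) (S_rep h).
  apply: (represents_red subT e_basis (S_rep _) rep1 _ ln1) => i n' /=.
  by apply: funext => W; rewrite /frob_divisor (place_actM g_act).
- rewrite -[RHS](map_mx1 (intr : {rmorphism int -> 'Z_(l ^ n)})).
  apply: (represents_red subT e_basis (S_rep _) (represents_id l e subT) _ ln1) => i n' /=.
  by apply: funext => W; rewrite /frob_divisor (place_act1 g_act).
have rep1 := representsMn C subT (represents_sum subT (fun h (_ : h \in klein) => S_rep h)).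
(* The level-n' component of a Tate module element is killed by l^n', so C times its sum of
   conjugates under V is principal, with C the same at all levels. *)
have rep0 : represents iota [set: E] l e e
    (fun D => (\sum_(h in klein) frob_divisor (g h) D) *+ C) (fun=> 0).
  apply: represents0 => i n'; have := tate_torsion subT n' (e_tate i).
  move=> /principalTE[f [f0 fD]]; apply/principalTE.
  have [||G [G0 GD]] := @klein_torsion (e i n') (l ^ n') f _ f0.
  - by rewrite expn_gt0 l_gt0.
  - by move=> W Wp; rewrite fD // natmulfctE -mulr_natr natz.
  exists G; split=> // W Wp; rewrite GD // natmulfctE fct_sumE.
  by rewrite -[RHS]mulr_natr natz.
have := represents_red subT e_basis rep1 rep0 (fun _ _ => erefl) ln1.
by rewrite map_mx0 raddfMn raddf_sum /= scaler_nat.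
Qed.
End Tate.
End Assembly.

Lemma map_mxX (R R' : pzRingType) (f : {rmorphism R -> R'}) r (A : 'M[R]_r) m :
  map_mx f (A ^+ m) = map_mx f A ^+ m.
Proof.
elim: m => [|m IHm]; first by rewrite !expr0 map_mx1.
by rewrite !exprS -[A * _]/(A *m _) map_mxM IHm.
Qed.

Lemma coef_eqz_modM (d : int) (f f' h h' : {poly int}) :
  (forall m, f`_m = f'`_m %[mod d])%Z -> (forall m, h`_m = h'`_m %[mod d])%Z ->
  forall m, ((f * h)`_m = (f' * h')`_m %[mod d])%Z.
Proof.
move=> ff' hh' m; apply/eqP; rewrite eqz_mod_dvd !coefM -sumrB; apply: rpred_sum => i _.
have -> : f`_i * h`_(m - i) - f'`_i * h'`_(m - i) =
  (f`_i - f'`_i) * h`_(m - i) + f'`_i * (h`_(m - i) - h'`_(m - i)) by ring.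
have dvd_sub (a b : int) : (a = b %[mod d])%Z -> (d %| a - b)%Z.
  by move=> ab; rewrite -eqz_mod_dvd; apply/eqP.
by apply: rpredD; [apply: dvdz_mulr|apply: dvdz_mull]; apply: dvd_sub.
Qed.

Lemma pchar_natr_neq0 (p n : nat) (R : nzRingType) : p \in [pchar R] ->
  coprime p n -> n%:R != 0 :> R.
Proof.
move=> pR; rewrite prime_coprime ?(pcharf_prime pR) //; apply: contra => n0.
by rewrite (dvdn_pcharf pR).
Qed.

Theorem theorem7p1
  (p : nat) (p_prime : prime p) (p_ge5 : (5 <= p)%N)
  (* the curve C over the rationals, with the action of S_4 *)
  (K : fieldType) (iotaQ : {rmorphism rat -> K}) (X : 'I_4 -> K)
  (K_C : function_field_of_C iotaQ X)
  (tau : 'S_4 -> {rmorphism K -> K})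
  (tauP : forall s : 'S_4, permutes_coordinates X s (tau s))
  (* its reduction modulo p, over an algebraic closure of F_p *)
  (k : closedFieldType) (k_Fpbar : algebraic_closure_of_Fp p k)
  (E : fieldType) (iota : {rmorphism k -> E}) (x : 'I_4 -> E)
  (E_C : function_field_of_C iota x)
  (phi : {rmorphism E -> E}) (phiP : is_frobenius p iota x phi)
  (l : nat) (l_prime : prime l) (l_neq_p : l != p)
  (L_C L_12 L_123 L_1234 : {poly int})
  (L_CP : is_L_poly iota phi
     (reduction X x (fixed_subfield (tau 1%g))) l L_C)
  (L_12P : is_L_poly iota phi
     (reduction X x (fixed_subfield (tau cycle12))) l L_12)
  (L_123P : is_L_poly iota phi
     (reduction X x (fixed_subfield (tau cycle123))) l L_123)
  (L_1234P : is_L_poly iota phi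
     (reduction X x (fixed_subfield (tau cycle1234))) l L_1234) :
  L_C = L_12 * L_123 * L_1234.
Proof.
have [pk k_fin] := k_Fpbar.
have k_neq0 n : coprime p n -> n%:R != 0 :> k := pchar_natr_neq0 pk.
have p_cop n : (0 < n < 5)%N -> coprime p n.
  move=> n5; rewrite prime_coprime //; apply/negP => /dvdn_leq; lia.
have k2 := k_neq0 2%N (p_cop 2%N isT); have k3 := k_neq0 3%N (p_cop 3%N isT).
have k24 : 24%:R != 0 :> k by apply: k_neq0; rewrite -[24%N]/(2 * 3 * 4)%N !coprimeMr !p_cop.
have [g [g_act gC gx]] := ff_automorphisms_exist E_C.
have g_faithful s := ff_faithful E_C (gx s).
have gen := klein_fixed_generated E_C k2 k3 g_act gC gx.
have order_ex := fun W Wp => @has_order_exists _ _ _ _ _ _ g_act gen W Wp.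
have residue_ex := fun W Wp => @residue_exists _ _ _ _ _ _ g_act gen W Wp.
have klein_torsion := norm_torsion_principal g_act gC gen (klein_coord_not_constant E_C).
have phi_surj := frobenius_surjective k_Fpbar E_C phiP.
have phi_const c : exists d, phi (iota c) = iota d.
  by exists (c ^+ p); rewrite phiP.1 rmorphXn.
have phi_const_inv c : exists d, phi (iota d) = iota c.
  have [[|n] // _ cn] := k_fin c; exists (c ^+ (p ^ n)).
  by rewrite phiP.1 -rmorphXn -exprM -expnSr cn.
have phi_comm h a : g h (phi a) = phi (g h a) := frobenius_commutes E_C phiP (gC h) (gx h) a.
have redE s := reduction_fixedE p_prime p_ge5 K_C E_C pk (tauP s) g_act gC gx k24.
(* All four L-polynomials now belong to fixed fields inside E. *)
move: L_CP L_12P L_123P L_1234P; rewrite /is_L_poly !redE fixed_by_cycle1 //.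
move=> [f [r [e [A [e_basis Al AE [f_monic sf] fA]]]] ->].
move=> [f1 [r1 [e1 [A1 [e1_basis A1l A1E [f1_monic sf1] fA1]]]] ->].
move=> [f2 [r2 [e2 [A2 [e2_basis A2l A2E [f2_monic sf2] fA2]]]] ->].
move=> [f3 [r3 [e3 [A3 [e3_basis A3l A3E [f3_monic sf3] fA3]]]] ->].
have [S S_rep] := choice (act_represented order_ex residue_ex g_act gC g_faithful k24 e_basis).
have f12_monic : f1 * f2 \is monic by rewrite rpredM.
rewrite -!reciprocal_polyM //; congr reciprocal_poly.
pose B n := block_mx (block_mx (A1 n) 0 0 (A2 n)) 0 0 (A3 n).
(* The factorial comes from the torsion relation for V, and 24 from the relation between class
   functions. *)
apply: (@eq_poly_of_traces l ((#|klein|)`! * 24) _ _ _ _ A B) => //.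
- exact: prime_gt1.
- by rewrite muln_gt0 fact_gt0.
- by rewrite rpredM.
- by rewrite !size_monicM ?monic_neq0 // sf1 sf2 sf3 !addnS.
- move=> n; rewrite !char_poly_block_diag; apply: coef_eqz_modM => //.
  exact: coef_eqz_modM.
(* For n = 0 divisibility by 1 is trivial; all other cases are computed in Z/l^n. *)
move=> n m; have [ln1|] := ltnP 1 (l ^ n); last first.
  rewrite leq_eqVlt ltnS leqn0 expn_eq0 => /orP[/eqP->|/andP[/eqP l0]]; first exact: dvd1z.
  by rewrite l0 in l_prime.
have A_rep : represents iota [set: E] l e e (frob_divisor phi) A by [].
have frob_trace s r' (e' : 'I_r' -> nat -> set E -> int) A'
    (e'_basis : is_tate_basis iota (fixed_by g <[s]>%G) l e')
    (A'_rep : represents iota (fixed_by g <[s]>%G) l e' e' (frob_divisor phi) A') :=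
  quotient_trace order_ex residue_ex g_act gC g_faithful k24 e_basis (cycle_cyclic s)
    e'_basis phi_surj phi_const phi_const_inv phi_comm A_rep A'_rep S_rep m ln1.
have trace1 := frob_trace _ _ _ _ e1_basis (conj A1l A1E).
have trace2 := frob_trace _ _ _ _ e2_basis (conj A2l A2E).
have trace3 := frob_trace _ _ _ _ e3_basis (conj A3l A3E).
have := reduced_traces order_ex residue_ex g_act gC g_faithful k24 e_basis
  phi_surj phi_const phi_comm A_rep S_rep (prime_gt0 l_prime) klein_torsion m ln1.
have [o1 o2 o3] : [/\ #[cycle12] = 2, #[cycle123] = 3 & #[cycle1234] = 4]%g%N := order_cycles.
(* The coefficients become 12 * 2 = 8 * 3 = 6 * 4 = 24, so the right side is the trace of the power
   of the block matrix times the same factor as on the left. *)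
rewrite -trace1 -trace2 -trace3 -[#|<[cycle12]>%G|]/(#[cycle12]%g) o1.
rewrite -[#|<[cycle123]>%G|]/(#[cycle123]%g) o2 -[#|<[cycle1234]>%G|]/(#[cycle1234]%g) o3.
rewrite -(intr_Zp_eq0 _ ln1) rmorphM /= -pmulrn natrM /B !exp_block_diag !mxtrace_block.
rewrite rmorphB !rmorphD /= -!trace_map_mx !map_mxX /= -mulrA mulrBr.
by move=> trE; rewrite mulrBr subr_eq0; apply/eqP; apply: (etrans trE); ring.
Qed.
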